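(* Let $d\in\{2,3\}$, $\kappa>0$, $T>0$, and let $\mathbb{S}$ and $p(\cdot)$ satisfy the structural assumptions listed in the context. Let $(\varrho,u)$ be a (sufficiently regular) weak solution on $[0,T]\times\mathbb{T}^d$ to $$\partial_t\varrho+\mathrm{div}(\varrho u)=0,\qquad \partial_t(\varrho u)+\mathrm{div}(\varrho u\otimes u)-\mathrm{div}(\varrho\,\mathbb{S}(\mathbb{D}u))+\nabla p(\varrho)-\kappa\,\mathrm{div}(\varrho\nabla^2\ln\varrho)=0$$ with $\varrho|_{t=0}=\varrho_0$, $(\varrho u)|_{t=0}=\varrho_0u_0$, satisfying the energy inequality $$E(t)+\int_0^t\int_{\mathbb{T}^d}\varrho\,\mathbb{S}(\mathbb{D}u):\mathbb{D}u\,\mathrm{d}x\,\mathrm{d}s\le E(0).$$ Then, for all smooth $(r,v)$ with $r>0$, the relative entropy $\mathcal{E}(t)=\mathcal{E}[(\varrho,u)|(r,v)](t)$ satisfies $$\begin{aligned}\mathcal{E}(t)-\mathcal{E}(0)\le{}&\int_0^t\int_{\mathbb{T}^d}\varrho(u-v)\otimes(\nabla\ln\varrho-\nabla\ln r):\mathbb{S}(\mathbb{D}v)\,\mathrm{d}x\,\mathrm{d}s\\&-\int_0^t\int_{\mathbb{T}^d}\varrho(u-v)\otimes(u-v):\nabla v\,\mathrm{d}x\,\mathrm{d}s\\&-\kappa\int_0^t\int_{\mathbb{T}^d}\varrho(\nabla\ln\varrho-\nabla\ln r)\otimes(\nabla\ln\varrho-\nabla\ln r):\nabla v\,\mathrm{d}x\,\mathrm{d}s\\&-\int_0^t\int_{\mathbb{T}^d}\varrho(u-v)\cdot\Big[\partial_tv+(v\cdot\nabla)v-\frac1r\mathrm{div}(r\mathbb{S}(\mathbb{D}v))+\frac1r\nabla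 p(r)-\kappa\frac1r\mathrm{div}(r\nabla^2\ln r)\Big]\,\mathrm{d}x\,\mathrm{d}s\\&-\kappa\int_0^t\int_{\mathbb{T}^d}\varrho(\nabla\ln\varrho-\nabla\ln r)\cdot\Big[\partial_t\nabla\ln r+(v\cdot\nabla)\nabla\ln r+\frac1r\mathrm{div}(r(\nabla v)^T)\Big]\,\mathrm{d}x\,\mathrm{d}s\\&-\int_0^t\int_{\mathbb{T}^d}(\varrho-r)\big[\partial_tH'(r)+v\cdot\nabla H'(r)+p'(r)\,\mathrm{div}\,v\big]\,\mathrm{d}x\,\mathrm{d}s\\&-\int_0^t\int_{\mathbb{T}^d}\big(p(\varrho)-p(r)-p'(r)(\varrho-r)\big)\,\mathrm{div}\,v\,\mathrm{d}x\,\mathrm{d}s.\end{aligned}$$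
   Context: Notation. $\mathbb{T}^d$ is the $d$-dimensional flat torus (periodic boundary conditions). For a vector field $u$, $\nabla u=(\partial_ju_i)_{i,j}$, $\mathbb{D}u=\frac12(\nabla u+(\nabla u)^T)$; $u\otimes v=(u_jv_i)_{i,j}$; the divergence of a matrix field is taken row-wise, $(\mathrm{div}A)_i=\sum_j\partial_jA_{ij}$; $A:B=\sum_{i,j}A_{ij}B_{ij}$; $((v\cdot\nabla)w)_i=\sum_jv_j\partial_jw_i$. Initial data: $\varrho_0\ge0$, $\sqrt{\varrho_0}\in H^1(\mathbb{T}^d)$, $\sqrt{\varrho_0}u_0\in L^2(\mathbb{T}^d)$. Assumptions on $\mathbb{S}$. $\mathbb{S}:\mathbb{R}^{d\times d}_{\mathrm{sym}}\to\mathbb{R}^{d\times d}_{\mathrm{sym}}$ is differentiable and, for some exponent $p\ge1$ (a number, not to be confused with the pressure function $p(\cdot)$) and constants $C,c,c_1>0$: $|\mathbb{S}(A)|\le C|A|^{p-1}$ for all $A$; $\mathbb{S}(A):A\ge c|A|^p$ if $|A|>c_1$; and $(\mathbb{S}(A)-\mathbb{S}(B)):(A-B)\ge0$ for all $A,B\in\mathbb{R}^{d\times d}_{\mathrm{sym}}$. Assumptions on the pressure. $p(\cdot)\in C([0,\infty))\cap C^2((0,\infty))$, $p(0)=0$, $p'>0$, and $a\varrho^{\gamma-1}-b\le p'(\varrho)\le\frac1a\varrho^{\gamma-1}+b$ for some constants $a,b>0$ and some $\gamma>1$. Energy and relative entropy. $H(\varrho)=\varrho\int_{\bar\varrho}^{\varrho}\frac{p(s)}{s^2}\,\mathrm{d}s$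 with $\bar\varrho$ a constant reference state, $H(\varrho|r)=H(\varrho)-H(r)-H'(r)(\varrho-r)$, $$E(t)=\frac12\int_{\mathbb{T}^d}\big(\varrho|u|^2+\kappa\varrho|\nabla\ln\varrho|^2\big)\,\mathrm{d}x+\int_{\mathbb{T}^d}H(\varrho)\,\mathrm{d}x,$$ $$\mathcal{E}(t)=\frac12\int_{\mathbb{T}^d}\big(\varrho|u-v|^2+\kappa\varrho|\nabla\ln\varrho-\nabla\ln r|^2\big)\,\mathrm{d}x+\int_{\mathbb{T}^d}H(\varrho|r)\,\mathrm{d}x.$$ A weak solution is a pair $(\varrho,u)$, $\varrho\ge0$, satisfying both equations in the sense of distributions together with the initial conditions; ''sufficiently regular'' means regular enough that all integrals in the statement are well defined and that the equations can be tested with smooth functions and the terms integrated by parts against smooth functions. *)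

(* Defs.v *)
From HB Require Import structures.
From mathcomp Require Import all_boot all_order all_algebra.
From mathcomp Require Import all_classical all_reals all_analysis.

Set Implicit Arguments.
Unset Strict Implicit.
Unset Printing Implicit Defensive.

Import Order.TTheory GRing.Theory Num.Theory.
Import numFieldNormedType.Exports.

Local Open Scope classical_set_scope.
Local Open Scope ring_scope.

Section MatrixAlgebra.
Context {R : realType} {d : nat}.
Implicit Types (a b : 'rV[R]_d) (A B : 'M[R]_d).

Definition dotv a b : R := \sum_i a 0 i * b 0 i.

(* Beware of the index order: (a (x) b)_ij = a_j b_i. *)
Definition tensor a b : 'M[R]_d := \matrix_(i, j) (a 0 j * b 0 i).

Definition ddot A B : R := \sum_i \sum_j A i j * B i j.

Definition fnorm A : R := Num.sqrt (ddot A A).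

Definition sym_mx A : Prop := A^T = A.

Definition sympart A : 'M[R]_d := 2^-1 *: (A + A^T).

End MatrixAlgebra.

Section SpatialCalculus.
Context {R : realType} {d : nat}.
Local Notation X := 'rV[R]_d.

Definition pd (j : 'I_d) (f : X -> R) (x : X) : R := 'D_(delta_mx 0 j) f x.

Definition grad (f : X -> R) (x : X) : 'rV[R]_d := \row_j pd j f x.

Definition gradv (w : X -> 'rV[R]_d) (x : X) : 'M[R]_d :=
  \matrix_(i, j) pd j (fun y => w y 0 i) x.

Definition symgrad (w : X -> 'rV[R]_d) (x : X) : 'M[R]_d :=
  sympart (gradv w x).

Definition divv (w : X -> 'rV[R]_d) (x : X) : R :=
  \sum_j pd j (fun y => w y 0 j) x.

Definition divm (A : X -> 'M[R]_d) (x : X) : 'rV[R]_d :=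
  \row_i \sum_j pd j (fun y => A y i j) x.

Definition laplv (w : X -> 'rV[R]_d) (x : X) : 'rV[R]_d := divm (gradv w) x.

Definition hess (f : X -> R) (x : X) : 'M[R]_d := gradv (grad f) x.

Definition advect (a : 'rV[R]_d) (w : X -> 'rV[R]_d) (x : X) : 'rV[R]_d :=
  \row_i \sum_j a 0 j * pd j (fun y => w y 0 i) x.

(* Functions on the torus R^d / Z^d are the Z^d-periodic functions on R^d. *)
Definition tperiodic (V : Type) (f : X -> V) : Prop :=
  forall x j, f (x + delta_mx 0 j) = f x.

End SpatialCalculus.

Section SpaceTimeCalculus.
Context {R : realType} {d : nat}.
Local Notation X := 'rV[R]_d.

Definition dt (f : R -> X -> R) (t : R) (x : X) : R :=
  derive1 (fun s => f s x) t.

Definition dtv (w : R -> X -> 'rV[R]_d) (t : R) (x : X) : 'rV[R]_d :=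
  \row_i dt (fun s y => w s y 0 i) t x.

Fixpoint Ck (k : nat) (f : R -> X -> R) : Prop :=
  continuous (fun z : R * X => f z.1 z.2) /\
  if k is k'.+1 then
    [/\ forall t x, derivable (fun s => f s x) t 1,
        forall j t x, derivable (f t) x (delta_mx 0 j),
        Ck k' (dt f)
      & forall j, Ck k' (fun t => pd j (f t))]
  else True.

(* A smooth function on [0, T] x T^d is the restriction of a smooth function
   on R x T^d (and a positive one of a positive one). *)
Definition smooth (f : R -> X -> R) : Prop :=
  (forall k, Ck k f) /\ (forall t, tperiodic (f t)).

Definition smoothv (w : R -> X -> 'rV[R]_d) : Prop :=
  forall i, smooth (fun t x => w t x 0 i).

End SpaceTimeCalculus.

Section TorusMeasure.
Context (R : realType).
Local Notation RL := (measurableTypeR R).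

Definition consp n (z : RL * n.-tuple RL) : n.+1.-tuple RL :=
  [tuple of z.1 :: z.2].

Lemma measurable_consp n : measurable_fun [set: RL * n.-tuple RL] (@consp n).
Proof. exact: measurable_cons. Qed.

HB.instance Definition _ n :=
  @isMeasurableFun.Build _ _ _ _ (@consp n) (@measurable_consp n).

(* Lebesgue measure on the unit cell [0, 1]^n. *)
Fixpoint torus_measure (n : nat) : probability (n.-tuple RL) R :=
  match n return probability (n.-tuple RL) R with
  | 0 => dirac [tuple]
  | n'.+1 => distribution
      (uniform_prob (@ltr01 R) \x torus_measure n')%E (@consp n')
  end.

End TorusMeasure.

Section Integration.
Context {R : realType} {d : nat}.
Local Notation X := 'rV[R]_d.
Local Notation lambda := (@lebesgue_measure R).
Local Notation mu := (torus_measure R d).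

Definition cellpt (z : d.-tuple (measurableTypeR R)) : X := \row_i tnth z i.

Definition torus_int (f : X -> R) : R := \int[mu]_z f (cellpt z).

Definition st_int (t : R) (f : R -> X -> R) : R :=
  \int[lambda]_(s in `[0, t]) torus_int (f s).

Definition tL1 (f : X -> R) : Prop :=
  mu.-integrable setT (fun z => (f (cellpt z))%:E).

Definition tL2 (f : X -> R) : Prop :=
  measurable_fun setT (f \o cellpt) /\ tL1 (fun x => f x ^+ 2).

Definition stL1 (T : R) (f : R -> X -> R) : Prop :=
  (lambda \x mu)%E.-integrable (`[0, T] `*` setT)
    (fun z => (f z.1 (cellpt z.2))%:E).

Definition stL2 (T : R) (f : R -> X -> R) : Prop :=
  measurable_fun (`[0, T] `*` setT)
    (fun z : measurableTypeR R * d.-tuple (measurableTypeR R) =>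
      f z.1 (cellpt z.2)) /\
  stL1 T (fun t x => f t x ^+ 2).

(* Weak gradient on the torus.  The test functions are all those which are
   differentiable and for which both integrals exist: S being differentiable
   but not necessarily C^1, a field of the form S(Dv) with v smooth is only
   known to be of that kind.  For f and g in L^1 this is equivalent to testing
   with C^infinity functions (f is absolutely continuous on almost every
   line). *)
Definition weak_grad (f : X -> R) (g : X -> 'rV[R]_d) : Prop :=
  [/\ tL1 f, forall j, tL1 (fun x => g x 0 j) &
  forall (psi : X -> R) (j : 'I_d),
    (forall x, differentiable psi x) -> tperiodic psi ->
    tL1 (fun x => f x * pd j psi x) -> tL1 (fun x => g x 0 j * psi x) ->
    torus_int (fun x => f x * pd j psi x) =
    - torus_int (fun x => g x 0 j * psi x)].

Definition tH1 (f : X -> R) : Prop :=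
  tL2 f /\ exists g, weak_grad f g /\ forall j, tL2 (fun x => g x 0 j).

(* Where rho may vanish, grad (ln rho) and grad u are given their usual
   meaning in degenerate compressible fluids, through the identities
     grad rho = rho grad (ln rho),
     d_j (rho u_i) = rho d_j u_i + u_i rho d_j (ln rho);
   this determines L and G almost everywhere on {rho > 0}, and both are only
   ever used multiplied by rho. *)
Definition log_grad (rho : X -> R) (L : X -> 'rV[R]_d) : Prop :=
  weak_grad rho (fun x => rho x *: L x).

Definition velocity_grad (rho : X -> R) (L u : X -> 'rV[R]_d)
    (G : X -> 'M[R]_d) : Prop :=
  forall i, weak_grad (fun x => rho x * u x 0 i)
    (fun x => rho x *: (row i (G x) + u x 0 i *: L x)).

End Integration.

Section Constitutive.
Context {R : realType}.

(* S is only relevant on symmetric matrices; S \o sympart being differentiable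
   on all matrices is differentiability of S on the space of symmetric ones. *)
Definition stress_law (d : nat) (S : 'M[R]_d -> 'M[R]_d) : Prop :=
  [/\ forall A, sym_mx A -> sym_mx (S A),
      forall A : 'M[R]_d, differentiable (S \o sympart) A,
      exists q C c c1 : R,
        [/\ 1 <= q, [/\ 0 < C, 0 < c & 0 < c1],
            forall A, sym_mx A -> fnorm (S A) <= C * fnorm A `^ (q - 1)
          & forall A, sym_mx A -> c1 < fnorm A ->
              c * fnorm A `^ q <= ddot (S A) A]
    & forall A B, sym_mx A -> sym_mx B ->
        0 <= ddot (S A - S B) (A - B)].

Definition pressure_law (p : R -> R) : Prop :=
  [/\ {within `[0, +oo[, continuous p},
      forall s, 0 < s ->
        [/\ derivable p s 1, derivable (derive1 p) s 1
          & {for s, continuous (derive1 (derive1 p))}],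
      p 0 = 0,
      forall s, 0 < s -> 0 < derive1 p s
    & exists a b gamma : R, [/\ 0 < a, 0 < b, 1 < gamma
      & forall s, 0 < s ->
          a * s `^ (gamma - 1) - b <= derive1 p s
          /\ derive1 p s <= a^-1 * s `^ (gamma - 1) + b]].

Definition oriented_int (a b : R) (f : R -> R) : R :=
  if a <= b then \int[lebesgue_measure]_(s in `[a, b]) f s
  else - \int[lebesgue_measure]_(s in `[b, a]) f s.

(* The factor s gives H(0) = 0, the limit of H at 0, whether or not the integral
   down to 0 converges. *)
Definition Hpot (p : R -> R) (rbar s : R) : R :=
  s * oriented_int rbar s (fun z => p z / z ^+ 2).

Definition Hrel (p : R -> R) (rbar s r : R) : R :=
  Hpot p rbar s - Hpot p rbar r - derive1 (Hpot p rbar) r * (s - r).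

End Constitutive.

Section Energy.
Context {R : realType} {d : nat}.
Local Notation X := 'rV[R]_d.
Variables (kappa : R) (p : R -> R) (rbar : R).

Definition energy (rho : X -> R) (u L : X -> 'rV[R]_d) : R :=
  2^-1 * torus_int (fun x =>
    rho x * dotv (u x) (u x) + kappa * rho x * dotv (L x) (L x))
  + torus_int (fun x => Hpot p rbar (rho x)).

Definition grad_ln (r : X -> R) (x : X) : 'rV[R]_d :=
  grad (fun y => ln (r y)) x.

Definition rel_energy (rho : X -> R) (u L : X -> 'rV[R]_d)
    (r : X -> R) (v : X -> 'rV[R]_d) : R :=
  2^-1 * torus_int (fun x =>
    rho x * dotv (u x - v x) (u x - v x)
    + kappa * rho x * dotv (L x - grad_ln r x) (L x - grad_ln r x))
  + torus_int (fun x => Hrel p rbar (rho x) (r x)).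

End Energy.

Section WeakSolution.
Context {R : realType} {d : nat}.
Local Notation X := 'rV[R]_d.

Definition test_function (T : R) (phi : R -> X -> R) : Prop :=
  smooth phi /\
  exists2 T', T' < T & forall t x, T' <= t -> phi t x = 0.

Definition initial_data (rho0 : X -> R) (u0 : X -> 'rV[R]_d) : Prop :=
  [/\ forall x, 0 <= rho0 x, tperiodic rho0, tperiodic u0,
      tH1 (fun x => Num.sqrt (rho0 x))
    & forall i, tL2 (fun x => Num.sqrt (rho0 x) * u0 x 0 i)].

Definition weak_continuity (T : R) (rho0 : X -> R)
    (rho : R -> X -> R) (u : R -> X -> 'rV[R]_d) : Prop :=
  forall phi, test_function T phi ->
    st_int T (fun t x =>
      rho t x * dt phi t x + rho t x * dotv (u t x) (grad (phi t) x))
    + torus_int (fun x => rho0 x * phi 0 x) = 0.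

(* rho (hess (ln rho)) is the distribution
   grad (rho grad (ln rho)) - rho grad (ln rho) (x) grad (ln rho). *)
Definition weak_momentum (T kappa : R) (S : 'M[R]_d -> 'M[R]_d) (p : R -> R)
    (rho0 : X -> R) (u0 : X -> 'rV[R]_d)
    (rho : R -> X -> R) (u L : R -> X -> 'rV[R]_d) (G : R -> X -> 'M[R]_d)
    : Prop :=
  forall phi : R -> X -> 'rV[R]_d,
    (forall i, test_function T (fun t x => phi t x 0 i)) ->
    st_int T (fun t x =>
      rho t x * dotv (u t x) (dtv phi t x)
      + rho t x * ddot (tensor (u t x) (u t x)) (gradv (phi t) x)
      - rho t x * ddot (S (sympart (G t x))) (gradv (phi t) x)
      + p (rho t x) * divv (phi t) x
      + kappa * (rho t x * dotv (L t x) (laplv (phi t) x)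
        + rho t x * ddot (tensor (L t x) (L t x)) (gradv (phi t) x)))
    + torus_int (fun x => rho0 x * dotv (u0 x) (phi 0 x)) = 0.

(* Arguments L0 and L stand for grad (ln rho0) and grad (ln rho), G for grad u. *)
Definition weak_solution (T kappa : R) (S : 'M[R]_d -> 'M[R]_d) (p : R -> R)
    (rho0 : X -> R) (u0 L0 : X -> 'rV[R]_d)
    (rho : R -> X -> R) (u L : R -> X -> 'rV[R]_d) (G : R -> X -> 'M[R]_d)
    : Prop :=
  [/\ forall t x, 0 <= t <= T -> 0 <= rho t x,
      forall t, 0 <= t <= T -> tperiodic (rho t) /\ tperiodic (u t),
      log_grad rho0 L0,
      {ae (@lebesgue_measure R), forall t, 0 <= t <= T ->
        log_grad (rho t) (L t) /\ velocity_grad (rho t) (L t) (u t) (G t)}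
    & weak_continuity T rho0 rho u /\
      weak_momentum T kappa S p rho0 u0 rho u L G].

(* Integrability of everything which is integrated, over the torus at time 0
   and over [0, T] x torus.  The last condition concerns the term
   div (r S(Dv)); it follows from the others when S is C^1. *)
Definition sufficiently_regular (T : R) (S : 'M[R]_d -> 'M[R]_d)
    (p : R -> R) (rbar : R) (rho0 : X -> R) (L0 : X -> 'rV[R]_d)
    (rho : R -> X -> R) (u L : R -> X -> 'rV[R]_d) (G : R -> X -> 'M[R]_d)
    : Prop :=
  [/\ (forall i, tL2 (fun x => Num.sqrt (rho0 x) * L0 x 0 i)) /\
      tL1 (fun x => Hpot p rbar (rho0 x)),
      [/\ stL2 T (fun t x => Num.sqrt (rho t x)),
          forall i, stL2 T (fun t x => Num.sqrt (rho t x) * u t x 0 i)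
        & forall i, stL2 T (fun t x => Num.sqrt (rho t x) * L t x 0 i)],
      stL1 T (fun t x => p (rho t x)) /\
      stL1 T (fun t x => Hpot p rbar (rho t x)),
      [/\ forall i j, stL1 T (fun t x => rho t x * G t x i j),
          forall i j, stL1 T (fun t x => rho t x * S (sympart (G t x)) i j)
        & stL1 T (fun t x => rho t x *
            ddot (S (sympart (G t x))) (sympart (G t x)))]
    & forall v : R -> X -> 'rV[R]_d, smoothv v -> forall i j,
        stL1 T (fun t x =>
          rho t x * pd j (fun y => S (symgrad (v t) y) i j) x) /\
        stL1 T (fun t x =>
          rho t x * u t x 0 i * pd j (fun y => S (symgrad (v t) y) i j) x)].

End WeakSolution.

(* Main.v *)
From HB Require Import structures.
Require Import Defs.
From mathcomp Require Import all_boot all_order all_algebra.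
From mathcomp Require Import all_classical all_reals all_analysis.
From mathcomp Require Import measurable_realfun.
From mathcomp Require Import ring lra.

Import Order.TTheory GRing.Theory Num.Theory.
Import numFieldNormedType.Exports.

Local Open Scope classical_set_scope.
Local Open Scope ring_scope.

Set Implicit Arguments.
Unset Strict Implicit.
Unset Printing Implicit Defensive.

(** Write [l] for [grad (ln r)], [h] for [H'], [U = u - v] and [M = L - l].

  When the squares are expanded, the relative energy differs from the energy only
  by terms that are linear in [rho], [rho u] or [rho L]: [H(rho|r)] is
  [H(rho) - rho h(r) + p(r)], and the integral of [rho L . l] is minus that of
  [rho div l], since [rho L] is the weak gradient of [rho] ([rel_energy_expand]).
  The increments of these linear terms are what the weak formulation computes: the
  momentum equation is tested with [v] ([momentum_identity]), the continuity
  equation with [|v|^2 / 2], [kappa div l], [kappa |l|^2 / 2] and [h(r)]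
  ([smooth_continuity], [C1_continuity]).  Together with the energy inequality this
  bounds the increment of the relative energy by the integral of an explicit
  [energy_rate] ([rel_energy_balance]).

  The right-hand side of the theorem has another integrand.  At each point of
  space-time it exceeds [energy_rate] by [rho (S(Du) - S(Dv)) : (Du - Dv)], which is
  nonnegative because [S] is monotone, plus three terms ([rate_identity]) whose
  integral over the torus vanishes at almost every time:
  - [div (rho A^T U)] with [A = S(Dv)], expanded by the identities that define [G]
    and [L] ([stress_null]);
  - [kappa div (rho xi)], where [xi] is the [capillary_field] built from [l] and [v]
    ([log_grad_ibp]); that [div xi] contains no product of derivatives of [l] and [v]
    rests on the symmetry of second derivatives ([divv_bracket], [divv_laplv]);
  - [div (p(r) v)], by the divergence theorem ([pressure_flux]).

  Three points need care.  Test functions vanish before the final time, so that an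
  identity at time [a] is obtained from smooth approximations of the ramp
  [(a - s)_+] by passing to the limit and differentiating in [a] at Lebesgue points
  ([time_primitive], [weak_time]).  Next, [h] is only of class [C^2] and [h(r)] not
  itself a test function: it is approximated in [C^1] by polynomials in [r].  Finally
  [S] is only differentiable, so that derivatives of [S(Dv)] need not be continuous;
  they are integrated by parts only against [rho] and [rho u], whose weak gradients
  admit test functions of that generality. *)

(** * Directional derivatives and total differentiability *)

Lemma continuous_sum {R : realType} (V : normedModType R) (T : topologicalType) (I : Type) (r : seq I)
    (F : I -> T -> V) : (forall i, continuous (F i)) ->
  continuous (fun x => \sum_(i <- r) F i x).
Proof.
by move=> cF; apply: continuous_big => [|i _]; [exact: add_continuous|exact: cF].
Qed.

Section Lines.
Context {R : realType} {V : normedModType R}.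
Implicit Types (f : V -> R) (x v w : V).

Lemma is_derive_line f x v (a : R) : derivable f (a *: v + x) v ->
  is_derive a 1 (fun s : R => f (s *: v + x)) ('D_v f (a *: v + x)).
Proof.
have E : (fun h : R => h^-1 *: (((fun s : R => f (s *: v + x)) \o shift a) (h *: 1) -
       f (a *: v + x))) = (fun h : R => h^-1 *: ((f \o shift (a *: v + x)) (h *: v) -
       f (a *: v + x))).
  apply/funext => h /=; congr (_ *: (f _ - _)).
  by rewrite /= [h *: 1]mulr1 scalerDl addrA.
move=> df; apply: DeriveDef; first by rewrite /derivable E.
by rewrite /derive E.
Qed.

Lemma continuous_line x v : continuous (fun s : R => s *: v + x).
Proof.
by move=> s; apply: cvgD; [apply: cvgZr_tmp; apply: cvg_id | apply: cvg_cst].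
Qed.

Lemma MVT_line f x v (a : R) : (forall y, derivable f y v) ->
  exists2 c : R, `|c| <= `|a| & f (a *: v + x) - f x = a * 'D_v f (c *: v + x).
Proof.
move=> df.
pose g (s : R) := f (s *: v + x).
have dg (s : R) : is_derive s 1 g ('D_v f (s *: v + x)) by exact: is_derive_line.
have cg : continuous g.
  move=> s; apply/differentiable_continuous/derivable1_diffP.
  exact: (@ex_derive _ _ _ _ _ _ _ (dg s)).
have [a0|a0] := leP 0 a.
  have [c] := MVT_segment a0 (fun s _ => dg s) (continuous_subspaceT cg).
  rewrite in_itv/= => /andP[c0 ca]; rewrite /g scale0r add0r subr0 => ->.
  by exists c; [rewrite !ger0_norm | rewrite mulrC].
have [c] := MVT_segment (ltW a0) (fun s _ => dg s) (continuous_subspaceT cg).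
rewrite in_itv/= => /andP[ca c0]; rewrite /g scale0r add0r sub0r mulrN => E.
exists c; first by rewrite !ler0_norm ?lerN2// ltW.
by apply: oppr_inj; rewrite opprB E mulrC.
Qed.

(** The two iterated derivatives are compared through the second difference
  quotient over a small parallelogram, which the mean value theorem evaluates
  as either of them at a nearby point. *)
Lemma derive_symmetric f v w x :
  (forall y, derivable f y v) -> (forall y, derivable f y w) ->
  (forall y, derivable ('D_v f) y w) -> (forall y, derivable ('D_w f) y v) ->
  {for x, continuous ('D_w ('D_v f))} -> {for x, continuous ('D_v ('D_w f))} ->
  'D_w ('D_v f) x = 'D_v ('D_w f) x.
Proof.
move=> dv dw dvw dwv cvw cwv.
have key (g : V -> R) (a b : V) (h : R) : h != 0 ->
    (forall y, derivable g y a) -> (forall y, derivable ('D_a g) y b) ->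
    exists c e : R, [/\ `|c| <= `|h|, `|e| <= `|h| &
     g (h *: a + (h *: b + x)) - g (h *: b + x) - (g (h *: a + x) - g x)
     = h ^+ 2 * 'D_b ('D_a g) (e *: b + (c *: a + x))].
  move=> h0 da dab.
  pose k y := g (h *: b + y) - g y.
  have dk y : is_derive y a k ('D_a g (h *: b + y) - 'D_a g y).
    have E : (fun s : R => s^-1 *: (((fun y => g (h *: b + y)) \o shift y) (s *: a)
        - g (h *: b + y))) = (fun s : R => s^-1 *: ((g \o shift (h *: b + y)) (s *: a) -
        g (h *: b + y))).
      by apply/funext => s /=; rewrite addrCA.
    have d1 : is_derive y a (fun y => g (h *: b + y)) ('D_a g (h *: b + y)).
      by apply: DeriveDef; [rewrite /derivable E; exact: da|rewrite /derive E].
    exact: (is_deriveB d1 (derivableP (da y))).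
  have [c ch Ec] := MVT_line x h (fun y => @ex_derive _ _ _ _ _ _ _ (dk y)).
  rewrite (@derive_val _ _ _ _ _ _ _ (dk (c *: a + x))) in Ec.
  have [e eh Ee] := MVT_line (c *: a + x) h dab.
  exists c, e; split => //.
  rewrite expr2 -mulrA -Ee -Ec /k.
  by rewrite [h *: b + (h *: a + x)]addrCA; ring.
apply/eqP; rewrite -subr_eq0 -normr_eq0; apply/eqP/le_anti.
rewrite normr_ge0 andbT; apply/ler_addgt0Pr => eps eps0; rewrite add0r.
have e2 : 0 < eps / 2 by rewrite divr_gt0.
move/cvgrPdist_lt : cvw => /(_ _ e2)/nbhs_ballP[d1 /= d10 H1].
move/cvgrPdist_lt : cwv => /(_ _ e2)/nbhs_ballP[d2 /= d20 H2].
pose d := Num.min d1 d2.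
have d0 : 0 < d by rewrite lt_min d10.
pose N := `|v| + `|w| + 1.
have N0 : 0 < N by rewrite ltr_wpDl// addr_ge0.
pose h := d / N.
have h0 : 0 < h by rewrite divr_gt0.
have near_x (a b : R) : `|a| <= h -> `|b| <= h -> `|x - (a *: v + (b *: w + x))| < d.
  move=> ah bh.
  rewrite addrA opprD addrCA subrr addr0 normrN.
  have -> : d = h * N by rewrite /h divfK ?gt_eqF.
  apply: (le_lt_trans (ler_normD _ _)); rewrite !normrZ.
  apply: (@le_lt_trans _ _ (h * `|v| + h * `|w|)).
    by apply: lerD; apply: ler_wpM2r.
  by rewrite -mulrDr ltr_pM2l// ltrDl.
have [c1 [e1 [c1h e1h E1]]] := key f v w h (lt0r_neq0 h0) dv dvw.
have [c2 [e3 [c2h e2h E2]]] := key f w v h (lt0r_neq0 h0) dw dwv.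
rewrite (gtr0_norm h0) in c1h e1h c2h e2h.
have E : 'D_w ('D_v f) (e1 *: w + (c1 *: v + x)) = 'D_v ('D_w f) (e3 *: v + (c2 *: w + x)).
  have h2 : h ^+ 2 != 0 by rewrite expf_neq0// lt0r_neq0.
  have gen (a b c e : R) : a - b - (c - e) = a - c - (b - e) by ring.
  have E0 : f (h *: v + (h *: w + x)) - f (h *: w + x) - (f (h *: v + x) - f x) =
      f (h *: w + (h *: v + x)) - f (h *: v + x) - (f (h *: w + x) - f x).
    by rewrite [h *: w + (h *: v + x)]addrCA gen.
  exact: (mulfI h2 (etrans (esym E1) (etrans E0 E2))).
have A1 : `|'D_w ('D_v f) x - 'D_w ('D_v f) (e1 *: w + (c1 *: v + x))| < eps / 2.
  apply: H1; rewrite -ball_normE/= addrCA; apply: lt_le_trans (near_x _ _ c1h e1h) _.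
  by rewrite ge_min lexx.
have A2 : `|'D_v ('D_w f) x - 'D_v ('D_w f) (e3 *: v + (c2 *: w + x))| < eps / 2.
  apply: H2; rewrite -ball_normE/=; apply: lt_le_trans (near_x _ _ e2h c2h) _.
  by rewrite ge_min lexx orbT.
rewrite -E in A2; rewrite distrC in A2.
have := ltrD A1 A2; rewrite -splitr => A; apply/ltW; apply: le_lt_trans A.
by apply: le_trans (ler_normD _ _); rewrite subrKA.
Qed.

End Lines.

Section PartialDerivatives.
Context {R : realType} {d : nat}.
Local Notation X := 'rV[R]_d.

Lemma row_sum_delta (x : X) : x = \sum_j x 0 j *: delta_mx 0 j.
Proof. by rewrite [LHS]row_sum_delta. Qed.

Lemma coord_le_norm (x : X) j : `|x 0 j| <= `|x|.
Proof.
rewrite [leRHS]/Num.Def.normr/= mx_normrE.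
exact: (le_bigmax _ (fun ij => `|x ij.1 ij.2|) (0, j)).
Qed.

Lemma norm_le_coord (x : X) (e : R) : 0 <= e -> (forall j, `|x 0 j| <= e) -> `|x| <= e.
Proof.
move=> e0 H; rewrite [leLHS]/Num.Def.normr/= mx_normrE.
by apply: bigmax_le => // -[i j] _ /=; rewrite ord1.
Qed.

(** The increment is split along the coordinate directions, one at a time,
  and each piece is given by the mean value theorem. *)
Lemma differentiable_pd (f : X -> R) (x : X) :
  (forall j y, derivable f y (delta_mx 0 j)) ->
  (forall j, {for x, continuous (pd j f)}) -> differentiable f x.
Proof.
move=> df cf.
pose df0 (h : X) : R := \sum_j h 0 j * pd j f x.
have linf : linear df0.
  move=> a u v; rewrite /df0 scaler_sumr -big_split/=; apply: eq_bigr => j _.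
  by rewrite !mxE mulrDl -mulrA.
pose lM := GRing.isLinear.Build _ _ _ _ _ linf.
pose L : {linear X -> R} := HB.pack df0 lM.
have cL : continuous L.
  apply: continuous_sum => j y.
  exact: (cvgM (@coord_continuous _ _ _ 0 j y) (cvg_cst _)).
have dfE : f \o shift x = cst (f x) + L +o_ (0 : X) id.
  apply/eqaddoP => eps eps0.
  pose e := eps / (d%:R + 1).
  have dp : 0 < (d%:R + 1 : R) by rewrite ltr_wpDl.
  have e0 : 0 < e by rewrite divr_gt0.
  have : \forall y \near x, forall j, `|pd j f x - pd j f y| <= e.
    have H j : \forall y \near x, `|pd j f x - pd j f y| <= e.
      by move/cvgrPdist_le : (cf j) => /(_ _ e0).
    exact: (@filter_forall _ _ _ (nbhs x) _ H).
  move=> /nbhs_ballP[r /= r0 Hr].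
  near=> h.
  have hr : `|h| < r.
    by near: h; apply/nbhs_ballP; exists r => //= y; rewrite -ball_normE/= sub0r normrN.
  pose hk k : X := \row_j (if (j < k)%N then h 0 j else 0).
  have hk0 : hk 0%N = 0 by apply/rowP => j; rewrite !mxE.
  have hkd : hk d = h by apply/rowP => j; rewrite !mxE ltn_ord.
  have hkS (j : 'I_d) : hk j.+1 = h 0 j *: delta_mx 0 j + hk j.
    apply/rowP => i; rewrite !mxE eqxx/= ltnS leq_eqVlt -(inj_eq val_inj).
    by case: ltngtP => ij; rewrite /= ?mulr0 ?mulr1 ?add0r ?addr0// (val_inj ij).
  have tel : f (h + x) - f x = \sum_(j < d) (f (hk j.+1 + x) - f (hk j + x)).
    rewrite -(big_mkord xpredT (fun j => f (hk j.+1 + x) - f (hk j + x))).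
    by rewrite telescope_sumr// hkd hk0 add0r.
  rewrite /= /df0.
  have -> : (f \o shift x - (cst (f x) + df0)) h
     = \sum_(j < d) (f (hk j.+1 + x) - f (hk j + x) - h 0 j * pd j f x).
    by rewrite big_split/= sumrN -tel /= !fctE /=; rewrite /df0; ring.
  apply: le_trans (ler_norm_sum _ _ _) _.
  apply: (@le_trans _ _ (\sum_(j < d) (e * `|h|))); last first.
    rewrite sumr_const card_ord -mulr_natr mulrAC -/e ler_wpM2r//.
    by rewrite /e mulrAC ler_pdivrMr// ler_pM2l// lerDl.
  apply: ler_sum => j _.
  rewrite hkS -[_ + _ + x]addrA.
  have [c ch ->] := MVT_line (hk j + x) (h 0 j) (df j).
  rewrite -mulrBr normrM mulrC; apply: ler_pM => //; last exact: coord_le_norm.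
  rewrite distrC; apply: Hr; rewrite -ball_normE/=.
  rewrite addrA opprD addrCA subrr addr0 normrN.
  apply: le_lt_trans hr; apply: norm_le_coord => // i.
  rewrite !mxE eqxx/= -(inj_eq val_inj).
  case: ltngtP => ij; rewrite /= ?mulr0 ?mulr1 ?add0r ?addr0// ?normr0//.
    exact: coord_le_norm.
  exact: (le_trans ch (coord_le_norm _ _)).
apply/diff_locallyP; have E := diff_unique cL dfE.
by rewrite E.
Unshelve. all: by end_near. Qed.

End PartialDerivatives.

(** * Smooth functions of time and space *)

Section DerivativeRules.
Context {R : realType} {V : normedModType R}.

Lemma is_derive_comp1 (phi : R -> R) (f : V -> R) (x v : V) :
  derivable f x v -> derivable phi (f x) 1 ->
  is_derive x v (fun y => phi (f y)) (derive1 phi (f x) * 'D_v f x).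
Proof.
move=> df dphi; have E0 : 0 *: v + x = x by rewrite scale0r add0r.
have df' : derivable f (0 *: v + x) v by rewrite E0.
have [dl El] := is_derive_line df'; rewrite E0 in El.
have dphi' : derivable phi (f (0 *: v + x)) 1 by rewrite E0.
have dc : derivable (phi \o (fun s : R => f (s *: v + x))) 0 1.
  by apply/derivable1_diffP/differentiable_comp; apply/derivable1_diffP.
have dF : derivable (fun y => phi (f y)) x v by apply/derivable1P.
apply: DeriveDef => //.
have dF' : derivable (fun y => phi (f y)) (0 *: v + x) v by rewrite E0.
have [_] := is_derive_line dF'; rewrite E0 => <-.
have := derive1_comp dl dphi'.
by rewrite !derive1E E0 => ->; rewrite El.
Qed.

End DerivativeRules.

Section SmoothFunctions.
Context {R : realType} {d : nat}.
Local Notation X := 'rV[R]_d.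
Implicit Types f g : R -> X -> R.

Definition jcontinuous f := continuous (fun z : R * X => f z.1 z.2).

Lemma jcontinuous_cst (c : R) : jcontinuous (fun _ _ => c).
Proof. by move=> z; exact: cvg_cst. Qed.

Lemma jcontinuousD f g : jcontinuous f -> jcontinuous g ->
  jcontinuous (fun t x => f t x + g t x).
Proof. by move=> cf cg z; apply: cvgD; [exact: cf|exact: cg]. Qed.

Lemma jcontinuousM f g : jcontinuous f -> jcontinuous g ->
  jcontinuous (fun t x => f t x * g t x).
Proof. by move=> cf cg z; apply: cvgM; [exact: cf|exact: cg]. Qed.

Lemma jcontinuousN f : jcontinuous f -> jcontinuous (fun t x => - f t x).
Proof. by move=> cf z; apply: cvgN; exact: cf. Qed.

Lemma jcontinuousB f g : jcontinuous f -> jcontinuous g ->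
  jcontinuous (fun t x => f t x - g t x).
Proof. by move=> cf cg; apply: jcontinuousD => //; exact: jcontinuousN. Qed.

Lemma jcontinuous_sum (I : Type) (r : seq I) (f : I -> R -> X -> R) :
  (forall i, jcontinuous (f i)) -> jcontinuous (fun t x => \sum_(i <- r) f i t x).
Proof.
by move=> cf; apply: (@continuous_sum _ _ _ _ _ (fun i z => f i z.1 z.2)).
Qed.

Lemma jcontinuous_comp (phi : R -> R) f :
  jcontinuous f -> (forall t x, {for f t x, continuous phi}) ->
  jcontinuous (fun t x => phi (f t x)).
Proof.
move=> cf cphi z; apply: (@continuous_comp _ _ _ (fun z => f z.1 z.2) phi); first exact: cf.
exact: cphi.
Qed.

Lemma jcontinuous_slice f t : jcontinuous f -> continuous (f t).
Proof.
move=> cf x; apply: (@continuous_comp _ _ _ (fun x => (t, x)) (fun z => f z.1 z.2)) => //.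
  exact: (cvg_pair (cvg_cst t) (@cvg_id _ (nbhs x))).
exact: cf.
Qed.

Lemma jcontinuous_time f x : jcontinuous f -> continuous (f^~ x).
Proof.
move=> cf t; apply: (@continuous_comp _ _ _ (fun t => (t, x)) (fun z => f z.1 z.2)) => //.
  exact: (cvg_pair (@cvg_id _ (nbhs t)) (cvg_cst x)).
exact: cf.
Qed.

Lemma Ck_continuous k f : Ck k f -> jcontinuous f.
Proof. by case: k => [|k] []. Qed.

Lemma CkS k f : Ck k.+1 f -> Ck k f.
Proof.
elim: k f => [|k IH] f; first by case.
move=> [cf [dft dfx Cdt Cpd]]; split; first exact: cf.
by split; [exact: dft|exact: dfx|exact: IH|move=> j; exact: (IH _ (Cpd j))].
Qed.

Lemma Ck_cst k (c : R) : Ck k (fun _ (_ : X) => c : R).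
Proof.
elim: k c => [|k IH] c; first by split=> //; exact: jcontinuous_cst.
split; first exact: jcontinuous_cst.
split.
- by move=> t x; exact: derivable_cst.
- by move=> j t x; exact: derivable_cst.
- rewrite (_ : dt _ = fun _ _ => 0); first exact: IH.
  by apply/funext => t; apply/funext => x; rewrite /dt derive1_cst.
- move=> j; rewrite (_ : (fun _ => _) = fun _ _ => 0); first exact: IH.
  by apply/funext => t; apply/funext => x; rewrite /pd derive_cst.
Qed.

Lemma CkD k f g : Ck k f -> Ck k g -> Ck k (fun t x => f t x + g t x).
Proof.
elim: k f g => [|k IH] f g.
  by move=> [cf _] [cg _]; split=> //; exact: jcontinuousD.
move=> [cf [ft fx Cft Cfx]] [cg [gt gx Cgt Cgx]]; split; first exact: jcontinuousD.
split.
- by move=> t x; apply: derivableD.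
- by move=> j t x; apply: derivableD.
- rewrite (_ : dt _ = fun t x => dt f t x + dt g t x); first exact: IH.
  by apply/funext => t; apply/funext => x; rewrite /dt !derive1E; exact: deriveD.
- move=> j; rewrite (_ : (fun _ => _) = fun t x => pd j (f t) x + pd j (g t) x).
    exact: (IH _ _ (Cfx j) (Cgx j)).
  by apply/funext => t; apply/funext => x; rewrite /pd; exact: deriveD.
Qed.

Lemma CkM k f g : Ck k f -> Ck k g -> Ck k (fun t x => f t x * g t x).
Proof.
elim: k f g => [|k IH] f g.
  by move=> [cf _] [cg _]; split=> //; exact: jcontinuousM.
move=> Cf Cg; have := Cf; have := Cg.
move=> [cg [gt gx Cgt Cgx]] [cf [ft fx Cft Cfx]]; split; first exact: jcontinuousM.
split.
- by move=> t x; apply: derivableM.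
- by move=> j t x; apply: derivableM.
- rewrite (_ : dt _ = fun t x => f t x * dt g t x + g t x * dt f t x).
    by apply: CkD; apply: IH => //; exact: CkS.
  by apply/funext => t; apply/funext => x; rewrite /dt !derive1E; exact: deriveM.
- move=> j; rewrite (_ : (fun _ => _) = fun t x => f t x * pd j (g t) x + g t x * pd j (f t) x).
    exact: (CkD (IH _ _ (CkS Cf) (Cgx j)) (IH _ _ (CkS Cg) (Cfx j))).
  by apply/funext => t; apply/funext => x; rewrite /pd; exact: deriveM.
Qed.

Lemma CkV k f : (forall t x, 0 < f t x) -> Ck k f -> Ck k (fun t x => (f t x)^-1).
Proof.
move=> f0; have fn0 t x : f t x != 0 by rewrite gt_eqF.
have cV : jcontinuous f -> jcontinuous (fun t x => (f t x)^-1).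
  by move=> cf z; apply: cvgV => //; exact: cf.
elim: k f f0 fn0 cV => [|k IH] f f0 fn0 cV.
  by move=> [cf _]; split=> //; exact: cV.
move=> Cf; have := Cf.
move=> [cf [ft fx Cft Cfx]]; split; first exact: cV.
have CV : Ck k (fun t x => - ((f t x)^-1 * (f t x)^-1)).
  rewrite (_ : (fun _ _ => _) = (fun t x => -1 * ((f t x)^-1 * (f t x)^-1))); last first.
    by apply/funext => t; apply/funext => x; rewrite mulN1r.
  apply: CkM; first exact: Ck_cst.
  by apply: CkM; apply: IH => //; exact: CkS.
have E a : - (a : R) ^- 2 = - (a^-1 * a^-1) by rewrite -invfM expr2.
split.
- by move=> t x; apply: derivableV.
- by move=> j t x; apply: derivableV.
- rewrite (_ : dt _ = fun t x => - ((f t x)^-1 * (f t x)^-1) * dt f t x).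
    exact: CkM.
  by apply/funext => t; apply/funext => x; rewrite /dt !derive1E -E; exact: deriveV.
- move=> j; rewrite (_ : (fun _ => _) = fun t x => - ((f t x)^-1 * (f t x)^-1) * pd j (f t) x).
    exact: (CkM CV (Cfx j)).
  by apply/funext => t; apply/funext => x; rewrite /pd -E; exact: deriveV.
Qed.

Lemma derivable_ln (x : R) : 0 < x -> derivable (@ln R) x 1.
Proof. by move=> x0; have [] := is_derive1_ln x0. Qed.

Lemma derive1_ln (x : R) : 0 < x -> derive1 (@ln R) x = x^-1.
Proof. by move=> x0; rewrite derive1E; have [] := is_derive1_ln x0. Qed.

Lemma dt_comp (phi : R -> R) f t x :
  derivable (f^~ x) t 1 -> derivable phi (f t x) 1 ->
  derivable (fun s => phi (f s x)) t 1 /\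
  dt (fun s y => phi (f s y)) t x = derive1 phi (f t x) * dt f t x.
Proof.
move=> df dphi; have [? E] := is_derive_comp1 df dphi.
by split=> //; rewrite /dt !derive1E E derive1E.
Qed.

Lemma pd_comp (phi : R -> R) (f : X -> R) j x :
  derivable f x (delta_mx 0 j) -> derivable phi (f x) 1 ->
  derivable (fun y => phi (f y)) x (delta_mx 0 j) /\
  pd j (fun y => phi (f y)) x = derive1 phi (f x) * pd j f x.
Proof. by move=> df dphi; have [] := is_derive_comp1 df dphi. Qed.

Lemma Ck_ln k f : (forall t x, 0 < f t x) -> Ck k f -> Ck k (fun t x => ln (f t x)).
Proof.
move=> f0 Cf.
have cl : jcontinuous (fun t x => ln (f t x)).
  apply: jcontinuous_comp; first exact: (Ck_continuous Cf).
  by move=> t x; exact: continuous_ln.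
case: k Cf => [|k] Cf; first by split.
have := Cf; move=> [cf [ft fx Cft Cfx]]; split; first exact: cl.
have CV := CkV f0 (CkS Cf).
split.
- by move=> t x; have [] := dt_comp (ft t x) (derivable_ln (f0 t x)).
- by move=> j t x; have [] := pd_comp (fx j t x) (derivable_ln (f0 t x)).
- rewrite (_ : dt _ = fun t x => (f t x)^-1 * dt f t x); first exact: CkM.
  apply/funext => t; apply/funext => x.
  by have [_ ->] := dt_comp (ft t x) (derivable_ln (f0 t x)); rewrite derive1_ln.
- move=> j; rewrite (_ : (fun _ => _) = fun t x => (f t x)^-1 * pd j (f t) x).
    exact: (CkM CV (Cfx j)).
  apply/funext => t; apply/funext => x.
  by have [_ ->] := pd_comp (fx j t x) (derivable_ln (f0 t x)); rewrite derive1_ln.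
Qed.

Lemma tperiodic_pd (f : X -> R) j : tperiodic f -> tperiodic (pd j f).
Proof.
move=> pf x i; rewrite /pd /derive.
by under eq_fun => h do rewrite /= addrA !pf.
Qed.

Lemma smooth_continuous f : smooth f -> jcontinuous f.
Proof. by move=> [/(_ 0%N)/Ck_continuous]. Qed.

Lemma smooth_derivable_dt f t x : smooth f -> derivable (f^~ x) t 1.
Proof. by move=> [/(_ 1%N)[_ []]]. Qed.

Lemma smooth_derivable_pd f t x j : smooth f -> derivable (f t) x (delta_mx 0 j).
Proof. by move=> [/(_ 1%N)[_ []]]. Qed.

Arguments smooth_derivable_dt {f} t x _.
Arguments smooth_derivable_pd {f} t x j _.

Lemma smooth_dt f : smooth f -> smooth (dt f).
Proof.
move=> [Cf pf]; split; first by move=> k; have [_ []] := Cf k.+1.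
by move=> t x j; rewrite /dt; congr (derive1 _ t); apply/funext => s; exact: pf.
Qed.

Lemma smooth_pd f j : smooth f -> smooth (fun t => pd j (f t)).
Proof.
move=> [Cf pf]; split; first by move=> k; have [_ [_ _ _ C]] := Cf k.+1; exact: C.
by move=> t; exact: tperiodic_pd.
Qed.

Lemma smooth_cst (c : R) : smooth (fun _ (_ : X) => c).
Proof. by split=> // k; exact: Ck_cst. Qed.

Lemma smoothD f g : smooth f -> smooth g -> smooth (fun t x => f t x + g t x).
Proof.
by move=> [Cf pf] [Cg pg]; split=> [k|t x j]; [exact: CkD|rewrite pf pg].
Qed.

Lemma smoothM f g : smooth f -> smooth g -> smooth (fun t x => f t x * g t x).
Proof.
by move=> [Cf pf] [Cg pg]; split=> [k|t x j]; [exact: CkM|rewrite pf pg].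
Qed.

Lemma smoothN f : smooth f -> smooth (fun t x => - f t x).
Proof.
move=> sf; rewrite (_ : (fun _ _ => _) = (fun t x => -1 * f t x)).
  by apply: smoothM => //; exact: smooth_cst.
by apply/funext => t; apply/funext => x; rewrite mulN1r.
Qed.

Lemma smooth_sum (I : Type) (r : seq I) (f : I -> R -> X -> R) :
  (forall i, smooth (f i)) -> smooth (fun t x => \sum_(i <- r) f i t x).
Proof.
move=> sf; elim: r => [|i r IH].
  rewrite (_ : (fun _ _ => _) = (fun _ _ => 0)); first exact: smooth_cst.
  by apply/funext => t; apply/funext => x; rewrite big_nil.
rewrite (_ : (fun _ _ => _) = (fun t x => f i t x + \sum_(j <- r) f j t x)).
  exact: smoothD.
by apply/funext => t; apply/funext => x; rewrite big_cons.
Qed.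

Lemma smoothV f : (forall t x, 0 < f t x) -> smooth f -> smooth (fun t x => (f t x)^-1).
Proof.
by move=> f0 [Cf pf]; split=> [k|t x j]; [exact: CkV|rewrite pf].
Qed.

Lemma smooth_ln f : (forall t x, 0 < f t x) -> smooth f -> smooth (fun t x => ln (f t x)).
Proof.
by move=> f0 [Cf pf]; split=> [k|t x j]; [exact: Ck_ln|rewrite pf].
Qed.

Lemma smooth_horner (q : {poly R}) f : smooth f -> smooth (fun t x => q.[f t x]).
Proof.
move=> sf; elim/poly_ind: q => [|q c IH].
  rewrite (_ : (fun _ _ => _) = (fun _ _ => 0)); first exact: smooth_cst.
  by apply/funext => t; apply/funext => x; rewrite horner0.
rewrite (_ : (fun _ _ => _) = (fun t x => q.[f t x] * f t x + c)).
  by apply: smoothD; [exact: smoothM|exact: smooth_cst].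
by apply/funext => t; apply/funext => x; rewrite hornerMXaddC.
Qed.

(** Functions of time alone whose successive derivatives are known in closed form. *)
Lemma smooth_time (e : nat -> R -> R) :
  (forall n (t : R), is_derive t 1 (e n) (e n.+1 t)) ->
  forall n, smooth (fun t (_ : X) => e n t).
Proof.
move=> de n; split=> // k; elim: k n => [|k IH] n.
  split=> // z; apply: (@continuous_comp _ _ _ fst (e n)); first exact: cvg_fst.
  by apply/differentiable_continuous/derivable1_diffP; have [] := de n z.1.
split; first exact: (Ck_continuous (IH n)).
split.
- by move=> t x; have [] := de n t.
- by move=> j t x; exact: derivable_cst.
- rewrite (_ : dt _ = fun t _ => e n.+1 t); first exact: IH.
  by apply/funext => t; apply/funext => x; rewrite /dt derive1E; have [] := de n t.
- move=> j; rewrite (_ : (fun _ => _) = fun _ _ => 0); first exact: Ck_cst.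
  by apply/funext => t; apply/funext => x; rewrite /pd derive_cst.
Qed.

Lemma smooth_differentiable f t x : smooth f -> differentiable (f t) x.
Proof.
move=> sf; apply: differentiable_pd.
  by move=> j y; exact: (smooth_derivable_pd _ _ _ sf).
by move=> j; exact: (jcontinuous_slice (smooth_continuous (smooth_pd j sf))).
Qed.

End SmoothFunctions.
Arguments smooth_derivable_dt {R d f} t x _.
Arguments smooth_derivable_pd {R d f} t x j _.

Section MixedDerivatives.
Context {R : realType} {d : nat}.
Local Notation X := 'rV[R]_d.
Implicit Types f g : R -> X -> R.

Lemma pd_pd_comm f t i j x : smooth f ->
  pd i (pd j (f t)) x = pd j (pd i (f t)) x.
Proof.
move=> sf; have sj := smooth_pd j sf; have si := smooth_pd i sf.
have cij : continuous (pd i (pd j (f t))).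
  exact: (@jcontinuous_slice _ _ (fun s => pd i (pd j (f s))) t (smooth_continuous (smooth_pd i sj))).
have cji : continuous (pd j (pd i (f t))).
  exact: (@jcontinuous_slice _ _ (fun s => pd j (pd i (f s))) t (smooth_continuous (smooth_pd j si))).
apply: (@derive_symmetric R X (f t) (delta_mx 0 j) (delta_mx 0 i) x).
- by move=> y; exact: (smooth_derivable_pd t y j sf).
- by move=> y; exact: (smooth_derivable_pd t y i sf).
- by move=> y; exact: (smooth_derivable_pd t y i sj).
- by move=> y; exact: (smooth_derivable_pd t y j si).
- exact: cij.
- exact: cji.
Qed.

(** Time and space derivatives are directional derivatives on the product [R * X],
  so that this is again [derive_symmetric]. *)
Lemma dt_pd_comm f t j x : smooth f ->
  dt (fun s => pd j (f s)) t x = pd j (dt f t) x.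
Proof.
pose unc g (z : R * X) := g z.1 z.2 : R.
pose et : R * X := (1, 0); pose ej : R * X := (0, delta_mx 0 j).
have quot_t g z : (fun h : R => h^-1 *: ((unc g \o shift z) (h *: et) - unc g z)) =
    (fun h : R => h^-1 *: (((g^~ z.2) \o shift z.1) (h *: 1) - g z.1 z.2)).
  by apply/funext => h; rewrite /unc /= scaler0 add0r.
have quot_j g z : (fun h : R => h^-1 *: ((unc g \o shift z) (h *: ej) - unc g z)) =
    (fun h : R => h^-1 *: (((g z.1) \o shift z.2) (h *: delta_mx 0 j) - g z.1 z.2)).
  by apply/funext => h; rewrite /unc /= scaler0 add0r.
have derT g z : smooth g -> derivable (unc g) z et.
  by move=> sg; rewrite /derivable quot_t; exact: (smooth_derivable_dt _ _ sg).
have derJ g z : smooth g -> derivable (unc g) z ej.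
  by move=> sg; rewrite /derivable quot_j; exact: (smooth_derivable_pd _ _ _ sg).
have DT g : 'D_et (unc g) = unc (dt g).
  by apply/funext => z; rewrite /derive quot_t /unc /dt derive1E.
have DJ g : 'D_ej (unc g) = unc (fun s => pd j (g s)).
  by apply/funext => z; rewrite /derive quot_j.
move=> sf.
have sft := smooth_dt sf; have sfj := smooth_pd j sf.
have sftj := smooth_pd j sft; have sfjt := smooth_dt sfj.
have E1 : 'D_et ('D_ej (unc f)) = unc (dt (fun s => pd j (f s))).
  by rewrite DJ; exact: (DT (fun s => pd j (f s))).
have E2 : 'D_ej ('D_et (unc f)) = unc (fun s => pd j (dt f s)).
  by rewrite DT; exact: (DJ (dt f)).
have cjt : continuous (unc (dt (fun s => pd j (f s)))) by exact: smooth_continuous.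
have ctj : continuous (unc (fun s => pd j (dt f s))) by exact: smooth_continuous.
have sym : 'D_et ('D_ej (unc f)) (t, x) = 'D_ej ('D_et (unc f)) (t, x).
  apply: (@derive_symmetric R _ (unc f) ej et (t, x)).
  - by move=> y; exact: (derJ _ _ sf).
  - by move=> y; exact: (derT _ _ sf).
  - by move=> y; rewrite DJ; exact: (derT _ _ sfj).
  - by move=> y; rewrite DT; exact: (derJ _ _ sft).
  - by rewrite E1; exact: cjt.
  - by rewrite E2; exact: ctj.
have F1 := congr1 (fun g : R * X -> R => g (t, x)) E1.
have F2 := congr1 (fun g : R * X -> R => g (t, x)) E2.
exact: (etrans (esym F1) (etrans sym F2)).
Qed.

End MixedDerivatives.

(** Calculus of [q(r)] for [q] of limited regularity, such as the pressure and [H'],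
  about which nothing is assumed at the origin. *)
Section Composition.
Context {R : realType} {d : nat}.
Local Notation X := 'rV[R]_d.
Variables (r : R -> X -> R) (q q' : R -> R).
Hypothesis sr : smooth r.
Hypothesis r0 : forall t x, 0 < r t x.
Hypothesis dq : forall s : R, 0 < s -> is_derive s 1 q (q' s).
Hypothesis cq' : forall s : R, 0 < s -> {for s, continuous q'}.
Let qr t x := q (r t x).

Let dqr t x : derivable q (r t x) 1 /\ derive1 q (r t x) = q' (r t x).
Proof. by have [d1 d2] := dq (r0 t x); rewrite derive1E. Qed.

Lemma comp_derivable_dt t x : derivable (qr^~ x) t 1.
Proof. by have [d1 _] := dqr t x; have [] := dt_comp (smooth_derivable_dt t x sr) d1. Qed.

Lemma comp_dt t x : dt qr t x = q' (r t x) * dt r t x.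
Proof.
by have [d1 <-] := dqr t x; have [_ ->] := dt_comp (smooth_derivable_dt t x sr) d1.
Qed.

Lemma comp_derivable_pd t x j : derivable (qr t) x (delta_mx 0 j).
Proof. by have [d1 _] := dqr t x; have [] := pd_comp (smooth_derivable_pd t x j sr) d1. Qed.

Lemma comp_pd t x j : pd j (qr t) x = q' (r t x) * pd j (r t) x.
Proof.
by have [d1 <-] := dqr t x; have [_ ->] := pd_comp (smooth_derivable_pd t x j sr) d1.
Qed.

Lemma comp_grad t x : grad (qr t) x = q' (r t x) *: grad (r t) x.
Proof. by apply/rowP => j; rewrite !mxE comp_pd. Qed.

Lemma comp_jcontinuous : jcontinuous qr.
Proof.
apply: jcontinuous_comp; first exact: smooth_continuous.
move=> t x; apply/differentiable_continuous/derivable1_diffP.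
by have [] := dqr t x.
Qed.

Let cq'r : jcontinuous (fun t x => q' (r t x)).
Proof. by apply: jcontinuous_comp; [exact: smooth_continuous|move=> t x; exact: cq']. Qed.

Lemma comp_jcontinuous_dt : jcontinuous (dt qr).
Proof.
rewrite (_ : dt qr = fun t x => q' (r t x) * dt r t x).
  by apply: jcontinuousM => //; exact: (smooth_continuous (smooth_dt sr)).
by apply/funext => t; apply/funext => x; exact: comp_dt.
Qed.

Lemma comp_jcontinuous_pd j : jcontinuous (fun t => pd j (qr t)).
Proof.
rewrite (_ : (fun t => _) = fun t x => q' (r t x) * pd j (r t) x).
  by apply: jcontinuousM => //; exact: (smooth_continuous (smooth_pd j sr)).
by apply/funext => t; apply/funext => x; exact: comp_pd.
Qed.

End Composition.

(** * Integrals over the torus and over space-time cylinders *)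

Section JointMeasurability.
Context {R : realType} {d : nat}.
Local Notation X := 'rV[R]_d.
Local Notation RL := (measurableTypeR R).
Local Notation TX := (d.-tuple RL).

Lemma measurable_coord_ball (i : 'I_d) (a e : R) :
  measurable [set z : TX | `|a - tnth z i| < e].
Proof.
have mi : measurable_fun [set: TX] (fun z : TX => tnth z i) by exact: measurable_tnth.
rewrite -[X in measurable X]setTI.
have : measurable_fun [set: TX] (fun z : TX => `|a - tnth z i|).
  by apply: measurableT_comp => //; apply: measurable_funB.
move=> /(_ measurableT [set` `]-oo, e[]); rewrite (_ : _ @^-1` _ = [set z | `|a - tnth z i| < e]).
  by apply; exact: measurable_itv.
by apply/seteqP; split => z; rewrite /= in_itv.
Qed.

Lemma rat_approx (x e : R) : 0 < e -> exists q : rat, `|ratr q - x| < e.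
Proof.
move=> e0; have : x - e < x + e by rewrite ltrBlDr -addrA ltrDl addr_gt0.
move=> /rat_in_itvoo[q]; rewrite in_itv/= => /andP[q1 q2]; exists q.
by rewrite ltr_norml ltrBrDl q1/= ltrBlDl.
Qed.

(** An open set of space-time is a countable union of boxes with rational
  centres, whose preimages are visibly measurable. *)
Lemma measurable_jcontinuous (f : R -> X -> R) : jcontinuous f ->
  measurable_fun [set: RL * TX] (fun z : RL * TX => f z.1 (cellpt z.2)).
Proof.
move=> cf; apply: (measurability _ (RGenOpens.measurableE R)) => _ [_ [a [b ->] <-]].
set W := [set` _]; have Wo : open W by exact: interval_open.
rewrite setTI.
pose A : set (R * X) := (fun z => f z.1 z.2) @^-1` W.
have Ao : open A by apply: open_comp => // z _; exact: cf.
pose idx := (rat * 'rV[rat]_d * nat)%type.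
pose e (k : nat) : R := k.+1%:R^-1.
have e0 k : 0 < e k by rewrite invr_gt0.
pose box (k : idx) : set (R * X) :=
  ball (ratr k.1.1 : R, (\row_i ratr (k.1.2 0 i)) : X) (e k.2).
pose B (k : idx) : set (RL * TX) :=
  if pselect (box k `<=` A) then
    [set t : RL | `|ratr k.1.1 - t| < e k.2] `*`
    (\bigcap_(i in [set: 'I_d]) [set z : TX | `|ratr (k.1.2 0 i) - tnth z i| < e k.2])
  else set0.
have boxE (k : idx) (z : RL * TX) : (`|ratr k.1.1 - z.1| < e k.2 /\
     (forall i, `|ratr (k.1.2 0 i) - tnth z.2 i| < e k.2)) ->
   box k (z.1, cellpt z.2).
  move=> [z1 z2]; split=> //=; split=> // i j.
  by rewrite !mxE; exact: z2.
rewrite (_ : _ @^-1` W = \bigcup_(k in [set: idx]) B k).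
  apply: countable_bigcupT_measurable; first exact: countableP.
  move=> k; rewrite /B; case: pselect => [kA|kA] /=; last exact: measurable0.
  apply: measurableX.
    rewrite (_ : mkset _ = ball (ratr k.1.1 : R) (e k.2)); first exact: measurable_ball.
    by [].
  apply: fin_bigcap_measurable => [|i _]; first exact: finite_finset.
  exact: measurable_coord_ball.
apply/seteqP; split=> [z Wz|z [k _]]; last first.
  rewrite /B; case: pselect => [kA|kA] //= [z1 z2].
  apply: (kA (z.1, cellpt z.2)); apply: boxE; split=> // i.
  exact: (z2 i).
have /nbhs_ballP[r /= r0 Hr] : nbhs (z.1 : R, cellpt z.2 : X) A.
  by apply: open_nbhs_nbhs; split.
have [n nr] : exists n, e n < r / 2.
  have r2 : 0 < r / 2 by rewrite divr_gt0.
  by have [n] := ltr_add_invr r2; rewrite add0r => ?; exists n.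
have [q qz] := rat_approx (z.1 : R) (e0 n).
have qi i : {q : rat | `|ratr q - tnth z.2 i| < e n}.
  by apply: cid; exact: (rat_approx (tnth z.2 i : R) (e0 n)).
pose k : idx := (q, \row_i sval (qi i), n).
have ki i : `|ratr (k.1.2 0 i) - tnth z.2 i| < e n.
  by rewrite mxE; exact: (svalP (qi i)).
exists k => //; rewrite /B; case: pselect => [kA|nA] /=.
  by split=> //= i _; exact: ki.
exfalso; apply: nA => y ky; apply: Hr.
have zk : ball (z.1 : R, cellpt z.2 : X) (r / 2)
   (ratr k.1.1 : R, (\row_i ratr (k.1.2 0 i)) : X).
  apply: ball_sym; apply: (@le_ball _ _ _ (e n)); first exact: ltW.
  by apply: (boxE k z).
rewrite (splitr r); apply: (ball_triangle zk).
apply: (@le_ball _ _ _ (e n)); first exact: ltW.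
exact: ky.
Qed.

Lemma measurable_continuous_cell (f : X -> R) : continuous f ->
  measurable_fun [set: TX] (f \o cellpt).
Proof.
move=> cf.
have cF : jcontinuous (fun _ : R => f).
  by move=> z; apply: continuous_comp; [exact: cvg_snd | exact: cf].
have := measurable_jcontinuous cF.
move=> m; rewrite (_ : f \o cellpt = (fun z : RL * TX => f (cellpt z.2)) \o (fun z : TX => (0 : RL, z))) //.
by apply: measurableT_comp => //; apply: measurable_fun_pair.
Qed.

End JointMeasurability.

Section Cell.
Context {R : realType}.
Local Notation RL := (measurableTypeR R).

Lemma uniform01_out : uniform_prob (@ltr01 R) (~` `[0, 1]) = 0.
Proof.
by rewrite /uniform_prob integral_uniform_pdf setICl integral_set0.
Qed.

(** Each coordinate is uniformly distributed on the unit interval. *)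
Lemma torus_measure_coord_out n (i : 'I_n) :
  torus_measure R n [set z | ~ `[0, 1]%classic (tnth z i)] = 0.
Proof.
elim: n i => [[]//|n IH i].
rewrite /= /distribution /pushforward/=.
have [j ->|->] := unliftP ord0 i.
  rewrite (_ : _ @^-1` _ = [set: RL] `*` [set z : n.-tuple RL | ~ `[0, 1]%classic (tnth z j)]).
    rewrite product_measure1E//; last first.
      rewrite (_ : mkset _ = [set: n.-tuple RL] `&` ((fun z : n.-tuple RL => tnth z j) @^-1` (~` `[0, 1]))).
        by apply: measurable_tnth => //; apply: measurableC.
      by rewrite setTI.
    by rewrite [X in (_ * X)%E](IH j) mule0.
  by apply/seteqP; split => [[x z]|[x z]]; rewrite /= tnthS; tauto.
rewrite (_ : _ @^-1` _ = (~` `[0, 1]) `*` [set: n.-tuple RL]).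
  rewrite product_measure1E//; last exact: measurableC.
  by rewrite [X in (X * _)%E]uniform01_out mul0e.
by apply/seteqP; split => [[x z]|[x z]]; rewrite /= tnth0; tauto.
Qed.

End Cell.

Section SpaceTimeIntegrability.
Context {R : realType} {d : nat}.
Local Notation X := 'rV[R]_d.
Local Notation RL := (measurableTypeR R).
Local Notation TX := (d.-tuple RL).
Local Notation lambda := (@lebesgue_measure R).
Local Notation mu := (torus_measure R d).
Implicit Types (f g c : R -> X -> R) (T t : R).

Definition cyl T : set (RL * TX) := `[0, T] `*` [set: TX].

Lemma measurable_cyl T : measurable (cyl T).
Proof. by apply: measurableX => //; exact: measurable_itv. Qed.
Hint Resolve measurable_cyl : core.

Lemma in_cyl T z : cyl T z -> 0 <= z.1 <= T.
Proof. by move=> [/=]; rewrite in_itv. Qed.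

(** The sample space consists of all tuples of reals; continuous coefficients are
  only bounded on the unit cell, whose complement is this null set. *)
Definition offcell : set TX := [set z | ~ forall i, `[0, 1]%classic (tnth z i)].

Lemma offcellE : offcell = \bigcup_(i in [set: 'I_d]) [set z | ~ `[0, 1]%classic (tnth z i)].
Proof.
apply/seteqP; split=> [z /existsNP[i zi]|z [i _ zi] H]; first by exists i.
exact/zi/H.
Qed.

Lemma measurable_off_coord i : measurable [set z : TX | ~ `[0, 1]%classic (tnth z i)].
Proof.
rewrite (_ : mkset _ = [set: TX] `&` ((fun z : TX => tnth z i) @^-1` (~` `[0, 1]))).
  by apply: measurable_tnth => //; apply: measurableC; exact: measurable_itv.
by rewrite setTI.
Qed.

Lemma measurable_offcell : measurable offcell.
Proof.
rewrite offcellE; apply: fin_bigcup_measurable => [|i _]; first exact: finite_finset.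
exact: measurable_off_coord.
Qed.
Hint Resolve measurable_offcell : core.

Lemma offcell0 : mu offcell = 0%E.
Proof.
suff : mu.-negligible offcell by move/negligibleP; apply.
have H (i : 'I_d) : \forall z \ae mu, `[0, 1]%classic (tnth z i).
  exists [set z : TX | ~ `[0, 1]%classic (tnth z i)]; split=> //.
    exact: measurable_off_coord.
  exact: torus_measure_coord_out.
have := @filter_forall TX 'I_d (fun i z => `[0, 1]%classic (tnth z i)) (almost_everywhere mu) _ H.
exact.
Qed.

Lemma jcontinuous_bounded c T : jcontinuous c -> exists2 M : R, 0 <= M &
  forall (t : R) (x : X), 0 <= t <= T -> (forall i, 0 <= x 0 i <= 1) -> `|c t x| <= M.
Proof.
move=> cc; pose K : set (R * X) := `[0, T] `*` [set x : X | forall i, `[0, 1]%classic (x ord0 i)].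
have cK : compact K.
  apply: compact_setX; first exact: segment_compact.
  apply: (@rV_compact R d (fun=> `[(0 : R), 1]%classic)) => _; exact: segment_compact.
have := compact_bounded (continuous_compact (continuous_subspaceT cc) cK).
move=> [M [_ HM]]; exists (`|M| + 1); first by rewrite addr_ge0.
move=> t x tT xi; apply: (HM (`|M| + 1)).
  by rewrite (le_lt_trans (ler_norm _))// ltrDl.
by exists (t, x) => //; split=> /=; rewrite ?in_itv//= => i; rewrite in_itv/=.
Qed.

Lemma slab_offcell0 : (lambda \x mu)%E ([set: RL] `*` offcell) = 0%E.
Proof. by rewrite product_measure1E// [X in (_ * X)%E]offcell0 mule0. Qed.

Lemma measurable_slab_offcell : measurable ([set: RL] `*` offcell).
Proof. exact: measurableX. Qed.
Hint Resolve measurable_slab_offcell : core.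

Lemma incell z : ~ offcell z -> forall i, 0 <= cellpt z 0 i <= 1.
Proof.
move=> /contrapT zi i; rewrite mxE; have := zi i.
by rewrite /= in_itv.
Qed.

Lemma stL1_measurable T f : stL1 T f ->
  measurable_fun (cyl T) (fun z : RL * TX => f z.1 (cellpt z.2)).
Proof. by move=> /measurable_int/measurable_EFinP. Qed.

Lemma stL1_eq T f g : (forall t x, 0 <= t <= T -> f t x = g t x) ->
  stL1 T f -> stL1 T g.
Proof.
move=> fg; apply: (@eq_integrable _ _ _ _ _ (measurable_cyl T)) => z zT.
by rewrite fg// in_cyl//; exact: set_mem.
Qed.

Lemma stL1D T f g : stL1 T f -> stL1 T g -> stL1 T (fun t x => f t x + g t x).
Proof. by move=> If Ig; have := integrableD (measurable_cyl T) If Ig. Qed.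

Lemma stL1Z T (k : R) f : stL1 T f -> stL1 T (fun t x => k * f t x).
Proof. by move=> If; have := integrableZl (measurable_cyl T) k If. Qed.

Lemma stL1N T f : stL1 T f -> stL1 T (fun t x => - f t x).
Proof. by move=> /(stL1Z (-1)); apply: stL1_eq => t x _; rewrite mulN1r. Qed.

Lemma stL1B T f g : stL1 T f -> stL1 T g -> stL1 T (fun t x => f t x - g t x).
Proof. by move=> If Ig; apply: stL1D => //; exact: stL1N. Qed.

(** A continuous coefficient is bounded on the closed unit cell, and almost
  every point of the sample space lies there. *)
Lemma stL1M T f c : stL1 T f -> jcontinuous c -> stL1 T (fun t x => f t x * c t x).
Proof.
move=> If cc; have [M M0 HM] := jcontinuous_bounded T cc.
have mfc : measurable_fun (cyl T) (fun z : RL * TX => (f z.1 (cellpt z.2) * c z.1 (cellpt z.2))%:E).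
  apply/measurable_EFinP; apply: measurable_funM; first exact: stL1_measurable.
  by apply: measurable_funTS; exact: measurable_jcontinuous.
have mD : measurable (cyl T `\` ([set: RL] `*` offcell)) by exact: measurableD.
apply/(negligible_integrable measurable_slab_offcell (measurable_cyl T) mfc slab_offcell0).
apply: (@le_integrable _ _ _ _ _ mD _ (fun z => (M * f z.1 (cellpt z.2))%:E)).
- by apply: measurable_funS mfc => // z [].
- move=> z [zT zo] /=; rewrite lee_fin !normrM mulrC ler_wpM2r// (ger0_norm M0).
  apply: HM; first exact: in_cyl.
  by apply: incell => zo2; exact: zo.
- by apply: (integrableS (measurable_cyl T) mD) (stL1Z M If) => z [].
Qed.

Lemma stL1Ml T f c : stL1 T f -> jcontinuous c -> stL1 T (fun t x => c t x * f t x).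
Proof. by move=> If cc; apply: stL1_eq (stL1M If cc) => t x _; rewrite mulrC. Qed.

Lemma stL1_cst T (k : R) : stL1 T (fun _ (_ : X) => k).
Proof.
apply: (@measurable_bounded_integrable _ _ _ _ (fun=> k) _ (measurable_cyl T)) => //.
- suff : ((lambda \x mu)%E (cyl T) < +oo)%E by [].
  rewrite /cyl product_measure1E//.
  rewrite [X in (_ * X)%E](_ : _ = 1%E); last exact: probability_setT.
  rewrite mule1; suff : (lambda `[0%R, T]%classic < +oo)%E by [].
  by rewrite lebesgue_measure_itv/=; case: ifP => _; rewrite ?ltry.
- by exists `|k|; split=> [|x kx y _]; [exact: num_real|rewrite ltW].
Qed.

Lemma stL1_jcontinuous T c : jcontinuous c -> stL1 T c.
Proof.
by move=> cc; apply: stL1_eq (stL1M (stL1_cst T 1) cc) => t x _; rewrite mul1r.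
Qed.

Lemma stL1_sum T (I : Type) (r : seq I) (f : I -> R -> X -> R) :
  (forall i, stL1 T (f i)) -> stL1 T (fun t x => \sum_(i <- r) f i t x).
Proof.
move=> If; elim: r => [|i r IH].
  by apply: stL1_eq (stL1_cst T 0) => t x _; rewrite big_nil.
by apply: stL1_eq (stL1D (If i) IH) => t x _; rewrite big_cons.
Qed.

Lemma stL2_mul T f g : stL2 T f -> stL2 T g -> stL1 T (fun t x => f t x * g t x).
Proof.
move=> [mf If] [mg Ig].
apply: (@le_integrable _ _ _ _ _ (measurable_cyl T) _
   (fun z => (f z.1 (cellpt z.2) ^+ 2 + g z.1 (cellpt z.2) ^+ 2)%:E)).
- by apply/measurable_EFinP; apply: measurable_funM.
- move=> z _ /=; rewrite lee_fin [leRHS]ger0_norm ?addr_ge0 ?sqr_ge0// normrM.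
  set a := f _ _; set b := g _ _.
  rewrite -(real_normK (num_real a)) -(real_normK (num_real b)).
  have := sqr_ge0 (`|a| - `|b|); have := normr_ge0 a; have := normr_ge0 b.
  nra.
- exact: (stL1D If Ig).
Qed.

End SpaceTimeIntegrability.

Section TorusIntegral.
Context {R : realType} {d : nat}.
Local Notation X := 'rV[R]_d.
Local Notation RL := (measurableTypeR R).
Local Notation TX := (d.-tuple RL).
Local Notation mu := (torus_measure R d).
Implicit Types (f g c : X -> R).

Lemma torus_int_eq f g : f =1 g -> torus_int f = torus_int g.
Proof. by move=> /funext ->. Qed.

Lemma tL1D f g : tL1 f -> tL1 g -> tL1 (fun x => f x + g x).
Proof. by move=> If Ig; have := integrableD measurableT If Ig. Qed.

Lemma tL1Z (k : R) f : tL1 f -> tL1 (fun x => k * f x).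
Proof. by move=> If; have := integrableZl measurableT k If. Qed.

Lemma tL1N f : tL1 f -> tL1 (fun x => - f x).
Proof.
move=> /(tL1Z (-1)); rewrite (_ : (fun x => -1 * f x) = (fun x => - f x))//.
by apply/funext => x; rewrite mulN1r.
Qed.

Lemma tL1B f g : tL1 f -> tL1 g -> tL1 (fun x => f x - g x).
Proof. by move=> If Ig; apply: tL1D => //; exact: tL1N. Qed.

Lemma tL1_cst (k : R) : tL1 (fun _ : X => k).
Proof. exact: finite_measure_integrable_cst. Qed.

Lemma tL1_sum (I : Type) (r : seq I) (f : I -> X -> R) :
  (forall i, tL1 (f i)) -> tL1 (fun x => \sum_(i <- r) f i x).
Proof.
move=> If; elim: r => [|i r IH].
  rewrite (_ : (fun x => _) = (fun=> 0)); first exact: tL1_cst.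
  by apply/funext => x; rewrite big_nil.
rewrite (_ : (fun x => _) = (fun x => f i x + \sum_(j <- r) f j x)).
  exact: tL1D.
by apply/funext => x; rewrite big_cons.
Qed.

Lemma tL1M f c : tL1 f -> continuous c -> tL1 (fun x => f x * c x).
Proof.
move=> If cc.
have jc : jcontinuous (fun _ : R => c).
  by move=> z; apply: continuous_comp; [exact: cvg_snd | exact: cc].
have [M M0 HM] := jcontinuous_bounded 0 jc.
have mfc : measurable_fun [set: TX] (fun z : TX => (f (cellpt z) * c (cellpt z))%:E).
  apply/measurable_EFinP; apply: measurable_funM.
    by move/measurable_int : If => /measurable_EFinP.
  exact: measurable_continuous_cell.
have mo := @measurable_offcell R d.
have mD : measurable ([set: TX] `\` offcell) by exact: measurableD.
apply/(negligible_integrable mo measurableT mfc offcell0).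
apply: (@le_integrable _ _ _ _ _ mD _ (fun z => (M * f (cellpt z))%:E)).
- by apply: measurable_funS mfc => // z [].
- move=> z [zT zo] /=; rewrite lee_fin !normrM mulrC ler_wpM2r// (ger0_norm M0).
  by apply: (HM 0); [rewrite lexx|exact: incell].
- by apply: (integrableS measurableT mD) (tL1Z M If) => z [].
Qed.

Lemma tL1_continuous c : continuous c -> tL1 c.
Proof.
move=> cc; have := tL1M (tL1_cst 1) cc.
by rewrite (_ : (fun x => 1 * c x) = c)//; apply/funext => x; rewrite mul1r.
Qed.

Lemma tL2_mul f g : tL2 f -> tL2 g -> tL1 (fun x => f x * g x).
Proof.
move=> [mf If] [mg Ig].
apply: (@le_integrable _ _ _ _ _ measurableT _
   (fun z => (f (cellpt z) ^+ 2 + g (cellpt z) ^+ 2)%:E)).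
- by apply/measurable_EFinP; apply: (measurable_funM mf mg).
- move=> z _ /=; rewrite lee_fin [leRHS]ger0_norm ?addr_ge0 ?sqr_ge0// normrM.
  set a := f _; set b := g _.
  rewrite -(real_normK (num_real a)) -(real_normK (num_real b)).
  have := sqr_ge0 (`|a| - `|b|); have := normr_ge0 a; have := normr_ge0 b.
  nra.
- exact: (tL1D If Ig).
Qed.

Lemma torus_intD f g : tL1 f -> tL1 g ->
  torus_int (fun x => f x + g x) = torus_int f + torus_int g.
Proof. by move=> If Ig; rewrite /torus_int (RintegralD _ If Ig). Qed.

Lemma torus_intZ (k : R) f : tL1 f -> torus_int (fun x => k * f x) = k * torus_int f.
Proof. by move=> If; rewrite /torus_int (RintegralZl _ _ If). Qed.

Lemma torus_intN f : tL1 f -> torus_int (fun x => - f x) = - torus_int f.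
Proof.
by move=> If; rewrite -mulN1r -torus_intZ//; apply: torus_int_eq => x; rewrite mulN1r.
Qed.

Lemma torus_intB f g : tL1 f -> tL1 g ->
  torus_int (fun x => f x - g x) = torus_int f - torus_int g.
Proof. by move=> If Ig; rewrite torus_intD ?torus_intN//; exact: tL1N. Qed.

Lemma torus_int0 : torus_int (fun _ : X => 0) = 0.
Proof. by rewrite /torus_int Rintegral_cst// mul0r. Qed.

Lemma torus_int_sum (I : Type) (r : seq I) (f : I -> X -> R) :
  (forall i, tL1 (f i)) ->
  torus_int (fun x => \sum_(i <- r) f i x) = \sum_(i <- r) torus_int (f i).
Proof.
move=> If; elim: r => [|i r IH].
  by rewrite big_nil -[RHS]torus_int0; apply: torus_int_eq => x; rewrite big_nil.
rewrite big_cons -IH -torus_intD//; last exact: tL1_sum.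
by apply: torus_int_eq => x; rewrite big_cons.
Qed.

Lemma torus_int_ge0 f : (forall x, 0 <= f x) -> 0 <= torus_int f.
Proof. by move=> f0; apply: Rintegral_ge0 => z _. Qed.

Lemma torus_int_le f g : tL1 f -> tL1 g -> (forall x, f x <= g x) ->
  torus_int f <= torus_int g.
Proof. by move=> If Ig fg; apply: le_Rintegral. Qed.

End TorusIntegral.

Section SpaceTimeIntegral.
Context {R : realType} {d : nat}.
Local Notation X := 'rV[R]_d.
Local Notation RL := (measurableTypeR R).
Local Notation TX := (d.-tuple RL).
Local Notation lambda := (@lebesgue_measure R).
Local Notation mu := (torus_measure R d).
Implicit Types (f g : R -> X -> R) (T t : R).

Let ext T f : RL * TX -> \bar R :=
  (fun z => (f z.1 (cellpt z.2))%:E) \_ (cyl T).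

Let extE T f s z : 0 <= s <= T -> ext T f (s, z) = (f s (cellpt z))%:E.
Proof.
by move=> sT; rewrite /ext patchE mem_set//; split => //=; rewrite in_itv.
Qed.

Let ext_integrable T f : stL1 T f -> (lambda \x mu)%E.-integrable setT (ext T f).
Proof. by move=> If; apply/(integrable_mkcond _ (measurable_cyl T)). Qed.

(** By Fubini, applied to the extension by zero outside of the cylinder. *)
Lemma stL1_slice T f : stL1 T f ->
  {ae lambda, forall s, 0 <= s <= T -> tL1 (f s)}.
Proof.
move=> If; have := ae_integrable1 (ext_integrable If).
apply: filterS => s Is sT.
by apply: (eq_integrable measurableT) Is => z _; rewrite extE.
Qed.

Lemma stL1_torus_int T f : stL1 T f ->
  lambda.-integrable `[0, T] (EFin \o (fun s => torus_int (f s))).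
Proof.
move=> If; have IF := integrable_fubini_F (ext_integrable If).
have {}IF : lambda.-integrable `[0, T] (fubini_F mu (ext T f)).
  by apply: integrableS IF.
have FE s : s \in `[0, T]%classic -> fine (fubini_F mu (ext T f) s) = torus_int (f s).
  rewrite inE/= in_itv/= => sT; congr fine; apply: eq_integral => z _.
  exact: extE.
apply: (@le_integrable _ _ _ _ _ _ _ (fubini_F mu (ext T f))) => //.
- apply: (eq_measurable_fun (EFin \o (fine \o fubini_F mu (ext T f)))).
    by move=> s sT; rewrite /= FE.
  apply/measurable_EFinP; apply: measurableT_comp => //.
  exact: measurable_int IF.
- move=> s sT /=; rewrite -FE ?inE//.
  by case: (fubini_F mu (ext T f) s) => [r| |] //=; rewrite normr0 leey.
Qed.

Lemma stL1_torus_int_sub T t f : t <= T -> stL1 T f ->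
  lambda.-integrable `[0, t] (EFin \o (fun s => torus_int (f s))).
Proof.
move=> tT /stL1_torus_int; apply: integrableS => //.
by apply: subset_itvl; rewrite bnd_simp.
Qed.

Lemma st_int_eq t f g : (forall s x, 0 <= s <= t -> f s x = g s x) ->
  st_int t f = st_int t g.
Proof.
move=> fg; apply: eq_Rintegral => s; rewrite inE/= in_itv/= => st.
by apply: torus_int_eq => x; exact: fg.
Qed.

Let mI t : measurable (`[0, t]%classic : set RL).
Proof. exact: measurable_itv. Qed.

Lemma ae_imp (P Q : R -> Prop) : (forall s, P s -> Q s) ->
  {ae lambda, forall s, P s} -> {ae lambda, forall s, Q s}.
Proof. by move=> PQ; apply: filterS; first exact: (ae_filter_ringOfSetsType lambda). Qed.

Lemma ae_imp2 (P Q S : R -> Prop) : (forall s, P s -> Q s -> S s) ->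
  {ae lambda, forall s, P s} -> {ae lambda, forall s, Q s} ->
  {ae lambda, forall s, S s}.
Proof. by move=> PQ; apply: filterS2; first exact: (ae_filter_ringOfSetsType lambda). Qed.

Lemma ae_eq_Rintegral t (f g : R -> R) :
  lambda.-integrable `[0, t] (EFin \o f) -> lambda.-integrable `[0, t] (EFin \o g) ->
  {ae lambda, forall s, 0 <= s <= t -> f s = g s} ->
  \int[lambda]_(s in `[0, t]) f s = \int[lambda]_(s in `[0, t]) g s.
Proof.
move=> If Ig fg; congr fine; apply: ae_eq_integral => //.
- exact: measurable_int If.
- exact: measurable_int Ig.
- by apply: ae_imp fg => s H; rewrite /= in_itv/= => /H ->.
Qed.

Lemma ae_le_Rintegral t (f g : R -> R) :
  lambda.-integrable `[0, t] (EFin \o f) -> lambda.-integrable `[0, t] (EFin \o g) ->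
  {ae lambda, forall s, 0 <= s <= t -> f s <= g s} ->
  \int[lambda]_(s in `[0, t]) f s <= \int[lambda]_(s in `[0, t]) g s.
Proof.
move=> If Ig fg; rewrite -subr_ge0 -RintegralB//.
have IB : lambda.-integrable `[0, t] (EFin \o (fun s => g s - f s)).
  by have := integrableB (mI t) Ig If.
(* The positive part represents [g - f] and is nonnegative everywhere. *)
rewrite (@ae_eq_Rintegral _ _ (fun s => Num.max 0 (g s - f s)))//.
- by apply: Rintegral_ge0 => s _; rewrite le_max lexx.
- apply: (le_integrable _ _ _ IB) => //.
    apply/measurable_EFinP; apply: measurable_maxr => //.
    by move: IB => /measurable_int/measurable_EFinP.
  move=> s _ /=; rewrite lee_fin; case: (leP 0 (g s - f s)) => // _.
  by rewrite normr0.
- apply: ae_imp fg => s H /H fgs.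
  by rewrite max_r// subr_ge0.
Qed.

Lemma st_intD T t f g : t <= T -> stL1 T f -> stL1 T g ->
  st_int t (fun s x => f s x + g s x) = st_int t f + st_int t g.
Proof.
move=> tT If Ig; rewrite /st_int -RintegralD//; last 2 first.
- exact: (stL1_torus_int_sub tT If).
- exact: (stL1_torus_int_sub tT Ig).
apply: ae_eq_Rintegral.
- exact: (stL1_torus_int_sub tT (stL1D If Ig)).
- have := integrableD (mI t) (stL1_torus_int_sub tT If) (stL1_torus_int_sub tT Ig).
  exact.
- have := stL1_slice Ig; have := stL1_slice If.
  apply: ae_imp2 => s Ifs Igs /andP[s0 st].
  have sT : 0 <= s <= T by rewrite s0 (le_trans st).
  by rewrite torus_intD//; [exact: Ifs|exact: Igs].
Qed.

Lemma st_intZ T t (k : R) f : t <= T -> stL1 T f ->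
  st_int t (fun s x => k * f s x) = k * st_int t f.
Proof.
move=> tT If; rewrite /st_int -RintegralZl//; last exact: (stL1_torus_int_sub tT If).
apply: ae_eq_Rintegral.
- exact: (stL1_torus_int_sub tT (stL1Z k If)).
- have := integrableZl (mI t) k (stL1_torus_int_sub tT If).
  exact.
- have := stL1_slice If; apply: ae_imp => s Ifs /andP[s0 st].
  by rewrite torus_intZ//; apply: Ifs; rewrite s0 (le_trans st).
Qed.

Lemma st_intN T t f : t <= T -> stL1 T f ->
  st_int t (fun s x => - f s x) = - st_int t f.
Proof.
move=> tT If; rewrite -mulN1r -(st_intZ _ tT If).
by apply: st_int_eq => s x _; rewrite mulN1r.
Qed.

Lemma st_intB T t f g : t <= T -> stL1 T f -> stL1 T g ->
  st_int t (fun s x => f s x - g s x) = st_int t f - st_int t g.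
Proof.
move=> tT If Ig; rewrite (st_intD tT If (stL1N Ig)).
by rewrite (st_intN tT Ig).
Qed.

Lemma st_int_le T t f g : t <= T -> stL1 T f -> stL1 T g ->
  {ae lambda, forall s, 0 <= s <= T -> torus_int (f s) <= torus_int (g s)} ->
  st_int t f <= st_int t g.
Proof.
move=> tT If Ig H; apply: ae_le_Rintegral.
- exact: (stL1_torus_int_sub tT If).
- exact: (stL1_torus_int_sub tT Ig).
- apply: ae_imp H => s Hs /andP[s0 st].
  by apply: Hs; rewrite s0 (le_trans st).
Qed.

End SpaceTimeIntegral.

(** * From weak formulations to almost every time *)

Section Bump.
Context {R : realType}.

(** The class of functions [x |-> P(1/x) exp(-1/x)] on the positive half-line,
  extended by zero, is closed under derivation: it provides the smooth cutoffs. *)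
Definition bump (P : {poly R}) (x : R) : R :=
  if 0 < x then P.[x^-1] * expR (- x^-1) else 0.

Definition bump_deriv (P : {poly R}) : {poly R} := 'X^2 * (P - P^`()).

Lemma exp_decay (m : nat) (y : R) : 0 <= y -> y ^+ m * expR (- y) <= m`!%:R.
Proof.
move=> y0; rewrite expRN ler_pdivrMr ?expR_gt0//.
case: m => [|m].
  by rewrite expr0 fact0 mul1r; apply: le_trans (expR_ge1Dx y); rewrite lerDl.
rewrite mulrC -ler_pdivrMr ?ltr0n ?fact_gt0//.
by apply: le_trans (expR_ge1Dxn m y0); rewrite lerDr.
Qed.

(** The exponential beats every power of [1/x]; a quadratic bound is what
  differentiability at the origin requires. *)
Lemma bump_quadratic (P : {poly R}) : exists2 C, 0 <= C &
  forall x, `|bump P x| <= C * x ^+ 2.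
Proof.
exists (\sum_(i < size P) `|P`_i| * (i.+2)`!%:R).
  by apply: sumr_ge0 => i _; rewrite mulr_ge0.
move=> x; rewrite /bump; case: ifP => [x0|_]; last first.
  by rewrite normr0 mulr_ge0 ?sqr_ge0//; apply: sumr_ge0 => i _; rewrite mulr_ge0.
have y0 : 0 <= x^-1 by rewrite invr_ge0 ltW.
rewrite normrM (ger0_norm (expR_ge0 _)) horner_coef mulrC.
apply: (@le_trans _ _ (expR (- x^-1) * \sum_(i < size P) `|P`_i| * x^-1 ^+ i)).
  apply: ler_wpM2l; first exact: expR_ge0.
  apply: le_trans (ler_norm_sum _ _ _) _; apply: ler_sum => i _.
  by rewrite normrM (ger0_norm (exprn_ge0 _ y0)).
rewrite mulr_sumr mulr_suml; apply: ler_sum => i _.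
rewrite mulrCA -mulrA; apply: ler_wpM2l => //.
rewrite -ler_pdivrMr ?exprn_gt0// -exprVn.
rewrite -mulrA -exprD addn2 mulrC; exact: exp_decay.
Qed.

Lemma is_derive_bump (P : {poly R}) (x : R) :
  is_derive x 1 (bump P) (bump (bump_deriv P) x).
Proof.
have [x0|x0|<-] := ltgtP 0 x.
- have dV : is_derive x 1 (fun y : R => y^-1) (- x^-2).
    apply: is_derive_eq; first by apply: is_deriveV; rewrite gt_eqF.
    by rewrite [_ *: _]mulr1.
  have dP : is_derive x 1 (fun y : R => P.[y^-1]) (P^`().[x^-1] * - x^-2).
    have [dV1 dV2] := dV.
    have [d1 d2] := is_derive_comp1 dV1 (@derivable_horner _ P x^-1).
    apply: DeriveDef; first exact: d1.
    rewrite d2 dV2.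
    by rewrite -[P^`().[_]]/(horner P^`() x^-1) derivE.
  have dE : is_derive x 1 (fun y : R => expR (- y^-1)) (expR (- x^-1) * x^-2).
    have [dV1 dV2] := dV.
    have dN : derivable (fun y : R => - y^-1) x 1 by exact: derivableN.
    have [d1 d2] := is_derive_comp1 dN (@derivable_expR _ (- x^-1)).
    have eE := congr1 (fun f : R -> R => f (- x^-1)) (@derive_expR R); rewrite /= in eE.
    apply: DeriveDef; first exact: d1.
    by rewrite d2 derive1E eE deriveN// dV2 opprK.
  have dPE : is_derive x 1 (fun y : R => P.[y^-1] * expR (- y^-1)) (bump (bump_deriv P) x).
    have [h1 h2] := is_deriveM dP dE.
    apply: DeriveDef; first exact: h1.
    apply: (etrans h2).
    rewrite /bump x0 /bump_deriv hornerM hornerXn hornerD hornerN /= !/GRing.scale/=.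
    by rewrite -exprVn; ring.
  apply: near_eq_is_derive dPE.
  near=> y; rewrite /bump ifT//.
  by near: y; exact: (lt_nbhsr x0).
- rewrite /bump ltNge (ltW x0)/=.
  have d0 : is_derive x 1 (cst 0 : R -> R) 0 by exact: is_derive_cst.
  apply: near_eq_is_derive d0.
  near=> y; rewrite ifF//; apply/negbTE; rewrite -leNgt ltW//.
  by near: y; exact: (lt_nbhsl x0).
- have [C C0 HC] := bump_quadratic P.
  have b0 (Q : {poly R}) : bump Q 0 = 0 by rewrite /bump ltxx.
  have H : (fun h : R => h^-1 *: ((bump P \o shift 0) (h *: 1) - bump P 0)) @ 0^' --> (0 : R).
    have C1 : 0 < C + 1 by rewrite ltr_wpDl.
    apply/cvgrPdist_le => eps eps0; near=> h.
    rewrite /= addr0 b0 subr0 sub0r normrN [h *: 1]mulr1 normrM normfV.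
    have h0 : h != 0 by near: h; exact: nbhs_dnbhs_neq.
    rewrite mulrC ler_pdivrMr ?normr_gt0//.
    apply: le_trans (HC h) _; rewrite -(real_normK (num_real h)) expr2 mulrA.
    apply: ler_wpM2r => //.
    apply: (@le_trans _ _ ((C + 1) * `|h|)); first by rewrite ler_wpM2r// lerDl.
    rewrite mulrC -ler_pdivlMr//.
    near: h; by apply: dnbhs0_le; rewrite divr_gt0.
  rewrite b0; apply: DeriveDef; first by apply/cvg_ex; exists 0.
  exact: cvg_lim H.
Unshelve. all: by end_near. Qed.

(** [cutoff a n] is a smooth approximation of the ramp [(a - s)_+]. *)
Definition cutoff (a : R) (n : nat) (s : R) : R :=
  (a - s) * bump 1 (n.+1%:R * (a - s)).

(** The derivative of [cutoff a n], which again has the form of a [bump]: at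
  [x = (n+1)(a - s)] it is [-(1 + 1/x) exp(-1/x)]. *)
Definition cutoff' (a : R) (n : nat) (s : R) : R :=
  - bump (1 + 'X) (n.+1%:R * (a - s)).

Lemma is_derive_affine (N a s : R) : is_derive s 1 (fun s : R => N * (a - s)) (- N).
Proof.
have [h1 h2] := is_deriveM (is_derive_cst N s 1)
  (is_deriveB (is_derive_cst a s 1) (is_derive_id s 1)).
apply: DeriveDef; first exact: h1.
by apply: (etrans h2); rewrite scaler0 addr0 sub0r /GRing.scale/= mulrN1.
Qed.

Lemma smooth_cutoff d a n : smooth (fun t (_ : 'rV[R]_d) => cutoff a n t).
Proof.
pose N : R := n.+1%:R.
apply: (@smoothM _ _ (fun t _ => a - t) (fun t _ => bump 1 (N * (a - t)))).
  pose e k (s : R) := (iter k deriv (a%:P - 'X)).[s].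
  rewrite (_ : (fun _ _ => _) = fun t _ => e 0%N t).
    apply: smooth_time => k s; rewrite /e /=.
    apply: DeriveDef; first exact: derivable_horner.
    by rewrite -derive1E -derivE.
  by apply/funext => t; apply/funext => _; rewrite /e /= hornerD hornerN hornerC hornerX.
pose e k (s : R) := (- N) ^+ k * bump (iter k bump_deriv 1) (N * (a - s)).
rewrite (_ : (fun _ _ => _) = fun t _ => e 0%N t).
  apply: smooth_time => k s; rewrite /e /=.
  have dl := is_derive_affine N a s.
  have [dl1 dl2] := dl.
  have [db1 db2] := is_derive_bump (iter k bump_deriv 1) (N * (a - s)).
  have [dc1 dc2] := is_derive_comp1 dl1 db1.
  have [h1 h2] := is_deriveM (is_derive_cst ((- N) ^+ k : R) s 1) (DeriveDef dc1 dc2).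
  apply: DeriveDef; first exact: h1.
  by apply: (etrans h2); rewrite dl2 derive1E db2 scaler0 addr0 exprS /GRing.scale/=; ring.
by apply/funext => t; apply/funext => _; rewrite /e expr0 mul1r.
Qed.

Lemma derive1_cutoff a n s : derive1 (cutoff a n) s = cutoff' a n s.
Proof.
pose N : R := n.+1%:R.
have N0 : N != 0 by rewrite pnatr_eq0.
have dl := is_derive_affine N a s.
have [dl1 dl2] := dl.
have [db1 db2] := is_derive_bump 1 (N * (a - s)).
have [dc1 dc2] := is_derive_comp1 dl1 db1.
have [_ h2] := is_deriveM (is_deriveB (is_derive_cst a s 1) (is_derive_id s 1)) (DeriveDef dc1 dc2).
rewrite derive1E; apply: (etrans h2); rewrite -[(cst a - id) s]/(a - s) dl2 derive1E db2 sub0r.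
rewrite /cutoff' /bump -/N; case: ifP => [x0|_]; last by rewrite /GRing.scale/=; ring.
rewrite /bump_deriv derivC subr0 mulr1 hornerXn hornerD hornerX hornerC /GRing.scale/=.
set E := expR _; rewrite invfM.
have as0 : a - s != 0 by apply/eqP => E0; move: x0; rewrite E0 mulr0 ltxx.
by field; rewrite as0 nat1r.
Qed.

Lemma cutoff_ge a n s : a <= s -> cutoff a n s = 0 /\ cutoff' a n s = 0.
Proof.
move=> sa; have E : (0 < n.+1%:R * (a - s)) = false.
  by apply/negbTE; rewrite -leNgt mulr_ge0_le0// subr_le0.
by rewrite /cutoff /cutoff' /bump E mulr0 oppr0.
Qed.

Lemma bump_bounds (x : R) : 0 <= bump 1 x <= 1 /\ 0 <= bump (1 + 'X) x <= 1.
Proof.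
rewrite /bump; case: ifP => [x0|_]; last by rewrite lexx ler01.
have y0 : 0 <= x^-1 by rewrite invr_ge0 ltW.
rewrite hornerC mul1r hornerD hornerX hornerC expR_ge0 expRN invf_le1 ?expR_gt0//.
have H := expR_ge1Dx x^-1; split.
  by apply: le_trans H; rewrite lerDl.
by rewrite mulr_ge0 ?invr_ge0 ?expR_ge0 ?addr_ge0//= ler_pdivrMr ?expR_gt0// mul1r.
Qed.

Lemma cvg_bump (P : {poly R}) (x : R) : 0 < x ->
  bump P (n.+1%:R * x) @[n --> \oo] --> P.[0].
Proof.
move=> x0.
have -> : (fun n : nat => bump P (n.+1%:R * x)) =
    (fun n : nat => (fun y => P.[y] * expR (- y)) (n.+1%:R^-1 * x^-1)).
  by apply/funext => n; rewrite /bump mulr_gt0// invfM.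
have c0 : n.+1%:R^-1 * x^-1 @[n --> \oo] --> (0 : R).
  rewrite -[X in _ --> X](mul0r x^-1); apply: cvgM; last exact: cvg_cst.
  exact: cvg_harmonic.
have -> : P.[0] = (fun y => P.[y] * expR (- y)) 0 by rewrite /= oppr0 expR0 mulr1.
have ch : {for 0, continuous (fun y : R => P.[y] * expR (- y))}.
  apply: cvgM; first exact: continuous_horner.
  apply: (@continuous_comp _ _ _ (fun y : R => - y) expR); first exact: oppr_continuous.
  exact: continuous_expR.
exact: (cvg_comp _ _ c0 ch).
Qed.

Lemma continuous_cutoff a n : continuous (cutoff a n) /\ continuous (cutoff' a n).
Proof.
have cl : continuous (fun s : R => n.+1%:R * (a - s)).
  move=> s; apply: cvgM; first exact: cvg_cst.
  by apply: cvgB; [exact: cvg_cst|exact: cvg_id].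
have cb (P : {poly R}) : continuous (fun s : R => bump P (n.+1%:R * (a - s))).
  move=> s; apply: (@continuous_comp _ _ _ (fun s : R => n.+1%:R * (a - s)) (bump P)); first exact: cl.
  apply/differentiable_continuous/derivable1_diffP.
  by have [] := is_derive_bump P (n.+1%:R * (a - s)).
split=> s.
  apply: cvgM; last exact: cb.
  by apply: cvgB; [exact: cvg_cst|exact: cvg_id].
by apply: cvgN; exact: cb.
Qed.

End Bump.

Section IntegrableTimesContinuous.
Context {R : realType}.
Local Notation RL := (measurableTypeR R).
Local Notation lambda := (@lebesgue_measure R).

Let mI t : measurable (`[0, t]%classic : set RL).
Proof. exact: measurable_itv. Qed.

Lemma integrableM_continuous (T : R) (f c : R -> R) : lambda.-integrable `[0, T] (EFin \o f) ->
  continuous c -> lambda.-integrable `[0, T] (EFin \o (fun s => f s * c s)).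
Proof.
move=> If cc.
have := compact_bounded (continuous_compact (continuous_subspaceT cc) (@segment_compact R 0 T)).
move=> [M [_ HM]].
have mf : measurable_fun `[0, T] f by move/measurable_int : If => /measurable_EFinP.
apply: (@le_integrable _ _ _ _ _ (mI T) _ (fun s => ((`|M| + 1) * f s)%:E)).
- apply/measurable_EFinP; apply: measurable_funM => //.
  by apply: measurable_funTS; exact: continuous_measurable_fun.
- move=> s sT /=; rewrite lee_fin !normrM mulrC ler_wpM2r//.
  rewrite [leRHS]ger0_norm ?addr_ge0//; apply: (HM (`|M| + 1)); last by exists s.
  by rewrite (le_lt_trans (ler_norm _))// ltrDl.
- exact: (integrableZl (mI T) (`|M| + 1) If).
Qed.

End IntegrableTimesContinuous.

Section TimePrimitive.
Context {R : realType}.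
Local Notation RL := (measurableTypeR R).
Local Notation lambda := (@lebesgue_measure R).
Variables (T : R) (A B : R -> R) (A0 : R).
Hypothesis T0 : 0 < T.
Hypothesis IA : lambda.-integrable `[0, T] (EFin \o A).
Hypothesis IB : lambda.-integrable `[0, T] (EFin \o B).

Let mI t : measurable (`[0, t]%classic : set RL).
Proof. exact: measurable_itv. Qed.

Hypothesis weakAB : forall a n, 0 < a < T ->
  \int[lambda]_(s in `[0, T]) (A s * cutoff' a n s + B s * cutoff a n s)
  + A0 * cutoff a n 0 = 0.

Let FI (f : R -> R) t := \int[lambda]_(s in `[0, t]) f s.

Let IsB : lambda.-integrable `[0, T] (EFin \o (fun s => B s * s)).
Proof. by apply: integrableM_continuous IB _ => s; exact: cvg_id. Qed.

Let restr (f : R -> R) a : lambda.-integrable `[0, T] (EFin \o f) -> 0 < a < T ->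
  \int[lambda]_(s in `[0, T]) (if s < a then f s else 0) = FI f a.
Proof.
move=> If /andP[a0 aT].
have sub : `[0, a[%classic `<=` (`[0, T]%classic : set RL).
  move=> s; rewrite /= !in_itv/= => /andP[-> sa]/=.
  by rewrite ltW// (lt_trans sa).
have Ia : lambda.-integrable `[0, a[ (EFin \o f) by apply: integrableS If.
rewrite /FI -(Rintegral_itv_bndo_bndc Ia).
have -> : `[0, a[%classic = `[0, T]%classic `&` [set s | s < a].
  apply/seteqP; split=> [s sa|s [/=]].
    by split; [exact: sub|move: sa; rewrite /= in_itv => /andP[]].
  by rewrite !in_itv/= => /andP[-> _] ->.
rewrite Rintegral_mkcondr; apply: eq_Rintegral => s _; rewrite patchE.
case: ifPn => sa; first by rewrite mem_set.
by rewrite ifN//; apply/negP; rewrite inE/= => sa'; rewrite sa' in sa.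
Qed.

(** By dominated convergence: the cutoffs tend to the ramp [(a - s)_+], their
  derivatives to minus the indicator of [s < a], and both stay bounded. *)
Lemma test_limit a : 0 < a < T -> FI A a = A0 * a + a * FI B a - FI (fun s => B s * s) a.
Proof.
move=> aT; have /andP[a0 aT'] := aT.
pose g s := `|A s| + `|B s| * T.
pose h s := if s < a then A s * -1 + B s * (a - s) else 0.
pose hn n s := A s * cutoff' a n s + B s * cutoff a n s.
have mA : measurable_fun `[0, T] A by move/measurable_int : IA => /measurable_EFinP.
have mB : measurable_fun `[0, T] B by move/measurable_int : IB => /measurable_EFinP.
have bc n s : 0 <= s -> `|cutoff' a n s| <= 1 /\ `|cutoff a n s| <= T.
  move=> s0; have [sa|sa] := leP a s.
    by have [-> ->] := cutoff_ge n sa; rewrite !normr0 ler01 ltW.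
  have [/andP[b0 b1] /andP[c0 c1]] := bump_bounds (n.+1%:R * (a - s)).
  rewrite /cutoff /cutoff' normrN ger0_norm//; split => //.
  have as0 : 0 <= a - s by rewrite subr_ge0 ltW.
  rewrite ger0_norm ?mulr_ge0//; apply: (@le_trans _ _ (a - s)).
    by rewrite ler_piMr.
  by rewrite lerBlDr (le_trans (ltW aT'))// lerDl.
have Icut n : lambda.-integrable `[0, T] (EFin \o hn n).
  have [c1 c2] := continuous_cutoff a n.
  have := integrableD (mI T) (integrableM_continuous IA c2) (integrableM_continuous IB c1).
  exact.
have Ig : lambda.-integrable `[0, T] (EFin \o g).
  have I1 : lambda.-integrable `[0, T] (EFin \o (fun s => `|A s|)).
    exact: (integrable_norm IA).
  have I2 : lambda.-integrable `[0, T] (EFin \o (fun s => `|B s| * T)).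
    apply: (integrableM_continuous (c := cst T)); last by move=> s; exact: cvg_cst.
    exact: (integrable_norm IB).
  by have := integrableD (mI T) I1 I2.
have Ih : lambda.-integrable `[0, T] (EFin \o (fun s => A s * -1 + B s * (a - s))).
  have c1 : continuous (fun _ : R => -1 : R) by move=> s; exact: cvg_cst.
  have I1 := integrableM_continuous IA c1.
  have c : continuous (fun s : R => a - s).
    by move=> s; apply: cvgB; [exact: cvg_cst|exact: cvg_id].
  by have := integrableD (mI T) I1 (integrableM_continuous IB c).
have hnh s : 0 <= s <= T -> hn n s @[n --> \oo] --> h s.
  move=> /andP[s0 sT]; rewrite /h; case: ltP => sa.
    have as0 : 0 < a - s by rewrite subr_gt0.
    apply: cvgD; apply: cvgM; try exact: cvg_cst.
      have := @cvg_bump R (1 + 'X) _ as0; rewrite hornerD hornerX hornerC addr0 => H.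
      by apply: cvgN.
    rewrite -[X in _ --> X]mulr1; apply: cvgM; first exact: cvg_cst.
    by have := @cvg_bump R 1 _ as0; rewrite hornerC.
  rewrite (_ : (fun n => hn n s) = fun=> 0); first exact: cvg_cst.
  by apply/funext => n; rewrite /hn; have [-> ->] := cutoff_ge n sa; rewrite !mulr0 addr0.
have mhn n : measurable_fun `[0, T] (hn n).
  by move/measurable_int : (Icut n) => /measurable_EFinP.
have mh : measurable_fun `[0, T] h.
  apply: (measurable_fun_cvg mhn) => s; rewrite /= in_itv/=; exact: hnh.
have mhnE n : measurable_fun `[0, T] (EFin \o hn n) by exact/measurable_EFinP.
have mhE : measurable_fun `[0, T] (EFin \o h) by exact/measurable_EFinP.
have cvgE : {ae lambda, forall s, `[0, T]%classic s -> (EFin \o hn n) s @[n --> \oo] --> (EFin \o h) s}.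
  apply: aeW => s; rewrite /= in_itv/= => sT.
  by apply: cvg_EFin; [exact: nearW|exact: hnh].
have domE : {ae lambda, forall s n, `[0, T]%classic s -> (`|(EFin \o hn n) s| <= (EFin \o g) s)%E}.
  apply: aeW => s n; rewrite /= in_itv/= => /andP[s0 _]; rewrite lee_fin.
  have [b1 b2] := bc n s s0.
  apply: le_trans (ler_normD _ _) _; rewrite (normrM (A s)) (normrM (B s)); apply: lerD.
    by rewrite ler_piMr.
  exact: (ler_wpM2l (normr_ge0 _) b2).
have [ih _ lim] := dominated_convergence (mI T) mhnE mhE cvgE Ig domE.
have Eh : \int[lambda]_(s in `[0, T]) h s + A0 * a = 0.
  have l1 : \int[lambda]_(s in `[0, T]) hn n s + A0 * cutoff a n 0 @[n --> \oo]
      --> \int[lambda]_(s in `[0, T]) h s + A0 * a.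
    apply: cvgD.
      apply: fine_cvg; rewrite fineK; first exact: lim.
      exact: (integrable_fin_num (mI T) ih).
    apply: cvgM; first exact: cvg_cst.
    have := @cvg_bump R 1 _ a0; rewrite hornerC => H.
    rewrite -[X in _ --> X]mulr1 /cutoff subr0.
    by apply: cvgM; [exact: cvg_cst|exact: H].
  have l2 : \int[lambda]_(s in `[0, T]) hn n s + A0 * cutoff a n 0 @[n --> \oo] --> (0 : R).
    by rewrite (_ : (fun n => _) = fun=> 0); [exact: cvg_cst|apply/funext => n; exact: weakAB].
  exact: (cvg_unique _ l1 l2).
rewrite restr// in Eh.
have IA' : lambda.-integrable `[0, a] (EFin \o A).
  by apply: integrableS IA => //; apply: subset_itvl; rewrite bnd_simp ltW.
have IB' : lambda.-integrable `[0, a] (EFin \o B).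
  by apply: integrableS IB => //; apply: subset_itvl; rewrite bnd_simp ltW.
have IsB' : lambda.-integrable `[0, a] (EFin \o (fun s => B s * s)).
  by apply: integrableS IsB => //; apply: subset_itvl; rewrite bnd_simp ltW.
have InA : lambda.-integrable `[0, a] (EFin \o (fun s => -1 * A s)).
  by have := integrableZl (mI a) (-1) IA'.
have IaB : lambda.-integrable `[0, a] (EFin \o (fun s => a * B s)).
  by have := integrableZl (mI a) a IB'.
have IaBs : lambda.-integrable `[0, a] (EFin \o (fun s => a * B s - B s * s)).
  by have := integrableB (mI a) IaB IsB'.
have E : FI (fun s => A s * -1 + B s * (a - s)) a =
    -1 * FI A a + (a * FI B a - FI (fun s => B s * s) a).
  rewrite -(RintegralZl _ (mI a) IA') -(RintegralZl _ (mI a) IB') -(RintegralB (mI a) IaB IsB').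
  rewrite -(RintegralD (mI a) InA IaBs).
  by apply: eq_Rintegral => s _; ring.
rewrite E in Eh; lra.
Qed.

Lemma ae_neq (c : R) : {ae lambda, forall t, t != c}.
Proof.
exists [set c]; split; [exact: measurable_set1|exact: lebesgue_measure_set1|].
by move=> t /= /negP; rewrite negbK => /eqP.
Qed.

Let diffFI (f : R -> R) : lambda.-integrable `[0, T] (EFin \o f) ->
  {ae lambda, forall t, 0 < t < T -> is_derive t 1 (FI f) (f t)}.
Proof.
move=> If; pose g := f \_ (`[0, T]%classic : set RL).
have Ig y : lambda.-integrable `[0, y] (EFin \o g).
  have : lambda.-integrable setT ((EFin \o f) \_ (`[0, T]%classic : set RL)).
    exact/(integrable_mkcond _ (mI T)).
  rewrite restrict_EFin => H; by apply: integrableS H.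
have := FTC1 Ig (integrable_locally (mI T) If).
apply: ae_imp => t H /andP[t0 tT].
have [d1 d2] := H t0.
have E : {near t, (fun x => \int[lambda]_(s in `[0, x]) g s) =1 FI f}.
  near=> x; apply: eq_Rintegral => s; rewrite inE/= in_itv/= => /andP[s0 sx].
  rewrite /g patchE mem_set//= in_itv/= s0/= (le_trans sx)//.
  by near: x; apply: filterS (lt_nbhsl tT) => x /ltW.
apply: (near_eq_is_derive E); apply: DeriveDef => //.
rewrite -derive1E d2 /g patchE mem_set//= in_itv/=.
by rewrite !ltW.
Unshelve. all: by end_near. Qed.

(** Letting the cutoffs tend to [(a - s)_+] gives
  [int_0^a A = a A0 + int_0^a (a - s) B(s) ds] for every [a], and it remains to
  differentiate in [a] at the Lebesgue points. *)
Lemma time_primitive :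
  {ae lambda, forall t, 0 <= t <= T -> A t = A0 + \int[lambda]_(s in `[0, t]) B s}.
Proof.
have H1 := ae_imp2 (fun t a b => conj a b) (diffFI IA) (diffFI IB).
have H2 := ae_imp2 (fun t a b => conj a b) H1 (diffFI IsB).
have H3 := ae_imp2 (fun t a b => conj a b) (ae_neq 0) (ae_neq T).
apply: ae_imp2 H2 H3 => t [[dA dB] dsB] [t0 tT] /andP[t0' tT'].
have t0T : 0 < t < T by rewrite !lt_neqAle eq_sym t0 t0' tT tT'.
have {}dA := dA t0T; have {}dB := dB t0T; have {}dsB := dsB t0T.
have d1 : is_derive t 1 (fun a => A0 * a + a * FI B a - FI (fun s => B s * s) a)
   (A0 + (t * B t + FI B t) - B t * t).
  have [h1 h2] := is_deriveB (is_deriveD (is_deriveM (is_derive_cst A0 t 1) (is_derive_id t 1))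
       (is_deriveM (is_derive_id t 1) dB)) dsB.
  apply: DeriveDef; first exact: h1.
  by apply: (etrans h2); rewrite scaler0 addr0 /GRing.scale/= !mulr1.
have E : {near t, (fun a => A0 * a + a * FI B a - FI (fun s => B s * s) a) =1 FI A}.
  near=> a; rewrite test_limit//; apply/andP; split.
    by near: a; apply: lt_nbhsr; case/andP : t0T.
  by near: a; apply: lt_nbhsl; case/andP : t0T.
have [_ <-] := dA; have [_ ->] := near_eq_is_derive E d1.
by rewrite -/(FI B t); ring.
Unshelve. all: by end_near. Qed.

End TimePrimitive.

Section WeakTime.
Context {R : realType} {d : nat}.
Local Notation X := 'rV[R]_d.
Local Notation lambda := (@lebesgue_measure R).

Lemma jcontinuous_cutoff (a : R) n :
  jcontinuous (fun s (_ : X) => cutoff a n s) /\ jcontinuous (fun s (_ : X) => cutoff' a n s).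
Proof.
have [c1 c2] := continuous_cutoff a n.
by split=> z; apply: continuous_comp; [exact: cvg_fst|exact: c1|exact: cvg_fst|exact: c2].
Qed.

(** Testing in time only: by Fubini this is the one-dimensional statement for the
  integrals over the torus. *)
Lemma weak_time (T : R) (f g : R -> X -> R) (f0 : X -> R) : 0 < T ->
  stL1 T f -> stL1 T g ->
  (forall a n, 0 < a < T ->
    st_int T (fun s x => f s x * cutoff' a n s + g s x * cutoff a n s)
    + torus_int f0 * cutoff a n 0 = 0) ->
  {ae lambda, forall t, 0 <= t <= T -> torus_int (f t) = torus_int f0 + st_int t g}.
Proof.
move=> T0 If Ig H.
apply: (@time_primitive _ T (fun s => torus_int (f s)) (fun s => torus_int (g s)) (torus_int f0)) => //.
- exact: stL1_torus_int.
- exact: stL1_torus_int.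
move=> a n aT; rewrite -[RHS](H a n aT); congr (_ + _).
have [c1 c2] := jcontinuous_cutoff a n.
have E : {ae lambda, forall s, 0 <= s <= T ->
    torus_int (fun x => f s x * cutoff' a n s + g s x * cutoff a n s)
    = torus_int (f s) * cutoff' a n s + torus_int (g s) * cutoff a n s}.
  apply: ae_imp2 (stL1_slice If) (stL1_slice Ig) => s Ifs Igs sT.
  have {}Ifs := Ifs sT; have {}Igs := Igs sT.
  have E (h : X -> R) k : tL1 h -> tL1 (fun x => h x * k) /\ torus_int (fun x => h x * k) = torus_int h * k.
    move=> Ih; under eq_fun do rewrite mulrC.
    by split; [exact: tL1Z|rewrite torus_intZ// mulrC].
  have [I1 E1] := E _ (cutoff' a n s) Ifs; have [I2 E2] := E _ (cutoff a n s) Igs.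
  by rewrite torus_intD// E1 E2.
have IW : stL1 T (fun s x => f s x * cutoff' a n s + g s x * cutoff a n s).
  by apply: stL1D; exact: stL1M.
apply: ae_eq_Rintegral.
- have [k1 k2] := continuous_cutoff a n.
  have I1 := integrableM_continuous (stL1_torus_int If) k2.
  have I2 := integrableM_continuous (stL1_torus_int Ig) k1.
  by have := integrableD (measurable_itv `[0, T] : measurable (`[0, T]%classic : set (measurableTypeR R))) I1 I2.
- exact: stL1_torus_int IW.
- by apply: ae_imp E => s Es sT; rewrite Es.
Qed.

End WeakTime.

(** * Polynomial approximation in C^1 *)

Section PolynomialApproximation.
Context {R : realType}.

(** The Bernstein sum [sum_k C(n,k) x^k (1-x)^(n-k) g k], defined by conditioning
  on the first of [n] coin tosses: all its moments follow by induction. *)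
Fixpoint bern (n : nat) (g : nat -> R) : {poly R} :=
  if n is n'.+1 then
    'X * bern n' (fun k => g k.+1) + (1 - 'X) * bern n' g
  else (g 0%N)%:P.

Lemma bernS n g (x : R) :
  (bern n.+1 g).[x] = x * (bern n (fun k => g k.+1)).[x] + (1 - x) * (bern n g).[x].
Proof. by rewrite /= hornerD !hornerM hornerX hornerD hornerN hornerX hornerC. Qed.

Lemma bern_cst n (c x : R) : (bern n (fun=> c)).[x] = c.
Proof. by elim: n => [|n IH]; rewrite ?bernS ?IH /= ?hornerC//; ring. Qed.

Lemma bernD n g1 g2 (x : R) :
  (bern n (fun k => g1 k + g2 k)).[x] = (bern n g1).[x] + (bern n g2).[x].
Proof.
by elim: n g1 g2 => [|n IH] g1 g2; rewrite ?bernS ?IH /= ?hornerC//; ring.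
Qed.

Lemma bernZ n c g (x : R) : (bern n (fun k => c * g k)).[x] = c * (bern n g).[x].
Proof. by elim: n g => [|n IH] g; rewrite ?bernS ?IH /= ?hornerC//; ring. Qed.

Lemma bern_le n g1 g2 (x : R) : 0 <= x <= 1 -> (forall k, (k <= n)%N -> g1 k <= g2 k) ->
  (bern n g1).[x] <= (bern n g2).[x].
Proof.
move=> /andP[x0 x1]; elim: n g1 g2 => [|n IH] g1 g2 H.
  by rewrite /= !hornerC; exact: H.
rewrite !bernS; apply: lerD; apply: ler_wpM2l => //; rewrite ?subr_ge0//; apply: IH => k kn.
  exact: H.
by apply: H; exact: (leq_trans kn).
Qed.

Lemma bern_norm n g1 g2 (x : R) : 0 <= x <= 1 -> (forall k, (k <= n)%N -> `|g1 k| <= g2 k) ->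
  `|(bern n g1).[x]| <= (bern n g2).[x].
Proof.
move=> x01 H; rewrite ler_norml -mulN1r -bernZ; apply/andP; split; apply: bern_le => // k kn.
  by rewrite mulN1r; have := H k kn; rewrite ler_norml => /andP[].
exact: le_trans (ler_norm _) (H k kn).
Qed.

(** The variance of a binomial law: at [c = n x] it is of order [n], not [n^2]. *)
Lemma bern_variance n (c x : R) :
  (bern n (fun k => (k%:R - c) ^+ 2)).[x] = n%:R * x * (1 - x) + (n%:R * x - c) ^+ 2.
Proof.
elim: n c => [|n IH] c; first by rewrite /= hornerC; ring.
rewrite bernS IH.
have -> : (fun k => (k.+1%:R - c) ^+ 2) = (fun k : nat => (k%:R - (c - 1)) ^+ 2).
  by apply/funext => k; rewrite -natr1; ring.
by rewrite IH -natr1; ring.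
Qed.

(** Bernstein's argument: [|x - k/N| <= eta + |x - k/N|^2 / eta], and the Bernstein
  sum of the last term is at most [1 / (eta N)] by [bern_variance]. *)
Lemma lipschitz_poly01 (f : R -> R) (L eps : R) : 0 < eps ->
  (forall x y, 0 <= x <= 1 -> 0 <= y <= 1 -> `|f x - f y| <= L * `|x - y|) ->
  exists P : {poly R}, forall x, 0 <= x <= 1 -> `|f x - P.[x]| <= eps.
Proof.
move=> eps0 lf.
pose K := `|L| + 1; have K0 : 0 < K by rewrite ltr_wpDl.
pose eta := eps / (2 * K); have eta0 : 0 < eta by rewrite divr_gt0// mulr_gt0.
have c0 : 0 < eps * eta / (2 * K) by rewrite divr_gt0// mulr_gt0.
have [n /=] := ltr_add_invr c0; rewrite add0r => nH.
pose N : R := n.+1%:R; have N0 : 0 < N by rewrite ltr0n.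
exists (bern n.+1 (fun k => f (k%:R / N))) => x x01; have /andP[x0 x1] := x01.
have E : f x - (bern n.+1 (fun k => f (k%:R / N))).[x]
   = (bern n.+1 (fun k => f x + -1 * f (k%:R / N))).[x].
  by rewrite bernD bern_cst bernZ mulN1r.
rewrite E.
have H := @bern_norm n.+1 (fun k => f x + -1 * f (k%:R / N))
  (fun k => K * eta + K / (eta * N ^+ 2) * (k%:R - N * x) ^+ 2) x x01.
apply: le_trans (H _) _.
  move=> k kn; rewrite mulN1r.
  have k01 : 0 <= k%:R / N <= 1.
    by rewrite divr_ge0 ?ler0n ?(ltW N0)//= ler_pdivrMr// mul1r ler_nat.
  apply: le_trans (lf _ _ x01 k01) _.
  set z := x - _.
  have zE : (k%:R - N * x) ^+ 2 = N ^+ 2 * z ^+ 2.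
    by rewrite /z; field; rewrite gt_eqF.
  rewrite zE.
  have -> : K * eta + K / (eta * N ^+ 2) * (N ^+ 2 * z ^+ 2) = K * (eta + z ^+ 2 / eta).
    by field; rewrite !gt_eqF.
  apply: (@le_trans _ _ (K * `|z|)).
    by apply: ler_wpM2r => //; rewrite (le_trans (ler_norm _))// lerDl.
  apply: ler_wpM2l; first exact: ltW.
  have -> : eta + z ^+ 2 / eta = (eta ^+ 2 + `|z| ^+ 2) / eta.
    by rewrite real_normK ?num_real//; field; rewrite gt_eqF.
  rewrite ler_pdivlMr//.
  by have := normr_ge0 z; nra.
rewrite (bernD _ (fun=> K * eta)) bern_cst bernZ bern_variance subrr expr0n/= addr0 -/N.
have -> : K * eta = eps / 2 by rewrite /eta; field; rewrite gt_eqF.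
rewrite [leRHS]splitr lerD2l.
have -> : K / (eta * N ^+ 2) * (N * x * (1 - x)) = (x * (1 - x)) * (K / eta * N^-1).
  by field; rewrite !gt_eqF.
apply: (@le_trans _ _ (1 * (K / eta * N^-1))).
  apply: ler_wpM2r; first by rewrite !mulr_ge0 ?invr_ge0 ?ltW.
  nra.
rewrite mul1r; have -> : eps / 2 = K / eta * (eps * eta / (2 * K)).
  by field; rewrite !gt_eqF.
by apply: ler_wpM2l; [rewrite mulr_ge0 ?invr_ge0 ?ltW|exact: ltW].
Qed.

Lemma lipschitz_poly (f : R -> R) (m M L eps : R) : m < M -> 0 < eps ->
  (forall x y, m <= x <= M -> m <= y <= M -> `|f x - f y| <= L * `|x - y|) ->
  exists P : {poly R}, forall x, m <= x <= M -> `|f x - P.[x]| <= eps.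
Proof.
move=> mM eps0 lf; pose D := M - m; have D0 : 0 < D by rewrite subr_gt0.
have inmM y : 0 <= y <= 1 -> m <= m + D * y <= M.
  move=> /andP[y0 y1]; rewrite lerDl mulr_ge0 ?(ltW D0)//=.
  by rewrite -lerBrDl ler_piMr// ltW.
have [|P HP] := @lipschitz_poly01 (fun y => f (m + D * y)) (L * D) eps eps0.
  move=> x y x01 y01; apply: le_trans (lf _ _ (inmM _ x01) (inmM _ y01)) _.
  have -> : m + D * x - (m + D * y) = D * (x - y) by ring.
  by rewrite normrM (gtr0_norm D0) mulrA.
exists (P \Po (D^-1 *: ('X - m%:P))) => x /andP[mx xM].
rewrite horner_comp hornerZ hornerXsubC.
have y01 : 0 <= D^-1 * (x - m) <= 1.
  apply/andP; split.
    by apply: mulr_ge0; rewrite ?subr_ge0// invr_ge0 ltW.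
  by rewrite mulrC ler_pdivrMr// mul1r lerD2r.
have := HP _ y01.
by have -> : m + D * (D^-1 * (x - m)) = x by field; rewrite gt_eqF.
Qed.

Lemma poly_primitive (P : {poly R}) : exists Q, Q^`() = P.
Proof.
exists (\sum_(i < size P) (P`_i / i.+1%:R) *: 'X^(i.+1)).
rewrite raddf_sum/= -[RHS]coefK poly_def; apply: eq_bigr => i _.
by rewrite derivZ derivXn/= -['X^i *+ _]scaler_nat scalerA divfK.
Qed.

(** A primitive of a polynomial close to [h'] is close to [h], by the mean value
  theorem for the difference. *)
Lemma C1_poly_approx (h h' : R -> R) (m M L eps : R) : m < M -> 0 < eps ->
  (forall x, m <= x <= M -> is_derive x 1 h (h' x)) ->
  (forall x y, m <= x <= M -> m <= y <= M -> `|h' x - h' y| <= L * `|x - y|) ->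
  exists Q : {poly R}, forall x, m <= x <= M ->
    `|h x - Q.[x]| <= eps /\ `|h' x - Q^`().[x]| <= eps.
Proof.
move=> mM eps0 dh lh'.
pose D := 1 + (M - m); have D0 : 0 < D by rewrite addr_gt0// subr_gt0.
have e0 : 0 < eps / D by rewrite divr_gt0.
have [P HP] := lipschitz_poly mM e0 lh'.
have [Q0 HQ0] := poly_primitive P.
pose Q := Q0 + (h m - Q0.[m])%:P.
have dQ : Q^`() = P by rewrite /Q derivD derivC addr0.
exists Q => x xmM; have /andP[mx xM] := xmM.
have De : eps / D <= eps.
  rewrite ler_pdivrMr//; apply: ler_peMr; first exact: ltW.
  by rewrite lerDl subr_ge0 ltW.
split; last by rewrite dQ; exact: le_trans (HP x xmM) De.
have dk y : m <= y <= M -> is_derive y 1 (fun z => h z - Q.[z]) (h' y - P.[y]).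
  move=> ymM; have dQy : is_derive y 1 (horner Q) (P.[y]).
    apply: DeriveDef; first exact: derivable_horner.
    by rewrite -derive1E -derivE dQ.
  have [h1 h2] := is_deriveB (dh y ymM) dQy.
  by apply: DeriveDef; [exact: h1|exact: h2].
have [y yx E] : exists2 c, c \in `[m, x]%R & (h x - Q.[x]) - (h m - Q.[m]) = (h' c - P.[c]) * (x - m).
  apply: (@MVT_segment _ (fun z => h z - Q.[z]) (fun c => h' c - P.[c])) => //.
    move=> z; rewrite in_itv/= => /andP[mz zx]; apply: dk.
    by rewrite ltW//= (le_trans (ltW zx)).
  apply: derivable_within_continuous => z; rewrite in_itv/= => /andP[mz zx].
  have zM : m <= z <= M by rewrite mz (le_trans zx).
  by have [] := dk z zM.
move: yx; rewrite in_itv/= => /andP[my yx].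
have ymM : m <= y <= M by rewrite my (le_trans yx).
have Qm : h m - Q.[m] = 0 by rewrite /Q hornerD hornerC; ring.
rewrite Qm subr0 in E; rewrite E normrM.
apply: (@le_trans _ _ (eps / D * D)); last by rewrite divfK// gt_eqF.
apply: ler_pM => //; first exact: HP.
rewrite ger0_norm ?subr_ge0// /D.
by rewrite (@le_trans _ _ (M - m)) ?lerD2r// lerDr.
Qed.

End PolynomialApproximation.

(** * Divergence theorem and fundamental theorem of calculus *)

Section FundamentalTheorem.
Context {R : realType}.
Local Notation RL := (measurableTypeR R).
Local Notation lambda := (@lebesgue_measure R).

Lemma integral_derive (F f : R -> R) (a b : R) : a < b ->
  (forall x : R, is_derive x 1 F (f x)) -> continuous f ->
  (\int[lambda]_(x in `[a, b]) (f x)%:E = (F b - F a)%:E)%E.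
Proof.
move=> ab dF cf.
have cF : continuous F.
  by move=> x; apply/differentiable_continuous/derivable1_diffP; have [] := dF x.
rewrite (continuous_FTC2 (F := F) ab) ?EFinB//.
- exact: continuous_subspaceT.
- split=> [x _||]; first by have [] := dF x.
    by apply: cvg_at_right_filter; exact: cF.
  by apply: cvg_at_left_filter; exact: cF.
- by move=> x _; rewrite derive1E; have [] := dF x.
Qed.

Lemma integral_uniform01 (h : R -> R) : measurable_fun [set: RL] h ->
  (\int[uniform_prob (@ltr01 R)]_x (h x)%:E = \int[lambda]_(x in `[0%R, 1%R]) (h x)%:E)%E.
Proof.
move=> mh; have mE : measurable_fun [set: RL] (EFin \o h) by exact/measurable_EFinP.
rewrite integralE [RHS]integralE; congr (_ - _)%E.
- rewrite integral_uniform//; last exact: measurable_funepos.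
  by rewrite subr0 invr1 mul1e.
- rewrite integral_uniform//; last exact: measurable_funeneg.
  by rewrite subr0 invr1 mul1e.
Qed.

Definition upd n (z : n.-tuple RL) (i : 'I_n) (s : RL) : n.-tuple RL :=
  [tuple if j == i then s else tnth z j | j < n].

Lemma tnth_upd n (z : n.-tuple RL) i s j : tnth (upd z i s) j = if j == i then s else tnth z j.
Proof. by rewrite tnth_mktuple. Qed.

Lemma upd_head n (x : RL) (z : n.-tuple RL) s : upd (consp (x, z)) ord0 s = consp (s, z).
Proof.
apply: eq_from_tnth => j; rewrite tnth_upd /consp.
have [k ->|->] := unliftP ord0 j; first by rewrite !tnthS.
by rewrite eqxx !tnth0.
Qed.

Lemma upd_tail n (x : RL) (z : n.-tuple RL) i s :
  upd (consp (x, z)) (lift ord0 i) s = consp (x, upd z i s).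
Proof.
apply: eq_from_tnth => j; rewrite tnth_upd /consp.
have [k ->|->] := unliftP ord0 j; last by rewrite !tnth0.
by rewrite !tnthS tnth_upd (inj_eq lift_inj).
Qed.

(** The sample space is a product of unit intervals: integrating first in the
  chosen coordinate, the fundamental theorem leaves the difference of the values
  on opposite faces. *)
Lemma torus_measure_derive n (i : 'I_n) (f g : n.-tuple RL -> R) :
  (torus_measure R n).-integrable setT (EFin \o g) ->
  (forall z s, is_derive (s : R) 1 (fun s : R => f (upd z i s)) (g (upd z i s))) ->
  (forall z, continuous (fun s : R => g (upd z i s))) ->
  (forall z, f (upd z i 1) = f (upd z i 0)) ->
  (\int[torus_measure R n]_z (g z)%:E = 0)%E.
Proof.
elim: n i f g => [[]//|n IH] i f g Ig dfg cg per.
have mg : measurable_fun setT (EFin \o g) by exact: measurable_int Ig.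
pose m1 := uniform_prob (@ltr01 R).
pose m2 := torus_measure R n.
pose G (p : RL * n.-tuple RL) := (g (consp p))%:E.
have mG : measurable_fun setT G.
  by apply: (measurableT_comp mg); exact: measurable_consp.
have IG : (m1 \x m2)%E.-integrable setT G.
  apply/integrableP; split=> //; move/integrableP : Ig => [_].
  rewrite [X in (X < _)%E -> _](_ : _ = \int[m1 \x m2]_p `|G p|)%E//.
  rewrite /= /distribution ge0_integral_pushforward//=.
  apply/measurable_EFinP; apply: measurableT_comp => //.
  exact/measurable_EFinP.
have -> : (\int[torus_measure R n.+1]_z (g z)%:E = \int[m1 \x m2]_p G p)%E.
  rewrite /= /distribution integral_pushforward//=.
have [j Ei|Ei] := unliftP ord0 i; rewrite Ei in dfg cg per.
- rewrite -(integral12_prod_meas1 IG).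
  rewrite (@ae_eq_integral _ _ _ _ setT (cst 0%E))//; first by rewrite integral0.
  - exact: measurable_fubini_F IG.
  - have := ae_integrable1 IG; apply: filterS => x Ix _.
    apply: (IH j (fun z => f (consp (x, z)))) => //.
    + by move=> z s; have := dfg (consp (x, z)) s; under eq_fun do rewrite upd_tail; rewrite upd_tail.
    + by move=> z; have := cg (consp (x, z)); under eq_fun do rewrite upd_tail.
    + by move=> z; have := per (consp (x, z)); rewrite !upd_tail.
- rewrite -(integral21_prod_meas1 IG).
  rewrite (eq_integral (fun=> 0%E)); first by rewrite integral0.
  move=> z _; rewrite /fubini_G.
  have d1 s : is_derive (s : R) 1 (fun s : R => f (consp (s, z))) (g (consp (s, z))).
    by have := dfg (consp (0, z)) s; under eq_fun do rewrite upd_head; rewrite upd_head.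
  have c1 : continuous (fun s : R => g (consp (s, z))).
    by have := cg (consp (0, z)); under eq_fun do rewrite upd_head.
  have p1 : f (consp (1, z)) = f (consp (0, z)).
    by have := per (consp (0, z)); rewrite !upd_head.
  rewrite [LHS](integral_uniform01 (continuous_measurable_fun c1)).
  by rewrite (integral_derive ltr01 d1 c1) p1 subrr.
Qed.

End FundamentalTheorem.

Section Divergence.
Context {R : realType} {d : nat}.
Local Notation X := 'rV[R]_d.
Local Notation RL := (measurableTypeR R).
Local Notation TX := (d.-tuple RL).
Local Notation lambda := (@lebesgue_measure R).
Local Notation mu := (torus_measure R d).

Lemma cellpt_upd (z : TX) i s :
  cellpt (upd z i s) = (s : R) *: delta_mx 0 i + cellpt (upd z i 0) :> X.
Proof.
apply/rowP => j; rewrite !mxE !tnth_upd eqxx/=.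
by case: eqP => _; rewrite ?mulr1 ?mulr0 ?addr0 ?add0r.
Qed.

Lemma torus_int_pd (f : X -> R) i : (forall x, derivable f x (delta_mx 0 i)) ->
  continuous (pd i f) -> tperiodic f -> torus_int (pd i f) = 0.
Proof.
move=> df cf pf; rewrite /torus_int /Rintegral.
suff -> : (\int[mu]_z (pd i f (cellpt z))%:E = 0)%E by [].
apply: (@torus_measure_derive _ _ i (f \o cellpt) (pd i f \o cellpt)).
- exact: tL1_continuous.
- move=> z s; rewrite /= cellpt_upd.
  under eq_fun do rewrite cellpt_upd.
  exact: is_derive_line.
- move=> z s; rewrite /=; under eq_fun do rewrite cellpt_upd.
  apply: (@continuous_comp _ _ _ (fun s : R => s *: delta_mx 0 i + cellpt (upd z i 0)) (pd i f)).
    exact: continuous_line.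
  by rewrite -cellpt_upd; exact: cf.
- by move=> z; rewrite /= cellpt_upd scale1r addrC pf.
Qed.

(** The fundamental theorem at each point of the torus, followed by Fubini. *)
Lemma torus_int_FTC (g : R -> X -> R) t : 0 <= t -> jcontinuous g -> jcontinuous (dt g) ->
  (forall s x, derivable (g^~ x) s 1) ->
  torus_int (g t) - torus_int (g 0) = st_int t (dt g).
Proof.
move=> t0 cg cdg dg.
have := t0; rewrite le_eqVlt => /predU1P[<-|t_gt0].
  rewrite subrr /st_int set_itv1.
  by rewrite Rintegral_set1.
have Ist := stL1_jcontinuous t cdg.
have Ig s : tL1 (g s) by exact/tL1_continuous/jcontinuous_slice.
rewrite -torus_intB//.
pose F (p : RL * TX) := (dt g p.1 (cellpt p.2))%:E.
pose H := F \_ (cyl (d := d) t).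
have IH : (lambda \x mu)%E.-integrable setT H.
  by apply/(integrable_mkcond _ (measurable_cyl t)).
have Fub := Fubini IH.
rewrite /st_int /torus_int /Rintegral; congr fine.
transitivity (\int[mu]_y \int[lambda]_x H (x, y))%E.
  apply: eq_integral => z _.
  have d1 s : is_derive (s : R) 1 (fun s => g s (cellpt z)) (dt g s (cellpt z)).
    by apply: DeriveDef; [exact: dg|rewrite /dt derive1E].
  rewrite -(integral_derive t_gt0 d1 (jcontinuous_time cdg)).
  rewrite integral_mkcond; apply: eq_integral => s _.
  rewrite /H !patchE.
  have -> : ((s, z) \in cyl (d := d) t) = (s \in `[0, t]%classic).
    apply/idP/idP; rewrite !inE; first by case.
    by move=> st; split.
  by case: ifPn.
rewrite -Fub [RHS]integral_mkcond; apply: eq_integral => s _.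
rewrite patchE; case: ifPn => st.
  rewrite -[RHS]/((fine _)%:E) fineK; last first.
    apply: (integrable_fin_num measurableT).
    exact: (tL1_continuous (@jcontinuous_slice _ _ (dt g) s cdg)).
  apply: eq_integral => z _; rewrite /H patchE mem_set//.
  by split=> //; move: st; rewrite inE.
apply: integral0_eq => z _; rewrite /H patchE ifN//.
by apply: contra st; rewrite !inE => -[].
Qed.

End Divergence.

(** * Pressure potential *)

Section OrientedIntegral.
Context {R : realType}.
Local Notation lambda := (@lebesgue_measure R).

Lemma oriented_int_derive (f : R -> R) (b s : R) : 0 < b -> 0 < s ->
  (forall z, 0 < z -> {for z, continuous f}) ->
  is_derive s 1 (fun y => oriented_int b y f) (f s).
Proof.
move=> b0 s0 cf.
(* Moving the base point to [c], below both [b] and [s], turns the oriented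
   integral into a difference of integrals over intervals starting at [c]. *)
pose c := Num.min b s / 2.
have m0 : 0 < Num.min b s by rewrite lt_min b0.
have c0 : 0 < c by rewrite divr_gt0.
have cm : c < Num.min b s by rewrite ltr_pdivrMr// mulr2n mulrDr mulr1 ltrDl.
have cb : c < b by apply: lt_le_trans cm _; rewrite ge_min lexx.
have cs : c < s by apply: lt_le_trans cm _; rewrite ge_min lexx orbT.
have If u : lambda.-integrable `[c, u] (EFin \o f).
  apply: continuous_compact_integrable; first exact: segment_compact.
  apply/continuous_in_subspaceT => z /[1!inE]; rewrite /= in_itv/= => /andP[cz _].
  by apply: cf; exact: lt_le_trans cz.
pose F y := \int[lambda]_(z in `[c, y]) f z.
have FB x y : c <= x -> x <= y -> F y - F x = \int[lambda]_(z in `[x, y]) f z.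
  move=> cx xy; rewrite /F Rintegral_itvB ?bnd_simp//.
  rewrite Rintegral_itv_obnd_cbnd//.
  by apply: integrableS (If y) => //; apply: subset_itvr; rewrite bnd_simp.
have E y : c < y -> F y - F b = oriented_int b y f.
  move=> cy; rewrite /oriented_int; case: leP => yb; first by rewrite FB// ltW.
  by rewrite -FB ?opprB// ltW.
have s1 : s < s + 1 by rewrite ltrDl.
have [dF1 dF2] := continuous_FTC1_closed s1 (If (s + 1)) cs (cf s s0).
have dF : is_derive s 1 F (f s) by apply: DeriveDef; [exact: dF1|rewrite -derive1E; exact: dF2].
have [h1 h2] := is_deriveB dF (is_derive_cst (F b) s 1).
have dFb : is_derive s 1 (fun y => F y - F b) (f s).
  by apply: DeriveDef; [exact: h1|apply: (etrans h2); rewrite subr0].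
apply: near_eq_is_derive dFb; near=> y; apply: E.
by near: y; exact: lt_nbhsr.
Unshelve. all: by end_near. Qed.

Lemma C1_lipschitz (q q' : R -> R) (m M : R) :
  (forall x, m <= x <= M -> is_derive x 1 q (q' x)) ->
  (forall x, m <= x <= M -> {for x, continuous q'}) ->
  exists L, forall x y, m <= x <= M -> m <= y <= M -> `|q x - q y| <= L * `|x - y|.
Proof.
move=> dq cq'.
have cq : {within `[m, M], continuous q'}.
  apply/continuous_in_subspaceT => z /[1!inE]; rewrite /= in_itv/=; exact: cq'.
have := compact_bounded (continuous_compact cq (@segment_compact R m M)).
move=> [K [_ HK]]; exists (`|K| + 1).
have main x y : m <= x <= M -> m <= y <= M -> x <= y -> `|q y - q x| <= (`|K| + 1) * `|y - x|.
  move=> /andP[mx xM] /andP[my yM] xy.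
  have sub z : z \in `[x, y]%R -> m <= z <= M.
    by rewrite in_itv/= => /andP[xz zy]; rewrite (le_trans mx)//= (le_trans zy).
  have [z zxy ->] : exists2 z, z \in `[x, y]%R & q y - q x = q' z * (y - x).
    apply: MVT_segment => //.
      by move=> z zi; apply/dq/sub; apply: subset_itv_oo_cc zi.
    by apply: derivable_within_continuous => z /sub zM; have [] := dq z zM.
  rewrite normrM ler_wpM2r//; apply: (HK (`|K| + 1)).
    by rewrite (le_lt_trans (ler_norm _))// ltrDl.
  by exists z => //; rewrite /= in_itv/=; exact: sub.
move=> x y xM yM; have [xy|yx] := leP x y.
  by rewrite distrC [`|x - y|]distrC; exact: main.
exact/main/ltW.
Qed.

End OrientedIntegral.

Section Pressure.
Context {R : realType}.
Variables (p : R -> R) (rbar : R).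
Hypothesis hp : pressure_law p.
Hypothesis rbar0 : 0 < rbar.

Let dp (s : R) : 0 < s -> is_derive s 1 p (derive1 p s).
Proof.
by case: hp => _ H _ _ _ s0; have [h1 _ _] := H s s0; apply: DeriveDef; [exact: h1|exact/esym/derive1E].
Qed.

Lemma pressure_derivable (s : R) : 0 < s -> derivable p s 1.
Proof. by move=> /dp[]. Qed.

Lemma pressure_continuous (s : R) : 0 < s -> {for s, continuous p}.
Proof. by move=> s0; apply/differentiable_continuous/derivable1_diffP/pressure_derivable. Qed.

Let dp' (s : R) : 0 < s -> is_derive s 1 (derive1 p) (derive1 (derive1 p) s).
Proof.
by case: hp => _ H _ _ _ s0; have [_ h1 _] := H s s0; apply: DeriveDef; [exact: h1|exact/esym/derive1E].
Qed.

Lemma pressure'_continuous (s : R) : 0 < s -> {for s, continuous (derive1 p)}.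
Proof.
by move=> s0; apply/differentiable_continuous/derivable1_diffP; have [] := dp' s0.
Qed.

Let g (z : R) := p z / z ^+ 2.

Let dV (s : R) : s != 0 -> is_derive s 1 (fun y : R => y^-1) (- s ^- 2).
Proof.
by move=> s0; apply: is_derive_eq; [apply: is_deriveV|rewrite [_ *: _]mulr1].
Qed.

Let cg (z : R) : 0 < z -> {for z, continuous g}.
Proof.
move=> z0; apply: cvgM; first exact: pressure_continuous.
apply: cvgV; first by rewrite expf_neq0// gt_eqF.
exact: exprn_continuous.
Qed.

Let dint (s : R) : 0 < s -> is_derive s 1 (fun y => oriented_int rbar y g) (g s).
Proof. by move=> s0; exact: oriented_int_derive. Qed.

Let dHpot (s : R) : 0 < s ->
  is_derive s 1 (Hpot p rbar) (oriented_int rbar s g + p s / s).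
Proof.
move=> s0; have [h1 h2] := is_deriveM (is_derive_id s 1) (dint s0).
apply: DeriveDef; first exact: h1.
apply: (etrans h2); rewrite /GRing.scale/= mulr1 addrC; congr (_ + _).
by rewrite /g; field; rewrite gt_eqF.
Qed.

Lemma Hpot'E (s : R) : 0 < s -> derive1 (Hpot p rbar) s = oriented_int rbar s g + p s / s.
Proof. by move=> s0; rewrite derive1E; have [] := dHpot s0. Qed.

Lemma Hpot_pressure (s : R) : 0 < s -> derive1 (Hpot p rbar) s * s - Hpot p rbar s = p s.
Proof. by move=> s0; rewrite Hpot'E// /Hpot -/g; field; rewrite gt_eqF. Qed.

Lemma is_derive_Hpot' (s : R) : 0 < s ->
  is_derive s 1 (derive1 (Hpot p rbar)) (derive1 p s / s).
Proof.
move=> s0.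
have [h1 h2] := is_deriveD (dint s0) (is_deriveM (dp s0) (dV (lt0r_neq0 s0))).
have d1 : is_derive s 1 (fun y => oriented_int rbar y g + p y / y) (derive1 p s / s).
  apply: DeriveDef; first exact: h1.
  apply: (etrans h2); rewrite /GRing.scale/= /g; field; rewrite gt_eqF//.
apply: near_eq_is_derive d1; near=> y; rewrite Hpot'E//.
by near: y; exact: lt_nbhsr.
Unshelve. all: by end_near. Qed.

(** [H'' = p'/s] is continuously differentiable on the half-line, because [p] is [C^2]. *)
Lemma Hpot''_lipschitz (m M : R) : 0 < m -> exists L, forall x y, m <= x <= M -> m <= y <= M ->
  `|derive1 p x / x - derive1 p y / y| <= L * `|x - y|.
Proof.
move=> m0.
apply: (@C1_lipschitz _ (fun s => derive1 p s / s)
  (fun s => derive1 p s * - s ^- 2 + s^-1 * derive1 (derive1 p) s)) => s /andP[ms _].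
  have s0 : 0 < s by exact: lt_le_trans ms.
  have [h1 h2] := is_deriveM (dp' s0) (dV (lt0r_neq0 s0)).
  by apply: DeriveDef; [exact: h1|exact: (etrans h2)].
have s0 : 0 < s by exact: lt_le_trans ms.
have sn0 : s != 0 by rewrite gt_eqF.
have cV : {for s, continuous (fun y : R => y^-1)} by apply: cvgV => //; exact: cvg_id.
apply: cvgD; apply: cvgM => //.
- exact: pressure'_continuous.
- apply: cvgN; apply: cvgV; first by rewrite expf_neq0.
  exact: exprn_continuous.
- by case: hp => _ H _ _ _; have [_ _] := H s s0.
Qed.

End Pressure.

Section PeriodicBounds.
Context {R : realType} {d : nat}.
Local Notation X := 'rV[R]_d.

Lemma tperiodic_nat (V : Type) (f : X -> V) (x : X) j n : tperiodic f ->
  f (x + n%:R *: delta_mx 0 j) = f x.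
Proof.
move=> pf; elim: n => [|n IH]; first by rewrite scale0r addr0.
by rewrite -natr1 scalerDl scale1r addrA pf.
Qed.

Lemma tperiodic_int (V : Type) (f : X -> V) (x : X) j (n : int) : tperiodic f ->
  f (x + n%:~R *: delta_mx 0 j) = f x.
Proof.
move=> pf; case: n => n; first exact: tperiodic_nat.
rewrite NegzE -(tperiodic_nat _ j n.+1 pf) -addrA -scalerDl.
by rewrite mulrNz addNr scale0r addr0.
Qed.

(** Integer parts are subtracted one coordinate at a time. *)
Lemma tperiodic_cell (V : Type) (f : X -> V) (x : X) : tperiodic f ->
  exists2 y : X, f y = f x & forall i, 0 <= y 0 i <= 1.
Proof.
move=> pf.
pose y k : X := \row_j (x 0 j - (if (j < k)%N then (Num.floor (x 0 j))%:~R else 0)).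
have yf k : (k <= d)%N -> f (y k) = f x.
  elim: k => [|k IH] kd.
    by congr f; apply/rowP => j; rewrite mxE subr0.
  rewrite -IH ?(ltnW kd)//; pose j0 := Ordinal kd.
  rewrite -(@tperiodic_int _ f (y k) j0 (- Num.floor (x 0 j0)) pf); congr f.
  apply/rowP => j; rewrite !mxE eqxx/= -(inj_eq val_inj)/= ltnS leq_eqVlt.
  case: eqP => [jk|jk]/=; last by rewrite mulr0 addr0.
  have -> : j = j0 by apply: val_inj.
  by rewrite ltnn subr0 mulr1 mulrNz.
exists (y d); first exact: yf.
move=> i; rewrite mxE ltn_ord; have /andP[h1 h2] := floor_itv (x 0 i).
rewrite subr_ge0 h1/= lerBlDl -(rmorph1 (intmul 1)) -rmorphD/=.
exact: ltW.
Qed.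

Lemma smooth_bounded (f : R -> X -> R) T : smooth f ->
  exists2 M : R, 0 <= M & forall t x, 0 <= t <= T -> `|f t x| <= M.
Proof.
move=> sf; have [M M0 HM] := jcontinuous_bounded T (smooth_continuous sf).
exists M => // t x tT; case: sf => _ pf.
by have [y <- y01] := tperiodic_cell x (pf t); exact: HM.
Qed.

End PeriodicBounds.

(** * Vector calculus *)

Section VectorAlgebra.
Context {R : realType} {d : nat}.
Implicit Types (a b c : 'rV[R]_d) (A B M : 'M[R]_d) (k : R).

Lemma dotvC a b : dotv a b = dotv b a.
Proof. by apply: eq_bigr => i _; rewrite mulrC. Qed.

Lemma dotvDl a b c : dotv (a + b) c = dotv a c + dotv b c.
Proof. by rewrite /dotv -big_split; apply: eq_bigr => i _; rewrite mxE mulrDl. Qed.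

Lemma dotvZl k a b : dotv (k *: a) b = k * dotv a b.
Proof. by rewrite /dotv mulr_sumr; apply: eq_bigr => i _; rewrite mxE mulrA. Qed.

Lemma dotvNl a b : dotv (- a) b = - dotv a b.
Proof. by rewrite -scaleN1r dotvZl mulN1r. Qed.

Lemma dotvDr a b c : dotv a (b + c) = dotv a b + dotv a c.
Proof. by rewrite dotvC dotvDl !(dotvC a). Qed.

Lemma dotvZr k a b : dotv a (k *: b) = k * dotv a b.
Proof. by rewrite dotvC dotvZl dotvC. Qed.

Lemma dotvNr a b : dotv a (- b) = - dotv a b.
Proof. by rewrite dotvC dotvNl dotvC. Qed.

Definition dotvE := (dotvDl, dotvDr, dotvNl, dotvNr, dotvZl, dotvZr).

Lemma ddot_tensor a b M : ddot (tensor a b) M = dotv b (a *m M^T).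
Proof.
apply: eq_bigr => i _; rewrite mxE mulr_sumr; apply: eq_bigr => j _.
by rewrite !mxE; ring.
Qed.

Lemma dotv_mulmx_tr a b M : dotv b (a *m M^T) = dotv a (b *m M).
Proof.
rewrite /dotv; under eq_bigr do rewrite mxE mulr_sumr.
under [RHS]eq_bigr do rewrite mxE mulr_sumr.
rewrite exchange_big; apply: eq_bigr => i _; apply: eq_bigr => j _.
by rewrite mxE; ring.
Qed.

Lemma ddotC A B : ddot A B = ddot B A.
Proof. by apply: eq_bigr => i _; apply: eq_bigr => j _; rewrite mulrC. Qed.

Lemma ddotBr A B M : ddot M (A - B) = ddot M A - ddot M B.
Proof.
rewrite /ddot -sumrB; apply: eq_bigr => i _; rewrite -sumrB; apply: eq_bigr => j _.
by rewrite !mxE mulrBr.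
Qed.

Lemma ddotBl A B M : ddot (A - B) M = ddot A M - ddot B M.
Proof. by rewrite ddotC ddotBr !(ddotC M). Qed.

Lemma ddotZr k A B : ddot A (k *: B) = k * ddot A B.
Proof.
rewrite /ddot mulr_sumr; apply: eq_bigr => i _; rewrite mulr_sumr; apply: eq_bigr => j _.
by rewrite mxE; ring.
Qed.

Lemma ddot_tr A B : ddot A^T B^T = ddot A B.
Proof.
rewrite /ddot exchange_big; apply: eq_bigr => i _; apply: eq_bigr => j _.
by rewrite !mxE.
Qed.

Lemma ddot_sympart A M : sym_mx A -> ddot A (sympart M) = ddot A M.
Proof.
move=> sA; have E : ddot A M^T = ddot A M by rewrite -{1}sA ddot_tr.
transitivity (2^-1 * (ddot A M + ddot A M^T)); last by rewrite E; field.
rewrite /ddot -big_split mulr_sumr; apply: eq_bigr => i _ /=.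
rewrite -big_split mulr_sumr; apply: eq_bigr => j _ /=.
by rewrite !mxE; ring.
Qed.

Lemma sym_sympart M : sym_mx (sympart M).
Proof. by rewrite /sym_mx /sympart linearZ/= linearD/= trmxK addrC. Qed.

End VectorAlgebra.

Lemma sum_swap {R : realType} (d : nat) (F G : 'I_d -> 'I_d -> R) :
  (forall i j, F i j = G j i) -> \sum_i \sum_j F i j = \sum_i \sum_j G i j.
Proof.
by move=> FG; rewrite exchange_big; apply: eq_bigr => i _; apply: eq_bigr => j _.
Qed.

Section DifferentialIdentities.
Context {R : realType} {d : nat}.
Local Notation X := 'rV[R]_d.
Implicit Types (f g r : R -> X -> R) (v w : R -> X -> 'rV[R]_d) (t : R) (x : X).

Lemma pdD (f g : X -> R) j x :
  derivable f x (delta_mx 0 j) -> derivable g x (delta_mx 0 j) ->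
  pd j (fun y => f y + g y) x = pd j f x + pd j g x.
Proof. by move=> df dg; exact: deriveD. Qed.

Lemma pdB (f g : X -> R) j x :
  derivable f x (delta_mx 0 j) -> derivable g x (delta_mx 0 j) ->
  pd j (fun y => f y - g y) x = pd j f x - pd j g x.
Proof. by move=> df dg; exact: deriveB. Qed.

Lemma pdM (f g : X -> R) j x :
  derivable f x (delta_mx 0 j) -> derivable g x (delta_mx 0 j) ->
  pd j (fun y => f y * g y) x = f x * pd j g x + g x * pd j f x.
Proof. by move=> df dg; exact: deriveM. Qed.

Lemma pd_cst (k : R) j x : pd j (fun _ => k) x = 0.
Proof. by rewrite /pd derive_cst. Qed.

Lemma pd_sum (I : Type) (s : seq I) (f : I -> X -> R) j x :
  (forall i, derivable (f i) x (delta_mx 0 j)) ->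
  derivable (fun y => \sum_(i <- s) f i y) x (delta_mx 0 j) /\
  pd j (fun y => \sum_(i <- s) f i y) x = \sum_(i <- s) pd j (f i) x.
Proof.
move=> df; elim: s => [|i s [IH1 IH2]].
  rewrite big_nil; under eq_fun do rewrite big_nil.
  by split; [exact: derivable_cst|rewrite pd_cst].
rewrite big_cons -IH2; under eq_fun do rewrite big_cons.
by split; [exact: derivableD|exact: pdD].
Qed.

Lemma smooth_pd_sum (I : Type) (s : seq I) (f : I -> R -> X -> R) j t x :
  (forall i, smooth (f i)) ->
  pd j (fun y => \sum_(i <- s) f i t y) x = \sum_(i <- s) pd j (f i t) x.
Proof. by move=> sf; apply: (pd_sum _ _).2 => i; exact: smooth_derivable_pd. Qed.

Lemma smooth_dt_sum (I : Type) (s : seq I) (f : I -> R -> X -> R) t x :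
  (forall i, smooth (f i)) ->
  dt (fun t y => \sum_(i <- s) f i t y) t x = \sum_(i <- s) dt (f i) t x.
Proof.
move=> sf; elim: s => [|i s IH].
  by rewrite big_nil /dt; under eq_fun do rewrite big_nil; rewrite derive1_cst.
rewrite big_cons -IH /dt; under eq_fun do rewrite big_cons.
rewrite !derive1E; apply: deriveD; first exact: smooth_derivable_dt.
exact: (smooth_derivable_dt t x (smooth_sum s sf)).
Qed.

Lemma smooth_pdM f g j t x : smooth f -> smooth g ->
  pd j (fun y => f t y * g t y) x = f t x * pd j (g t) x + g t x * pd j (f t) x.
Proof. by move=> sf sg; apply: pdM; exact: smooth_derivable_pd. Qed.

Lemma smooth_pdB f g j t x : smooth f -> smooth g ->
  pd j (fun y => f t y - g t y) x = pd j (f t) x - pd j (g t) x.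
Proof. by move=> sf sg; apply: pdB; exact: smooth_derivable_pd. Qed.

Lemma smooth_pdD f g j t x : smooth f -> smooth g ->
  pd j (fun y => f t y + g t y) x = pd j (f t) x + pd j (g t) x.
Proof. by move=> sf sg; apply: pdD; exact: smooth_derivable_pd. Qed.

Lemma smooth_dtM f g t x : smooth f -> smooth g ->
  dt (fun t y => f t y * g t y) t x = f t x * dt g t x + g t x * dt f t x.
Proof.
by move=> sf sg; rewrite /dt !derive1E; apply: deriveM; exact: smooth_derivable_dt.
Qed.

Lemma smoothv_grad f : smooth f -> smoothv (fun t => grad (f t)).
Proof.
move=> sf j; rewrite (_ : (fun _ _ => _) = fun t => pd j (f t)); first exact: smooth_pd.
by apply/funext => t; apply/funext => x; rewrite mxE.
Qed.

Lemma smoothv_dtv w : smoothv w -> smoothv (dtv w).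
Proof.
move=> sw j; rewrite (_ : (fun _ _ => _) = dt (fun t x => w t x 0 j)); first exact: smooth_dt.
by apply/funext => t; apply/funext => x; rewrite mxE.
Qed.

Lemma smooth_divv w : smoothv w -> smooth (fun t => divv (w t)).
Proof. by move=> sw; apply: smooth_sum => j; exact: (smooth_pd j (sw j)). Qed.

Lemma smooth_dotv v w : smoothv v -> smoothv w -> smooth (fun t x => dotv (v t x) (w t x)).
Proof. by move=> sv sw; apply: smooth_sum => j; apply: smoothM. Qed.

Lemma smooth_gradv w i j : smoothv w -> smooth (fun t x => gradv (w t) x i j).
Proof.
move=> sw; rewrite (_ : (fun _ _ => _) = fun t => pd j (fun y => w t y 0 i)).
  exact: (smooth_pd j (sw i)).
by apply/funext => t; apply/funext => x; rewrite mxE.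
Qed.

Lemma smooth_gradv_tr w i j : smoothv w -> smooth (fun t x => (gradv (w t) x)^T i j).
Proof.
move=> sw; rewrite (_ : (fun _ _ => _) = fun t x => gradv (w t) x j i).
  exact: smooth_gradv.
by apply/funext => t; apply/funext => x; rewrite mxE.
Qed.

Lemma smoothv_mulmx v (A : R -> X -> 'M[R]_d) : smoothv v ->
  (forall i j, smooth (fun t x => A t x i j)) -> smoothv (fun t x => v t x *m A t x).
Proof.
move=> sv sA j.
rewrite (_ : (fun _ _ => _) = fun t x => \sum_k v t x 0 k * A t x k j).
  by apply: smooth_sum => k; apply: smoothM.
by apply/funext => t; apply/funext => x; rewrite mxE.
Qed.

Lemma smoothvD v w : smoothv v -> smoothv w -> smoothv (fun t x => v t x + w t x).
Proof.
move=> sv sw j; rewrite (_ : (fun _ _ => _) = fun t x => v t x 0 j + w t x 0 j).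
  exact: smoothD.
by apply/funext => t; apply/funext => x; rewrite mxE.
Qed.

Lemma smoothvN v : smoothv v -> smoothv (fun t x => - v t x).
Proof.
move=> sv j; rewrite (_ : (fun _ _ => _) = fun t x => - v t x 0 j).
  exact: smoothN.
by apply/funext => t; apply/funext => x; rewrite mxE.
Qed.

Lemma smoothvB v w : smoothv v -> smoothv w -> smoothv (fun t x => v t x - w t x).
Proof. by move=> sv sw; apply: smoothvD => //; exact: smoothvN. Qed.

Lemma smoothv_laplv v : smoothv v -> smoothv (fun t : R => laplv (v t) : X -> 'rV[R]_d).
Proof.
move=> sv i.
rewrite (_ : (fun _ _ => _) = fun t x => \sum_j pd j (fun y => gradv (v t) y i j) x).
  by apply: smooth_sum => j; exact: (smooth_pd j (smooth_gradv i j sv)).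
by apply/funext => t; apply/funext => x; rewrite mxE.
Qed.

Lemma smoothv_advection (a b : R -> X -> 'rV[R]_d) : smoothv a -> smoothv b ->
  smoothv (fun t x => a t x *m (gradv (b t) x)^T).
Proof. by move=> sa sb; exact: (smoothv_mulmx sa (fun i j => smooth_gradv_tr i j sb)). Qed.

Lemma advectE (a : X) (w : X -> 'rV[R]_d) x : advect a w x = a *m (gradv w x)^T.
Proof. by apply/rowP => i; rewrite !mxE; apply: eq_bigr => j _; rewrite !mxE. Qed.

Lemma divvD v w t x : smoothv v -> smoothv w ->
  divv (fun y => v t y + w t y) x = divv (v t) x + divv (w t) x.
Proof.
move=> sv sw; rewrite /divv -big_split; apply: eq_bigr => j _ /=.
by under eq_fun do rewrite mxE; exact: (smooth_pdD _ _ _ (sv j) (sw j)).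
Qed.

Lemma divvB v w t x : smoothv v -> smoothv w ->
  divv (fun y => v t y - w t y) x = divv (v t) x - divv (w t) x.
Proof.
move=> sv sw; rewrite /divv -sumrB; apply: eq_bigr => j _ /=.
by under eq_fun do rewrite 2!mxE; exact: (smooth_pdB _ _ _ (sv j) (sw j)).
Qed.

Lemma divv_dtv w t x : smoothv w -> divv (dtv w t) x = dt (fun s => divv (w s)) t x.
Proof.
move=> sw; rewrite (smooth_dt_sum _ _ _ (fun j => smooth_pd j (sw j))).
apply: eq_bigr => j _; rewrite (dt_pd_comm _ _ _ (sw j)).
by under eq_fun do rewrite mxE.
Qed.

Lemma divm_gradv_tr w t x : smoothv w ->
  divm (fun y => (gradv (w t) y)^T) x = grad (divv (w t)) x.
Proof.
move=> sw; apply/rowP => i; rewrite !mxE.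
rewrite (smooth_pd_sum _ _ _ _ (fun j => smooth_pd j (sw j))).
apply: eq_bigr => j _; rewrite -(pd_pd_comm _ _ _ _ (sw j)).
by under eq_fun do rewrite !mxE.
Qed.

Lemma gradv_grad_sym f t x : smooth f -> (gradv (grad (f t)) x)^T = gradv (grad (f t)) x.
Proof.
move=> sf; apply/matrixP => i j; rewrite !mxE.
under eq_fun do rewrite mxE; under [in RHS]eq_fun do rewrite mxE.
exact: pd_pd_comm.
Qed.

(** By [divm_gradv_tr], a Hessian being symmetric. *)
Lemma divm_hess f t x : smooth f ->
  divm (gradv (grad (f t))) x = grad (divv (grad (f t))) x.
Proof.
move=> sf; rewrite -(divm_gradv_tr t x (smoothv_grad sf)).
by congr (divm _ x); apply/funext => y; rewrite gradv_grad_sym.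
Qed.

Lemma divm_scale (f : X -> R) (A : X -> 'M[R]_d) x :
  (forall j, derivable f x (delta_mx 0 j)) ->
  (forall i j, derivable (fun y => A y i j) x (delta_mx 0 j)) ->
  divm (fun y => f y *: A y) x = f x *: divm A x + grad f x *m (A x)^T.
Proof.
move=> df dA; apply/rowP => i; rewrite !mxE mulr_sumr -big_split; apply: eq_bigr => j _ /=.
under eq_fun do rewrite mxE.
by rewrite !mxE (pdM (df j) (dA i j)); ring.
Qed.

End DifferentialIdentities.

Section SecondOrderIdentities.
Context {R : realType} {d : nat}.
Local Notation X := 'rV[R]_d.
Implicit Types (f g r : R -> X -> R) (v w : R -> X -> 'rV[R]_d) (t : R) (x : X).

(** The divergence of [w.grad z - z.grad w] involves no product of first-order
  derivatives, because [grad w : (grad z)^T] is symmetric in [w] and [z]. *)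
Lemma divv_bracket v w t x : smoothv v -> smoothv w ->
  divv (fun y => w t y *m (gradv (v t) y)^T - v t y *m (gradv (w t) y)^T) x
  = dotv (w t x) (grad (divv (v t)) x) - dotv (v t x) (grad (divv (w t)) x).
Proof.
have adv (a b : R -> X -> 'rV[R]_d) : smoothv a -> smoothv b ->
    divv (fun y => a t y *m (gradv (b t) y)^T) x =
    dotv (a t x) (grad (divv (b t)) x) +
    \sum_i \sum_j pd j (fun y => b t y 0 i) x * pd i (fun y => a t y 0 j) x.
  move=> sa sb.
  have E i : pd i (fun y => (a t y *m (gradv (b t) y)^T) 0 i) x =
      \sum_j (a t x 0 j * pd i (pd j (fun y => b t y 0 i)) x
        + pd j (fun y => b t y 0 i) x * pd i (fun y => a t y 0 j) x).
    have -> : (fun y => (a t y *m (gradv (b t) y)^T) 0 i) =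
        (fun y => \sum_j a t y 0 j * pd j (fun z => b t z 0 i) y).
      by apply/funext => y; rewrite mxE; apply: eq_bigr => j _; rewrite !mxE.
    rewrite (@smooth_pd_sum _ _ _ _ (fun j s y => a s y 0 j * pd j (fun z => b s z 0 i) y)).
      by apply: eq_bigr => j _; rewrite (smooth_pdM _ _ _ (sa j) (smooth_pd j (sb i))).
    by move=> j; apply: smoothM => //; exact: (smooth_pd j (sb i)).
  rewrite /divv; under eq_bigr do rewrite E big_split.
  rewrite big_split/=; congr (_ + _); rewrite exchange_big /dotv; apply: eq_bigr => j _ /=.
  rewrite -mulr_sumr; congr (_ * _); rewrite mxE.
  rewrite (smooth_pd_sum _ _ _ _ (fun i => smooth_pd i (sb i))).
  by apply: eq_bigr => i _; rewrite (pd_pd_comm _ _ _ _ (sb i)).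
move=> sv sw.
rewrite (@divvB _ _ (fun t y => w t y *m (gradv (v t) y)^T) (fun t y => v t y *m (gradv (w t) y)^T)); last 2 first.
- by apply: smoothv_mulmx => // i j; exact: smooth_gradv_tr.
- by apply: smoothv_mulmx => // i j; exact: smooth_gradv_tr.
rewrite (adv w v)// (adv v w)//.
have gen (a b c e : R) : c = e -> a + c - (b + e) = a - b by move=> ->; ring.
by apply: gen; apply: sum_swap => i j; rewrite mulrC.
Qed.

(** Divergence and gradient commute, so the Laplacian of a field and the gradient
  of its divergence have the same divergence. *)
Lemma divv_laplv v t x : smoothv v ->
  divv (laplv (v t)) x = divv (grad (divv (v t))) x.
Proof.
move=> sv; rewrite /divv.
have s1 i j : smooth (fun s => pd j (fun z => v s z 0 i)) by exact: (smooth_pd j (sv i)).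
have s2 i j k : smooth (fun s => pd k (pd j (fun z => v s z 0 i))) by exact: (smooth_pd k (s1 i j)).
have E1 i : pd i (fun y => laplv (v t) y 0 i) x = \sum_j pd i (pd j (pd j (fun y => v t y 0 i))) x.
  have -> : (fun y => laplv (v t) y 0 i) = (fun y => \sum_j pd j (pd j (fun z => v t z 0 i)) y).
    apply/funext => y; rewrite mxE; apply: eq_bigr => j _.
    by congr (pd j _ y); apply/funext => z; rewrite mxE.
  by rewrite (@smooth_pd_sum _ _ _ _ (fun j s y => pd j (pd j (fun z => v s z 0 i)) y)).
have E2 i : pd i (fun y => grad (divv (v t)) y 0 i) x = \sum_j pd i (pd i (pd j (fun y => v t y 0 j))) x.
  have -> : (fun y => grad (divv (v t)) y 0 i) = (fun y => \sum_j pd i (pd j (fun z => v t z 0 j)) y).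
    apply/funext => y; rewrite mxE /divv.
    by rewrite (@smooth_pd_sum _ _ _ _ (fun j s y => pd j (fun z => v s z 0 j) y)).
  by rewrite (@smooth_pd_sum _ _ _ _ (fun j s y => pd i (pd j (fun z => v s z 0 j)) y)).
rewrite (eq_bigr _ (fun i _ => E1 i)) [RHS](eq_bigr _ (fun i _ => E2 i)).
apply: sum_swap => i j.
have H : pd i (pd j (fun z => v t z 0 i)) = pd j (pd i (fun z => v t z 0 i)).
  by apply/funext => y; exact: (@pd_pd_comm _ _ (fun s z => v s z 0 i) t i j y (sv i)).
by rewrite (@pd_pd_comm _ _ (fun s => pd j (fun z => v s z 0 i)) t i j x (s1 i j)) H.
Qed.

Lemma half_norm_dt w t x : smoothv w ->
  dt (fun s y => 2^-1 * dotv (w s y) (w s y)) t x = dotv (w t x) (dtv w t x).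
Proof.
move=> sw; rewrite (smooth_dtM _ _ (smooth_cst _) (smooth_dotv sw sw)).
rewrite {2}/dt derive1_cst mulr0 addr0.
rewrite (smooth_dt_sum _ _ _ (fun j => smoothM (sw j) (sw j))) mulr_sumr.
apply: eq_bigr => j _; rewrite (smooth_dtM _ _ (sw j) (sw j)) mxE.
by field.
Qed.

Lemma half_norm_grad w t x : smoothv w ->
  grad (fun y => 2^-1 * dotv (w t y) (w t y)) x = w t x *m gradv (w t) x.
Proof.
move=> sw; apply/rowP => i; rewrite !mxE.
rewrite (smooth_pdM _ _ _ (smooth_cst 2^-1) (smooth_dotv sw sw)) pd_cst mulr0 addr0.
rewrite (smooth_pd_sum _ _ _ _ (fun j => smoothM (sw j) (sw j))) mulr_sumr.
apply: eq_bigr => j _; rewrite (smooth_pdM _ _ _ (sw j) (sw j)) mxE.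
by field.
Qed.

End SecondOrderIdentities.

(** * The two equations at almost every time *)

Section WeightedIntegrability.
Context {R : realType} {d : nat}.
Local Notation X := 'rV[R]_d.
Implicit Types (rho a b : R -> X -> R) (w z c e : R -> X -> 'rV[R]_d) (T : R).

(** Densities such as [rho u_i u_j] are products of the square integrable fields
  [sqrt(rho) u_i]. *)
Lemma stL1_weighted T rho a b : (forall t x, 0 <= t <= T -> 0 <= rho t x) ->
  stL2 T (fun t x => Num.sqrt (rho t x) * a t x) ->
  stL2 T (fun t x => Num.sqrt (rho t x) * b t x) ->
  stL1 T (fun t x => rho t x * (a t x * b t x)).
Proof.
move=> r0 Ia Ib; apply: stL1_eq (stL2_mul Ia Ib) => t x tT.
by rewrite -[in RHS](sqr_sqrtr (r0 t x tT)); ring.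
Qed.

Lemma tL1_weighted (rho a b : X -> R) : (forall x, 0 <= rho x) ->
  tL2 (fun x => Num.sqrt (rho x) * a x) -> tL2 (fun x => Num.sqrt (rho x) * b x) ->
  tL1 (fun x => rho x * (a x * b x)).
Proof.
move=> r0 Ia Ib; have := tL2_mul Ia Ib.
rewrite (_ : (fun x => _ * _ * (_ * _)) = (fun x => rho x * (a x * b x)))//.
by apply/funext => x; rewrite -[in RHS](sqr_sqrtr (r0 x)); ring.
Qed.

Definition moment1 T rho w := forall i, stL1 T (fun t x => rho t x * w t x 0 i).
Definition moment2 T rho w z :=
  forall i j, stL1 T (fun t x => rho t x * (w t x 0 i * z t x 0 j)).

Definition jcontinuousv w := forall i, jcontinuous (fun t x => w t x 0 i).

Lemma smoothv_jcontinuous w : smoothv w -> jcontinuousv w.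
Proof. by move=> sw i; exact: (smooth_continuous (sw i)). Qed.

Lemma stL1_dotv T rho w c : moment1 T rho w -> jcontinuousv c ->
  stL1 T (fun t x => rho t x * dotv (w t x) (c t x)).
Proof.
move=> Iw cc; apply: stL1_eq (stL1_sum (index_enum _) (fun i => stL1M (Iw i) (cc i))) => t x _.
by rewrite /dotv mulr_sumr; apply: eq_bigr => i _; rewrite mulrA.
Qed.

Lemma stL1_dotv2 T rho w z : moment2 T rho w z ->
  stL1 T (fun t x => rho t x * dotv (w t x) (z t x)).
Proof.
move=> Iw; apply: stL1_eq (stL1_sum (index_enum _) (fun i => Iw i i)) => t x _.
by rewrite /dotv mulr_sumr; apply: eq_bigr => i _.
Qed.

Lemma stL1_ddot T rho w z (M : R -> X -> 'M[R]_d) : moment2 T rho w z ->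
  (forall i j, jcontinuous (fun t x => M t x i j)) ->
  stL1 T (fun t x => rho t x * ddot (tensor (w t x) (z t x)) (M t x)).
Proof.
move=> Iw cM.
apply: stL1_eq (stL1_sum (index_enum _) (fun i => stL1_sum (index_enum _) (fun j =>
  stL1M (Iw j i) (cM i j)))) => t x _.
rewrite /ddot mulr_sumr; apply: eq_bigr => i _; rewrite mulr_sumr; apply: eq_bigr => j _.
by rewrite mxE; ring.
Qed.

Lemma moment1B T rho w c : stL1 T rho -> moment1 T rho w -> jcontinuousv c ->
  moment1 T rho (fun t x => w t x - c t x).
Proof.
move=> Ir Iw cc i; apply: stL1_eq (stL1B (Iw i) (stL1M Ir (cc i))) => t x _.
by rewrite !mxE mulrBr.
Qed.

Lemma moment2B T rho w z c e : stL1 T rho -> moment1 T rho w -> moment1 T rho z ->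
  moment2 T rho w z -> jcontinuousv c -> jcontinuousv e ->
  moment2 T rho (fun t x => w t x - c t x) (fun t x => z t x - e t x).
Proof.
move=> Ir Iw Iz Iwz cc ce i j.
have I1 := stL1B (Iwz i j) (stL1M (Iw i) (ce j)).
have I2 := stL1B (stL1M (stL1M Ir (cc i)) (ce j)) (stL1M (Iz j) (cc i)).
by apply: stL1_eq (stL1D I1 I2) => t x _; rewrite !mxE; ring.
Qed.

End WeightedIntegrability.

Section WeakContinuity.
Context {R : realType} {d : nat}.
Local Notation X := 'rV[R]_d.
Local Notation lambda := (@lebesgue_measure R).
Variables (T : R) (rho0 : X -> R) (rho : R -> X -> R) (u : R -> X -> 'rV[R]_d).
Hypothesis T0 : 0 < T.
Hypothesis rho0_ge0 : forall x, 0 <= rho0 x.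
Hypothesis rho_ge0 : forall t x, 0 <= t <= T -> 0 <= rho t x.
Hypothesis Irho0 : tL1 rho0.
Hypothesis Irho : stL1 T rho.
Hypothesis Iu : moment1 T rho u.
Hypothesis hcont : weak_continuity T rho0 rho u.

(** [rho (d_t + u.grad) phi], the rate of change of the integral of [rho phi]. *)
Definition transport (phi : R -> X -> R) (s : R) (x : X) : R :=
  rho s x * dt phi s x + rho s x * dotv (u s x) (grad (phi s) x).

Lemma stL1_transport phi : jcontinuous (dt phi) ->
  (forall j, jcontinuous (fun t => pd j (phi t))) -> stL1 T (transport phi).
Proof.
move=> ct cx; apply: stL1D; first exact: stL1M.
apply: (stL1_dotv Iu) => j; rewrite (_ : (fun _ _ => _) = fun t => pd j (phi t))//.
by apply/funext => t; apply/funext => x; rewrite mxE.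
Qed.

Lemma smooth_stL1_transport phi : smooth phi -> stL1 T (transport phi).
Proof.
move=> sphi; apply: stL1_transport; first exact: (smooth_continuous (smooth_dt sphi)).
by move=> j; exact: (smooth_continuous (smooth_pd j sphi)).
Qed.

Lemma test_cutoff (phi : R -> X -> R) a n : a < T -> smooth phi ->
  test_function T (fun s x => cutoff a n s * phi s x).
Proof.
move=> aT sphi; split; first by apply: smoothM => //; exact: smooth_cutoff.
by exists a => // t x at_; have [-> _] := cutoff_ge n at_; rewrite mul0r.
Qed.

Lemma dt_cutoff (phi : R -> X -> R) a n s x : smooth phi ->
  dt (fun s x => cutoff a n s * phi s x) s x =
  cutoff' a n s * phi s x + cutoff a n s * dt phi s x.
Proof.
move=> sphi; rewrite (smooth_dtM _ _ (smooth_cutoff d a n) sphi).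
by rewrite {2}/dt derive1_cutoff; ring.
Qed.

Lemma pd_cutoff (phi : R -> X -> R) a n s x j : smooth phi ->
  pd j (fun x => cutoff a n s * phi s x) x = cutoff a n s * pd j (phi s) x.
Proof.
move=> sphi; rewrite (smooth_pdM _ _ _ (smooth_cutoff d a n) sphi).
by rewrite pd_cst mulr0 addr0.
Qed.

Lemma grad_cutoff (phi : R -> X -> R) a n s x : smooth phi ->
  grad (fun x => cutoff a n s * phi s x) x = cutoff a n s *: grad (phi s) x.
Proof. by move=> sphi; apply/rowP => j; rewrite !mxE pd_cutoff. Qed.

(** A smooth [phi] does not vanish near the final time and is not a test function;
  its products with the cutoffs in time are. *)
Lemma smooth_continuity phi : smooth phi ->
  {ae lambda, forall t, 0 <= t <= T ->
    torus_int (fun x => rho t x * phi t x) =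
    torus_int (fun x => rho0 x * phi 0 x) + st_int t (transport phi)}.
Proof.
move=> sphi.
apply: (@weak_time _ _ T (fun t x => rho t x * phi t x) (transport phi)
  (fun x => rho0 x * phi 0 x)) => //.
- by apply: stL1M => //; exact: smooth_continuous.
- exact: smooth_stL1_transport.
move=> a n /andP[_ aT].
have add0 (b c b' c' : R) : b = b' -> c = c' -> b' + c' = 0 -> b + c = 0 by move=> -> ->.
apply: (add0 _ _ _ _ _ _ (hcont (test_cutoff n aT sphi))).
  apply: st_int_eq => s x _; rewrite dt_cutoff// grad_cutoff// dotvZr /transport; ring.
rewrite mulrC -torus_intZ.
  by apply: torus_int_eq => x; ring.
by apply: tL1M => //; exact: (@jcontinuous_slice _ _ phi 0 (smooth_continuous sphi)).
Qed.

(** [h(r)] need not be smooth, but [h'] is a uniform limit of polynomials on the range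
  of [r], and smooth test functions pass to the limit. *)
Lemma C1_continuity (h h' : R -> R) (r : R -> X -> R) : smooth r ->
  (forall t x, 0 < r t x) ->
  (forall s : R, 0 < s -> is_derive s 1 h (h' s)) ->
  (forall s : R, 0 < s -> {for s, continuous h'}) ->
  (forall m M : R, 0 < m -> exists L, forall x y, m <= x <= M -> m <= y <= M ->
     `|h' x - h' y| <= L * `|x - y|) ->
  {ae lambda, forall t, 0 <= t <= T ->
    torus_int (fun x => rho t x * h (r t x)) =
    torus_int (fun x => rho0 x * h (r 0 x)) + st_int t (transport (fun t x => h (r t x)))}.
Proof.
move=> sr r0 dh ch' lh'.
have [M M0 HM] := smooth_bounded T sr.
have [K K0 HK] := smooth_bounded T (smoothV r0 sr).
pose m := (K + 1)^-1.
have m0 : 0 < m by rewrite invr_gt0 ltr_wpDl.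
pose M' := m + M + 1.
have mM' : m < M' by rewrite /M' -addrA ltrDl ltr_wpDl.
have rm t x : 0 <= t <= T -> m <= r t x <= M'.
  move=> tT; apply/andP; split.
    rewrite /m -[leRHS]invrK lef_pV2 ?posrE ?invr_gt0 ?ltr_wpDl//.
    by apply: le_trans (ler_norm _) _; apply: le_trans (HK t x tT) _; rewrite lerDl.
  have h1 := ler_norm (r t x); have h2 := HM t x tT.
  by rewrite /M'; lra.
have [L HL] := lh' m M' m0.
have dhm x : m <= x <= M' -> is_derive x 1 h (h' x).
  by move=> /andP[mx _]; apply: dh; exact: lt_le_trans mx.
have exQ n : exists Q : {poly R}, forall x, m <= x <= M' ->
    `|h x - Q.[x]| <= n.+1%:R^-1 /\ `|h' x - Q^`().[x]| <= n.+1%:R^-1.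
  by apply: (C1_poly_approx mM' _ dhm HL); rewrite invr_gt0.
have [Q HQ] := choice exQ.
pose hr t x := h (r t x); pose qr n t x := (Q n).[r t x].
have chr : jcontinuous hr := comp_jcontinuous sr r0 dh.
have dthr := comp_dt sr r0 dh; have pdhr := comp_pd sr r0 dh.
have sqr n : smooth (qr n) by exact: smooth_horner.
have dtqr n t x : dt (qr n) t x = (Q n)^`().[r t x] * dt r t x.
  have [_ ->] := dt_comp (smooth_derivable_dt t x sr) (@derivable_horner _ (Q n) (r t x)).
  by rewrite -derivE.
have pdqr n t x j : pd j (qr n t) x = (Q n)^`().[r t x] * pd j (r t) x.
  have [_ ->] := pd_comp (smooth_derivable_pd t x j sr) (@derivable_horner _ (Q n) (r t x)).
  by rewrite -derivE.
have gradE (k : R) (f : X -> R) t x : (forall j, pd j f x = k * pd j (r t) x) ->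
    grad f x = k *: grad (r t) x.
  by move=> H; apply/rowP => j; rewrite !mxE.
have Ith : stL1 T (transport hr).
  apply: stL1_transport; first exact: (comp_jcontinuous_dt sr r0 dh ch').
  by move=> j; exact: (comp_jcontinuous_pd sr r0 dh ch').
pose W := transport r.
have IW : stL1 T W by exact: smooth_stL1_transport.
have IW' : stL1 T (fun s x => `|W s x|) by exact: (integrable_norm IW).
have Itq n : stL1 T (transport (qr n)) by exact: smooth_stL1_transport.
have diffE n s x : transport hr s x - transport (qr n) s x =
    (h' (r s x) - (Q n)^`().[r s x]) * W s x.
  rewrite /W /transport dthr dtqr.
  rewrite (gradE _ _ _ _ (pdhr s x)) (gradE _ _ _ _ (pdqr n s x)) !dotvZr; ring.
have H1 := ae_foralln (fun n => smooth_continuity (sqr n)).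
apply: ae_imp2 H1 (stL1_slice Irho) => t Hn It tT.
have {}It := It tT; have /andP[t0 tT'] := tT.
have TT0 : (0 : R) <= 0 <= T by apply/andP; split => //; exact: ltW.
pose D := torus_int (fun x => rho t x * hr t x) - torus_int (fun x => rho0 x * hr 0 x)
  - st_int t (transport hr).
pose C := torus_int (rho t) + torus_int rho0 + st_int t (fun s x => `|W s x|).
have C0 : 0 <= C.
  apply: addr_ge0; first apply: addr_ge0.
  - by apply: torus_int_ge0 => x; exact: rho_ge0.
  - exact: torus_int_ge0.
  - by apply: Rintegral_ge0 => s _; exact: torus_int_ge0.
have torus_bound (a b c : X -> R) (e : R) : tL1 a -> continuous b -> continuous c ->
    (forall x, 0 <= a x) -> (forall x, `|b x - c x| <= e) ->
    `|torus_int (fun x => a x * b x) - torus_int (fun x => a x * c x)| <= e * torus_int a.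
  move=> Ia cb cc a0 bc; have Iab := tL1M Ia cb; have Iac := tL1M Ia cc.
  rewrite -torus_intB// -torus_intZ// ler_norml -torus_intN; last exact: tL1Z.
  have B x : - (e * a x) <= a x * b x - a x * c x <= e * a x.
    by rewrite -ler_norml -mulrBr normrM (ger0_norm (a0 x)) mulrC ler_wpM2r.
  apply/andP; split; apply: torus_int_le.
  - by apply: tL1N; exact: tL1Z.
  - exact: tL1B.
  - by move=> x; have /andP[] := B x.
  - exact: tL1B.
  - exact: tL1Z.
  - by move=> x; have /andP[] := B x.
have st_bound n : `|st_int t (transport hr) - st_int t (transport (qr n))|
    <= n.+1%:R^-1 * st_int t (fun s x => `|W s x|).
  rewrite -(st_intB tT' Ith (Itq n)) -(st_intZ _ tT' IW') ler_norml.
  rewrite -(st_intN tT' (stL1Z _ IW')).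
  have I1 := stL1B Ith (Itq n); have I2 := stL1Z n.+1%:R^-1 IW'.
  have B s x : 0 <= s <= T -> - (n.+1%:R^-1 * `|W s x|) <= transport hr s x - transport (qr n) s x
     <= n.+1%:R^-1 * `|W s x|.
    move=> sT; rewrite -ler_norml diffE normrM ler_wpM2r//.
    by have [] := HQ n _ (rm s x sT).
  apply/andP; split; apply: (st_int_le tT') => //.
  - exact: stL1N.
  - apply: ae_imp2 (stL1_slice I1) (stL1_slice (stL1N I2)) => s J1 J2 sT.
    by apply: torus_int_le; [exact: J2|exact: J1|move=> x; have /andP[] := B s x sT].
  - apply: ae_imp2 (stL1_slice I1) (stL1_slice I2) => s J1 J2 sT.
    by apply: torus_int_le; [exact: J1|exact: J2|move=> x; have /andP[] := B s x sT].
have cq n s : continuous (qr n s) by exact: (@jcontinuous_slice _ _ (qr n) s (smooth_continuous (sqr n))).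
have chs s : continuous (hr s) by exact: (@jcontinuous_slice _ _ hr s chr).
have HD n : `|D| <= n.+1%:R^-1 * C.
  have b1 : `|torus_int (fun x => rho t x * hr t x) - torus_int (fun x => rho t x * qr n t x)|
      <= n.+1%:R^-1 * torus_int (rho t).
    apply: torus_bound => // x; first exact: rho_ge0.
    by have [] := HQ n _ (rm t x tT).
  have b2 : `|torus_int (fun x => rho0 x * hr 0 x) - torus_int (fun x => rho0 x * qr n 0 x)|
      <= n.+1%:R^-1 * torus_int rho0.
    by apply: torus_bound => // x; have [] := HQ n _ (rm 0 x TT0).
  have b3 := st_bound n; have En := Hn n tT.
  rewrite /C !mulrDr.
  apply: le_trans (lerD (lerD b1 b2) b3).
  rewrite /D En.
  set a := torus_int _; set b := torus_int _; set c := st_int _ _; set b' := torus_int _; set c' := st_int _ _.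
  have -> : a - b - c = (a - (b' + c')) - (b - b') - (c - c') by ring.
  by apply: le_trans (ler_normB _ _) _; rewrite lerD2r; exact: ler_normB.
apply/eqP; rewrite -subr_eq0 opprD addrA -/D -normr_eq0; apply/eqP/le_anti.
rewrite normr_ge0 andbT leNgt; apply/negP => D0.
have C1 : 0 < C + 1 by rewrite ltr_wpDl.
have e0 : 0 < `|D| / (C + 1) by rewrite divr_gt0.
have [n] := ltr_add_invr e0; rewrite add0r ltr_pdivlMr// => Hlt.
have := lt_le_trans Hlt (HD n); rewrite ltr_pM2l ?invr_gt0//.
by rewrite ltNge lerDl ler01.
Qed.

End WeakContinuity.

Section WeakMomentum.
Context {R : realType} {d : nat}.
Local Notation X := 'rV[R]_d.
Local Notation lambda := (@lebesgue_measure R).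
Variables (T kappa : R) (S : 'M[R]_d -> 'M[R]_d) (p : R -> R).
Variables (rho0 : X -> R) (u0 : X -> 'rV[R]_d).
Variables (rho : R -> X -> R) (u L : R -> X -> 'rV[R]_d) (G : R -> X -> 'M[R]_d).
Hypothesis T0 : 0 < T.
Hypothesis Iu0 : forall i, tL1 (fun x => rho0 x * u0 x 0 i).
Hypothesis Iu : moment1 T rho u.
Hypothesis IL : moment1 T rho L.
Hypothesis Iuu : moment2 T rho u u.
Hypothesis ILL : moment2 T rho L L.
Hypothesis Ip : stL1 T (fun t x => p (rho t x)).
Hypothesis IS : forall i j, stL1 T (fun t x => rho t x * S (sympart (G t x)) i j).
Hypothesis hmom : weak_momentum T kappa S p rho0 u0 rho u L G.

(** The rate of change of the integral of [rho u . v] according to the momentum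
  equation. *)
Definition momentum_rate (v : R -> X -> 'rV[R]_d) (s : R) (x : X) : R :=
  rho s x * dotv (u s x) (dtv v s x)
  + rho s x * ddot (tensor (u s x) (u s x)) (gradv (v s) x)
  - rho s x * ddot (S (sympart (G s x))) (gradv (v s) x)
  + p (rho s x) * divv (v s) x
  + kappa * (rho s x * dotv (L s x) (laplv (v s) x)
    + rho s x * ddot (tensor (L s x) (L s x)) (gradv (v s) x)).

Lemma stL1_momentum_rate v : smoothv v -> stL1 T (momentum_rate v).
Proof.
move=> sv; have cD i j := smooth_continuous (smooth_gradv i j sv).
apply: stL1D; first apply: stL1D; first apply: stL1B; first apply: stL1D.
- exact: (stL1_dotv Iu (smoothv_jcontinuous (smoothv_dtv sv))).
- exact: stL1_ddot.
- apply: stL1_eq (stL1_sum (index_enum _) (fun i => stL1_sum (index_enum _) (fun j =>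
    stL1M (IS i j) (cD i j)))) => t x _.
  rewrite /ddot mulr_sumr; apply: eq_bigr => i _; rewrite mulr_sumr; apply: eq_bigr => j _.
  by rewrite mulrA.
- by apply: stL1M => //; exact: (smooth_continuous (smooth_divv sv)).
- apply: stL1Z; apply: stL1D; last exact: stL1_ddot.
  exact: (stL1_dotv IL (smoothv_jcontinuous (smoothv_laplv sv))).
Qed.

Lemma momentum_identity v : smoothv v ->
  {ae lambda, forall t, 0 <= t <= T ->
    torus_int (fun x => rho t x * dotv (u t x) (v t x)) =
    torus_int (fun x => rho0 x * dotv (u0 x) (v 0 x)) + st_int t (momentum_rate v)}.
Proof.
move=> sv.
apply: (@weak_time _ _ T (fun t x => rho t x * dotv (u t x) (v t x)) (momentum_rate v)
  (fun x => rho0 x * dotv (u0 x) (v 0 x))) => //.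
- exact: (stL1_dotv Iu (smoothv_jcontinuous sv)).
- exact: stL1_momentum_rate.
move=> a n /andP[_ aT].
pose phi s x : 'rV[R]_d := cutoff a n s *: v s x.
have phiE i : (fun s x => phi s x 0 i) = (fun s x => cutoff a n s * v s x 0 i).
  by apply/funext => s; apply/funext => x; rewrite mxE.
have tphi i : test_function T (fun s x => phi s x 0 i).
  by rewrite phiE; exact: test_cutoff.
have add0 (b c b' c' : R) : b = b' -> c = c' -> b' + c' = 0 -> b + c = 0 by move=> -> ->.
apply: (add0 _ _ _ _ _ _ (hmom tphi)); last first.
  rewrite mulrC -torus_intZ.
    by apply: torus_int_eq => x; rewrite /phi dotvZr; ring.
  have Is := tL1_sum (index_enum 'I_d) (fun i => tL1M (Iu0 i)
    (@jcontinuous_slice _ _ (fun s x => v s x 0 i) 0 (smooth_continuous (sv i)))).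
  rewrite (_ : (fun x => rho0 x * _) = (fun x => \sum_i rho0 x * u0 x 0 i * v 0 x 0 i))//.
  by apply/funext => x; rewrite /dotv mulr_sumr; apply: eq_bigr => i _; rewrite mulrA.
apply: st_int_eq => s x _.
have Ed : dtv phi s x = cutoff' a n s *: v s x + cutoff a n s *: dtv v s x.
  by apply/rowP => i; rewrite !mxE phiE dt_cutoff.
have Eg y : gradv (phi s) y = cutoff a n s *: gradv (v s) y.
  apply/matrixP => i j; rewrite !mxE.
  rewrite (_ : (fun z => phi s z 0 i) = (fun z => cutoff a n s * v s z 0 i)).
    exact: (@pd_cutoff _ _ (fun s z => v s z 0 i)).
  by apply/funext => z; rewrite mxE.
have Ev : divv (phi s) x = cutoff a n s * divv (v s) x.
  rewrite /divv mulr_sumr; apply: eq_bigr => j _.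
  by have := congr1 (fun A : 'M[R]_d => A j j) (Eg x); rewrite !mxE.
have El : laplv (phi s) x = cutoff a n s *: laplv (v s) x.
  apply/rowP => i; rewrite !mxE mulr_sumr; apply: eq_bigr => j _.
  rewrite (_ : (fun y => gradv (phi s) y i j) = (fun y => cutoff a n s * gradv (v s) y i j)).
    exact: (@pd_cutoff _ _ (fun s y => gradv (v s) y i j) a n s x j (smooth_gradv i j sv)).
  by apply/funext => y; rewrite Eg mxE.
rewrite Ed Eg Ev El /momentum_rate !dotvE !ddotZr; ring.
Qed.

End WeakMomentum.

(** * Integrals that vanish *)

Section LogGradient.
Context {R : realType} {d : nat}.
Local Notation X := 'rV[R]_d.

Lemma tL1_dotv (rho : X -> R) (w c : X -> 'rV[R]_d) :
  (forall i, tL1 (fun x => rho x * w x 0 i)) -> (forall i, continuous (fun x => c x 0 i)) ->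
  tL1 (fun x => rho x * dotv (w x) (c x)).
Proof.
move=> Iw cc; have Is := tL1_sum (index_enum 'I_d) (fun i => tL1M (Iw i) (cc i)).
rewrite (_ : (fun x => rho x * _) = (fun x => \sum_i rho x * w x 0 i * c x 0 i))//.
by apply/funext => x; rewrite /dotv mulr_sumr; apply: eq_bigr => i _; rewrite mulrA.
Qed.

(** [rho L] is the weak gradient of [rho]; tested with each [w_j] in the direction
  [j] and summed, this says that [div (rho w)] has zero integral. *)
Lemma log_grad_ibp (rho : X -> R) (L w : X -> 'rV[R]_d) : log_grad rho L ->
  (forall j x, differentiable (fun y => w y 0 j) x) -> (forall j, tperiodic (fun y => w y 0 j)) ->
  (forall j, continuous (pd j (fun y => w y 0 j))) ->
  [/\ tL1 (fun x => rho x * dotv (L x) (w x)), tL1 (fun x => rho x * divv w x) &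
    torus_int (fun x => rho x * dotv (L x) (w x)) = - torus_int (fun x => rho x * divv w x)].
Proof.
move=> [Ir IL ibp] dw pw cdw.
have cw j : continuous (fun y => w y 0 j) by move=> x; exact: differentiable_continuous.
have ILw j : tL1 (fun x => (rho x *: L x) 0 j * w x 0 j) by exact: tL1M.
have Ird j : tL1 (fun x => rho x * pd j (fun y => w y 0 j) x) by exact: tL1M.
have E1 : (fun x => rho x * dotv (L x) (w x)) = (fun x => \sum_j (rho x *: L x) 0 j * w x 0 j).
  apply/funext => x; rewrite /dotv mulr_sumr; apply: eq_bigr => j _.
  by rewrite mxE mulrA.
have E2 : (fun x => rho x * divv w x) = (fun x => \sum_j rho x * pd j (fun y => w y 0 j) x).
  by apply/funext => x; rewrite /divv mulr_sumr.
rewrite E1 E2; split; [exact: tL1_sum|exact: tL1_sum|].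
rewrite !torus_int_sum// -sumrN; apply: eq_bigr => j _.
by rewrite (ibp _ j (dw j) (pw j) (Ird j) (ILw j)) opprK.
Qed.

End LogGradient.

Section StressField.
Context {R : realType} {d : nat}.
Local Notation X := 'rV[R]_d.
Local Notation lambda := (@lebesgue_measure R).
Variables (S : 'M[R]_d -> 'M[R]_d).
Hypothesis dS : forall A : 'M[R]_d, differentiable (S \o sympart) A.

(** A matrix field is the sum of its entries times elementary matrices. *)
Lemma differentiable_mx (B : X -> 'M[R]_d) x :
  (forall i j, differentiable (fun y => B y i j) x) -> differentiable B x.
Proof.
move=> dB.
rewrite (_ : B = \sum_i \sum_j (fun y => B y i j *: delta_mx i j)).
  by apply: differentiable_sum => i; apply: differentiable_sum => j; exact: differentiableZl.
apply/funext => y; rewrite {1}[B y]matrix_sum_delta fct_sumE; apply: eq_bigr => i _.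
by rewrite fct_sumE.
Qed.

Lemma stress_differentiable (w : X -> 'rV[R]_d) i j x :
  (forall k l y, differentiable (fun z => gradv w z k l) y) ->
  differentiable (fun y => S (symgrad w y) i j) x.
Proof.
move=> dw.
have d1 : differentiable (S \o sympart \o gradv w) x.
  by apply: differentiable_comp; [apply: differentiable_mx => k l; exact: dw|exact: dS].
exact: (differentiable_comp d1 (differentiable_coord _ i j)).
Qed.

Lemma tperiodic_stress (w : X -> 'rV[R]_d) i j : (forall k, tperiodic (fun y => w y 0 k)) ->
  tperiodic (fun y => S (symgrad w y) i j).
Proof.
move=> pw y k; rewrite /symgrad; congr (S (sympart _) i j).
by apply/matrixP => a b; rewrite !mxE; exact: tperiodic_pd.
Qed.

Lemma stress_jcontinuous (v : R -> X -> 'rV[R]_d) i j : smoothv v ->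
  jcontinuous (fun t x => S (symgrad (v t) x) i j).
Proof.
move=> sv z.
have c1 : continuous (fun z : R * X => gradv (v z.1) z.2).
  rewrite (_ : (fun _ => _) = (fun z : R * X =>
    \sum_k \sum_l gradv (v z.1) z.2 k l *: (delta_mx k l : 'M[R]_d))).
    apply: continuous_sum => k; apply: continuous_sum => l y.
    have c0 : continuous (fun z : R * X => gradv (v z.1) z.2 k l).
      exact: (smooth_continuous (smooth_gradv k l sv)).
    exact: (cvgZr_tmp (c0 y)).
  by apply/funext => y; exact: matrix_sum_delta.
have c2 := continuous_comp (c1 z) (differentiable_continuous (dS (gradv (v z.1) z.2))).
exact: (@continuous_comp _ _ _ (fun z : R * X => S (symgrad (v z.1) z.2))
  (fun M : 'M[R]_d => M i j) z c2 (@coord_continuous _ _ _ i j _)).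
Qed.

End StressField.

Section StressNull.
Context {R : realType} {d : nat}.
Local Notation X := 'rV[R]_d.

Lemma tL1_torus_int0_sum (f : 'I_d -> 'I_d -> X -> R) :
  (forall i j, tL1 (f i j)) -> (forall i j, torus_int (f i j) = 0) ->
  tL1 (fun x => \sum_i \sum_j f i j x) /\ torus_int (fun x => \sum_i \sum_j f i j x) = 0.
Proof.
move=> If f0; have Is i : tL1 (fun x => \sum_j f i j x) by exact: tL1_sum.
split; first exact: tL1_sum.
rewrite torus_int_sum// big1// => i _.
by rewrite torus_int_sum// big1.
Qed.

(** The integrand is [div (rho A^T (u - v))]: the identity defining [G] is tested with
  the entries of [A], the one defining [L] with their products with the [v_i]. *)
Lemma stress_null (rho : X -> R) (L u v : X -> 'rV[R]_d) (G A : X -> 'M[R]_d) :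
  log_grad rho L -> velocity_grad rho L u G ->
  (forall i j x, differentiable (fun y => A y i j) x) ->
  (forall i j, tperiodic (fun y => A y i j)) ->
  (forall i x, differentiable (fun y => v y 0 i) x) ->
  (forall i, tperiodic (fun y => v y 0 i)) ->
  (forall i j, continuous (pd j (fun y => v y 0 i))) ->
  (forall i j, tL1 (fun x => rho x * pd j (fun y => A y i j) x)) ->
  (forall i j, tL1 (fun x => rho x * u x 0 i * pd j (fun y => A y i j) x)) ->
  let E x := rho x * dotv (u x - v x) (divm A x) + rho x * ddot (G x - gradv v x) (A x)
    + rho x * dotv (u x - v x) (L x *m (A x)^T) in
  tL1 E /\ torus_int E = 0.
Proof.
move=> [Ir IL ibp] hG dA pA dv pv cdv IdA IudA E.
have cA i j : continuous (fun y => A y i j) by move=> x; exact: differentiable_continuous.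
have cv i : continuous (fun y => v y 0 i) by move=> x; exact: differentiable_continuous.
pose a i j x := rho x * u x 0 i * pd j (fun y => A y i j) x.
pose b i j x := (rho x *: (row i (G x) + u x 0 i *: L x)) 0 j * A x i j.
pose psi i j x := v x 0 i * A x i j.
pose e i j x := rho x * pd j (psi i j) x.
pose f i j x := (rho x *: L x) 0 j * psi i j x.
have pdpsi i j x : pd j (psi i j) x = v x 0 i * pd j (fun y => A y i j) x + A x i j * pd j (fun y => v y 0 i) x.
  by apply: pdM; exact: diff_derivable.
have Ib i j : tL1 (b i j) by apply: tL1M (cA i j); have [_ IG _] := hG i; exact: IG.
have If i j : tL1 (f i j).
  by apply: tL1M => //; move=> x; exact: (cvgM (cv i x) (cA i j x)).
have Ie i j : tL1 (e i j).
  rewrite (_ : e i j = fun x => rho x * pd j (fun y => A y i j) x * v x 0 i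
    + rho x * A x i j * pd j (fun y => v y 0 i) x).
    by apply: tL1D; apply: tL1M => //; exact: tL1M.
  by apply/funext => x; rewrite /e pdpsi; ring.
have ab i j : torus_int (a i j) = - torus_int (b i j).
  by have [_ _ ibpG] := hG i; exact: (ibpG _ j (dA i j) (pA i j) (IudA i j) (Ib i j)).
have ef i j : torus_int (e i j) = - torus_int (f i j).
  have dpsi x : differentiable (psi i j) x by exact: (differentiableM (dv i x) (dA i j x)).
  have ppsi : tperiodic (psi i j) by move=> x k; rewrite /psi pv pA.
  exact: (ibp _ j dpsi ppsi (Ie i j) (If i j)).
pose N i j x := a i j x + b i j x - (e i j x + f i j x).
have IN i j : tL1 (N i j) by exact: tL1B (tL1D (IudA i j) (Ib i j)) (tL1D (Ie i j) (If i j)).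
have N0 i j : torus_int (N i j) = 0.
  rewrite (torus_intB (tL1D (IudA i j) (Ib i j)) (tL1D (Ie i j) (If i j))).
  rewrite (torus_intD (IudA i j) (Ib i j)) (torus_intD (Ie i j) (If i j)) ab ef; ring.
have := tL1_torus_int0_sum IN N0.
rewrite (_ : (fun x => \sum_i \sum_j N i j x) = E)//.
apply/funext => x; rewrite /E /dotv /ddot !mulr_sumr -!big_split; apply: eq_bigr => i _ /=.
rewrite !mxE !mulr_sumr -!big_split; apply: eq_bigr => j _ /=.
by rewrite /N /a /b /e /f pdpsi /psi !mxE; ring.
Qed.

End StressNull.

Section Density.
Context {R : realType} {d : nat}.
Local Notation X := 'rV[R]_d.

Lemma torus_int_divv (w : X -> 'rV[R]_d) :
  (forall j x, derivable (fun y => w y 0 j) x (delta_mx 0 j)) ->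
  (forall j, continuous (pd j (fun y => w y 0 j))) ->
  (forall j, tperiodic (fun y => w y 0 j)) ->
  tL1 (divv w) /\ torus_int (divv w) = 0.
Proof.
move=> dw cw pw; have I j := tL1_continuous (cw j).
split; first exact: (tL1_sum (index_enum 'I_d) I).
rewrite (torus_int_sum (index_enum 'I_d) I) big1// => j _.
exact: (torus_int_pd (dw j) (cw j) (pw j)).
Qed.

Variables (r : R -> X -> R) (v : R -> X -> 'rV[R]_d) (p : R -> R) (rbar : R).
Hypothesis sr : smooth r.
Hypothesis r0 : forall t x, 0 < r t x.
Hypothesis sv : smoothv v.
Hypothesis hp : pressure_law p.
Hypothesis rbar0 : 0 < rbar.
Let l t := grad_ln (r t).
Let h := derive1 (Hpot p rbar).

Lemma smoothv_grad_ln : smoothv (fun t => grad_ln (r t)).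
Proof. exact: (smoothv_grad (smooth_ln r0 sr)). Qed.

Lemma grad_lnE t x : grad (r t) x = r t x *: grad_ln (r t) x.
Proof.
apply/rowP => j; rewrite !mxE.
have [_ ->] := pd_comp (smooth_derivable_pd t x j sr) (derivable_ln (r0 t x)).
by rewrite derive1_ln// mulVKf// gt_eqF.
Qed.

(** Since [grad r = r grad (ln r)], the division by [r] leaves no singular factor. *)
Lemma divm_weighted (A : X -> 'M[R]_d) t x :
  (forall i j, derivable (fun y => A y i j) x (delta_mx 0 j)) ->
  (r t x)^-1 *: divm (fun y => r t y *: A y) x = divm A x + grad_ln (r t) x *m (A x)^T.
Proof.
move=> dA; rewrite divm_scale//; last by move=> j; exact: smooth_derivable_pd.
have rn0 : r t x != 0 by rewrite gt_eqF.
by rewrite grad_lnE -scalemxAl -scalerDr scalerA mulVf// scale1r.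
Qed.

Let dp (s : R) : 0 < s -> is_derive s 1 p (derive1 p s).
Proof. by move=> s0; apply: DeriveDef; [exact: pressure_derivable|rewrite derive1E]. Qed.

Let cp' (s : R) : 0 < s -> {for s, continuous (derive1 p)}.
Proof. exact: pressure'_continuous. Qed.

Let dh (s : R) : 0 < s -> is_derive s 1 h (derive1 p s / s).
Proof. exact: is_derive_Hpot'. Qed.

(** The thermodynamic identity [dp = r dh], [h] being the derivative of [H]. *)
Lemma grad_pressure t x :
  grad (fun y => p (r t y)) x = r t x *: grad (fun y => h (r t y)) x.
Proof.
rewrite (comp_grad sr r0 dp) (comp_grad sr r0 dh) scalerA mulrCA divff ?mulr1//.
by rewrite gt_eqF.
Qed.

Lemma dt_pressure t x :
  dt (fun s y => p (r s y)) t x = r t x * dt (fun s y => h (r s y)) t x.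
Proof.
rewrite (comp_dt sr r0 dp) (comp_dt sr r0 dh) !mulrA; congr (_ * _).
by rewrite mulrAC divff ?mul1r// gt_eqF.
Qed.

Lemma Hpot''_continuous (s : R) : 0 < s -> {for s, continuous (fun s => derive1 p s / s)}.
Proof.
move=> s0; apply: cvgM; first exact: pressure'_continuous.
by apply: cvgV; [rewrite gt_eqF|exact: cvg_id].
Qed.

(** The integrand is [div (p(r) v)], by [grad_pressure]. *)
Lemma pressure_flux t :
  let f x := r t x * dotv (v t x) (grad (fun y => h (r t y)) x) + p (r t x) * divv (v t) x in
  tL1 f /\ torus_int f = 0.
Proof.
move=> f; pose w x : 'rV[R]_d := p (r t x) *: v t x.
have wE j : (fun y => w y 0 j) = (fun y => p (r t y) * v t y 0 j).
  by apply/funext => y; rewrite mxE.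
have dv j x := smooth_derivable_pd t x j (sv j).
have dpr j x : derivable (fun y => p (r t y)) x (delta_mx 0 j).
  exact: (comp_derivable_pd sr r0 dp).
have pdE j x : pd j (fun y => w y 0 j) x =
    p (r t x) * pd j (fun y => v t y 0 j) x + v t x 0 j * pd j (fun y => p (r t y)) x.
  by rewrite wE (pdM (dpr j x) (dv j x)).
have cp : continuous (fun x => p (r t x)).
  exact: (@jcontinuous_slice _ _ (fun t x => p (r t x)) t (comp_jcontinuous sr r0 dp)).
have cdp j : continuous (pd j (fun x => p (r t x))).
  have cj : jcontinuous (fun t => pd j (fun x => p (r t x))).
    by move=> z; exact: (comp_jcontinuous_pd sr r0 dp cp').
  exact: (@jcontinuous_slice _ _ (fun t => pd j (fun x => p (r t x))) t cj).
have cv j : continuous (fun x => v t x 0 j).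
  exact: (@jcontinuous_slice _ _ (fun t x => v t x 0 j) t (smooth_continuous (sv j))).
have cdv j : continuous (pd j (fun x => v t x 0 j)).
  exact: (@jcontinuous_slice _ _ (fun t => pd j (fun x => v t x 0 j)) t
    (smooth_continuous (smooth_pd j (sv j)))).
have := @torus_int_divv w.
rewrite (_ : divv w = f).
  apply.
  - by move=> j x; rewrite wE; exact: derivableM.
  - move=> j; rewrite (_ : pd j _ = fun x => p (r t x) * pd j (fun y => v t y 0 j) x +
      v t x 0 j * pd j (fun y => p (r t y)) x); last by apply/funext => x; exact: pdE.
    by move=> x; exact: (cvgD (cvgM (cp x) (cdv j x)) (cvgM (cv j x) (cdp j x))).
  - by move=> j x k; rewrite /w !mxE (sr.2 t) (sv j).2.
apply/funext => x; rewrite /f -dotvZr -grad_pressure /dotv mulr_sumr -big_split.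
by apply: eq_bigr => j _; rewrite pdE mxE addrC.
Qed.

(** The field [xi] for which [kappa div (rho xi)] accounts for all the capillary terms
  by which the remainder and the rate of change of the relative energy differ. *)
Definition capillary_field t x : 'rV[R]_d :=
  grad_ln (r t) x *m (gradv (v t) x)^T - v t x *m (gradv (grad_ln (r t)) x)^T
  - grad (divv (v t)) x + laplv (v t) x - dtv (fun s => grad_ln (r s)) t x.

Lemma smoothv_capillary_field : smoothv capillary_field.
Proof.
have sl := smoothv_grad_ln.
have s1 := smoothvB (smoothv_advection sl sv) (smoothv_advection sv sl).
have s2 := smoothvB s1 (smoothv_grad (smooth_divv sv)).
exact: (smoothvB (smoothvD s2 (smoothv_laplv sv)) (smoothv_dtv sl)).
Qed.

(** [divv_bracket] takes care of the two advection terms, and the divergences of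
  [laplv v] and [grad (div v)] cancel by [divv_laplv]. *)
Lemma divv_capillary_field t x : divv (capillary_field t) x =
  dotv (grad_ln (r t) x) (grad (divv (v t)) x) - dotv (v t x) (grad (divv (grad_ln (r t))) x)
  - dt (fun s => divv (grad_ln (r s))) t x.
Proof.
have sl := smoothv_grad_ln.
have sg : smoothv (fun t => grad (divv (v t))) by apply: smoothv_grad; exact: smooth_divv.
pose b t x : 'rV[R]_d :=
  grad_ln (r t) x *m (gradv (v t) x)^T - v t x *m (gradv (grad_ln (r t)) x)^T.
have sb : smoothv b := smoothvB (smoothv_advection sl sv) (smoothv_advection sv sl).
have E1 := @divvB _ _ (fun t x => b t x - grad (divv (v t)) x + laplv (v t) x)
  (dtv (fun s => grad_ln (r s))) t x
  (smoothvD (smoothvB sb sg) (smoothv_laplv sv)) (smoothv_dtv sl).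
have E2 := @divvD _ _ (fun t x => b t x - grad (divv (v t)) x) (fun t => laplv (v t)) t x
  (smoothvB sb sg) (smoothv_laplv sv).
have E3 := @divvB _ _ b (fun t => grad (divv (v t))) t x sb sg.
have E4 := divv_bracket t x sv sl.
apply: (etrans E1); rewrite (divv_dtv t x sl); congr (_ - _).
apply: (etrans E2); rewrite (divv_laplv t x sv) E3 E4.
by rewrite subrK.
Qed.

End Density.

(** * Relative energy *)

Section Expansion.
Context {R : realType} {d : nat}.
Local Notation X := 'rV[R]_d.

(** By the Legendre identity [r H'(r) - H(r) = p(r)], the relative potential
  [H(rho|r)] is [H(rho) - rho H'(r) + p(r)]. *)
Lemma rel_energy_expand (kappa : R) (p : R -> R) (rbar : R) (rho r : X -> R)
    (u L v : X -> 'rV[R]_d) :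
  let l := grad_ln r in
  let h := derive1 (Hpot p rbar) in
  pressure_law p -> 0 < rbar -> (forall x, 0 < r x) ->
  tL1 (fun x => rho x * dotv (u x) (u x)) -> tL1 (fun x => rho x * dotv (L x) (L x)) ->
  tL1 (fun x => rho x * dotv (u x) (v x)) -> tL1 (fun x => rho x * dotv (L x) (l x)) ->
  tL1 (fun x => rho x * (2^-1 * dotv (v x) (v x))) ->
  tL1 (fun x => rho x * (2^-1 * dotv (l x) (l x))) ->
  tL1 (fun x => Hpot p rbar (rho x)) -> tL1 (fun x => rho x * h (r x)) ->
  tL1 (fun x => p (r x)) ->
  rel_energy kappa p rbar rho u L r v =
  energy kappa p rbar rho u L - torus_int (fun x => rho x * dotv (u x) (v x))
  + torus_int (fun x => rho x * (2^-1 * dotv (v x) (v x)))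
  - kappa * torus_int (fun x => rho x * dotv (L x) (l x))
  + kappa * torus_int (fun x => rho x * (2^-1 * dotv (l x) (l x)))
  - torus_int (fun x => rho x * h (r x)) + torus_int (fun x => p (r x)).
Proof.
move=> l h hp rbar0 r0 Iuu ILL Iuv ILl Ivv Ill IH Ih Ip.
rewrite /rel_energy /energy.
have Ek : torus_int (fun x => Hrel p rbar (rho x) (r x)) =
  torus_int (fun x => Hpot p rbar (rho x)) - torus_int (fun x => rho x * h (r x))
  + torus_int (fun x => p (r x)).
  rewrite -torus_intB// -torus_intD//; last exact: tL1B.
  by apply: torus_int_eq => x; rewrite /Hrel -(Hpot_pressure hp rbar0 (r0 x)) -/h; ring.
have IE : tL1 (fun x => rho x * dotv (u x) (u x) + kappa * rho x * dotv (L x) (L x)).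
  by apply: tL1D => //; under eq_fun do rewrite -mulrA; exact: tL1Z.
have Er : torus_int (fun x => rho x * dotv (u x - v x) (u x - v x)
     + kappa * rho x * dotv (L x - grad_ln r x) (L x - grad_ln r x)) =
  torus_int (fun x => rho x * dotv (u x) (u x) + kappa * rho x * dotv (L x) (L x))
  - 2 * torus_int (fun x => rho x * dotv (u x) (v x))
  + 2 * torus_int (fun x => rho x * (2^-1 * dotv (v x) (v x)))
  - 2 * kappa * torus_int (fun x => rho x * dotv (L x) (l x))
  + 2 * kappa * torus_int (fun x => rho x * (2^-1 * dotv (l x) (l x))).
  have I1 := tL1B IE (tL1Z 2 Iuv); have I2 := tL1D I1 (tL1Z 2 Ivv).
  have I3 := tL1B I2 (tL1Z (2 * kappa) ILl).
  rewrite -!torus_intZ// -torus_intB//; last exact: tL1Z.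
  rewrite -torus_intD//; last exact: tL1Z.
  rewrite -torus_intB//; last exact: tL1Z.
  rewrite -torus_intD//; last exact: tL1Z.
  apply: torus_int_eq => x; rewrite !dotvE (dotvC (v x) (u x)) (dotvC (grad_ln r x) (L x)) -/l.
  by field.
have gen (e0 a b c e H f g k : R) : 2^-1 * (e0 - 2 * a + 2 * b - 2 * k * c + 2 * k * e) + (H - f + g) =
    2^-1 * e0 + H - a + b - k * c + k * e - f + g by field.
by rewrite Ek Er; exact: gen.
Qed.

End Expansion.

Section RateIdentity.
Context {R : realType} {d : nat}.

(** The algebra of the proof at one point of space-time, where vectors and matrices are
  values of fields: [v'] and [l'] of time derivatives, [gdv], [gdl] and [gh] of the
  gradients of [div v], [div l] and [H'(r)], [lap] of the Laplacian of [v], [dA] of the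
  divergence of [A = S(Dv)], and [SG = S(Du)].  The right-hand side of the relative energy
  inequality, with the divisions by [r] carried out, is the rate [lhs] which the weak
  formulation yields, plus a term of monotonicity type, plus three integrands of
  divergence type. *)
Lemma rate_identity (kappa rho r pr prho dth p' dv dtdl : R)
    (u v L l v' l' gdv gdl lap gh dA : 'rV[R]_d) (G Dv Dl A SG : 'M[R]_d) :
  sym_mx A -> sym_mx Dl -> sym_mx SG ->
  let lhs :=
    - (rho * ddot SG (sympart G))
    - (rho * dotv u v' + rho * ddot (tensor u u) Dv - rho * ddot SG Dv + prho * dv
       + kappa * (rho * dotv L lap + rho * ddot (tensor L L) Dv))
    + (rho * dotv v v' + rho * dotv u (v *m Dv))
    + kappa * (rho * dtdl + rho * dotv u gdl)
    + kappa * (rho * dotv l l' + rho * dotv u (l *m Dl))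
    - (rho * dth + rho * dotv u gh) + r * dth in
  let mon := rho * ddot (SG - A) (sympart G - sympart Dv) in
  let stress := rho * dotv (u - v) dA + rho * ddot (G - Dv) A
    + rho * dotv (u - v) (L *m A^T) in
  let xi := l *m Dv^T - v *m Dl^T - gdv + lap - l' in
  let div_xi := dotv l gdv - dotv v gdl - dtdl in
  rho * ddot (tensor (u - v) (L - l)) A
  - rho * ddot (tensor (u - v) (u - v)) Dv
  - kappa * (rho * ddot (tensor (L - l) (L - l)) Dv)
  - rho * dotv (u - v) (v' + v *m Dv^T - (dA + l *m A^T) + gh - kappa *: (gdl + l *m Dl^T))
  - kappa * (rho * dotv (L - l) (l' + v *m Dl^T + (gdv + l *m Dv)))
  - (rho - r) * (dth + dotv v gh + p' * dv)
  - (prho - pr - p' * (rho - r)) * dv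
  = lhs + mon + (stress + kappa * (rho * div_xi + rho * dotv L xi) + (r * dotv v gh + pr * dv)).
Proof.
move=> sA sDl sG lhs mon stress xi div_xi.
rewrite /lhs /mon /stress /xi /div_xi !ddotBl !ddotBr !(ddot_sympart _ sA) !(ddot_sympart _ sG).
rewrite (ddotC G A) (ddotC Dv A) !ddot_tensor sA sDl !mulmxBl.
have trv a b : dotv b (a *m Dv) = dotv a (b *m Dv^T) by rewrite dotv_mulmx_tr.
have qA a b : dotv b (a *m A) = dotv a (b *m A) by rewrite -{1}sA dotv_mulmx_tr.
have qD a b : dotv b (a *m Dl) = dotv a (b *m Dl) by rewrite -{1}sDl dotv_mulmx_tr.
rewrite !dotvE !trv (qA L u) (qA L v) (qA l u) (qA l v) (qD l u) (qD v L) (qD v l).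
rewrite (dotvC l gdv) (dotvC v gdl) (dotvC u gdl) (dotvC u gh) (dotvC v gh).
clear lhs mon stress xi div_xi; ring.
Qed.
End RateIdentity.

Lemma ae_forall_ord {R : realType} n (P : 'I_n -> R -> Prop) :
  (forall i, {ae (@lebesgue_measure R), forall s, P i s}) ->
  {ae (@lebesgue_measure R), forall s, forall i, P i s}.
Proof.
move=> HP.
have Hk k : {ae (@lebesgue_measure R), forall s, forall i : 'I_n, val i = k -> P i s}.
  have [kn|nk] := ltnP k n.
    apply: ae_imp (HP (Ordinal kn)) => s H i E.
    by have -> : i = Ordinal kn; [exact: val_inj|exact: H].
  by apply: aeW => s i E; move: (ltn_ord i); rewrite [X in (X < _)%N]E ltnNge nk.
by apply: ae_imp (ae_foralln Hk) => s H i; exact: (H i i erefl).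
Qed.

Section RelativeEnergy.
Context {R : realType} {d : nat}.
Local Notation X := 'rV[R]_d.
Local Notation lambda := (@lebesgue_measure R).
Variables (kappa T : R) (S : 'M[R]_d -> 'M[R]_d) (p : R -> R) (rbar : R).
Variables (rho0 : X -> R) (u0 L0 : X -> 'rV[R]_d).
Variables (rho : R -> X -> R) (u L : R -> X -> 'rV[R]_d) (G : R -> X -> 'M[R]_d).
Variables (r : R -> X -> R) (v : R -> X -> 'rV[R]_d).
Hypothesis T0 : 0 < T.
Hypothesis hS : stress_law S.
Hypothesis hp : pressure_law p.
Hypothesis rbar0 : 0 < rbar.
Hypothesis hinit : initial_data rho0 u0.
Hypothesis hsol : weak_solution T kappa S p rho0 u0 L0 rho u L G.
Hypothesis hreg : sufficiently_regular T S p rbar rho0 L0 rho u L G.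
Let dissipation s x := rho s x * ddot (S (sympart (G s x))) (sympart (G s x)).
Hypothesis henergy : {ae lambda, forall t, 0 <= t <= T ->
  energy kappa p rbar (rho t) (u t) (L t) + st_int t dissipation
  <= energy kappa p rbar rho0 u0 L0}.
Hypothesis sr : smooth r.
Hypothesis r0 : forall t x, 0 < r t x.
Hypothesis sv : smoothv v.
Let l t := grad_ln (r t).
Let h := derive1 (Hpot p rbar).

Let sl : smoothv l.
Proof. exact: smoothv_grad_ln. Qed.

Let symS A : sym_mx A -> sym_mx (S A).
Proof. by case: hS => H _ _ _; exact: H. Qed.

Let dS A : differentiable (S \o sympart) A.
Proof. by case: hS. Qed.

Let rho_ge0 t x : 0 <= t <= T -> 0 <= rho t x.
Proof. by case: hsol => H _ _ _ _; exact: H. Qed.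

Let rho0_ge0 x : 0 <= rho0 x.
Proof. by case: hinit. Qed.

Let root1 : stL2 T (fun t x => Num.sqrt (rho t x) * 1).
Proof.
case: hreg => _ [H _ _] _ _ _.
rewrite (_ : (fun _ _ => _) = (fun t x => Num.sqrt (rho t x)))//.
by apply/funext => t; apply/funext => x; rewrite mulr1.
Qed.

Let rootu i : stL2 T (fun t x => Num.sqrt (rho t x) * u t x 0 i).
Proof. by case: hreg => _ [_ H _] _ _ _; exact: H. Qed.

Let rootL i : stL2 T (fun t x => Num.sqrt (rho t x) * L t x 0 i).
Proof. by case: hreg => _ [_ _ H] _ _ _; exact: H. Qed.

Let Irho : stL1 T rho.
Proof. by apply: stL1_eq (stL1_weighted rho_ge0 root1 root1) => t x _; rewrite !mulr1. Qed.

Let Iu : moment1 T rho u.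
Proof. by move=> i; apply: stL1_eq (stL1_weighted rho_ge0 (rootu i) root1) => t x _; rewrite mulr1. Qed.

Let IL : moment1 T rho L.
Proof. by move=> i; apply: stL1_eq (stL1_weighted rho_ge0 (rootL i) root1) => t x _; rewrite mulr1. Qed.

Let Iuu : moment2 T rho u u.
Proof. by move=> i j; exact: (stL1_weighted rho_ge0 (rootu i) (rootu j)). Qed.

Let ILL : moment2 T rho L L.
Proof. by move=> i j; exact: (stL1_weighted rho_ge0 (rootL i) (rootL j)). Qed.

Let IuL : moment2 T rho u L.
Proof. by move=> i j; exact: (stL1_weighted rho_ge0 (rootu i) (rootL j)). Qed.

Let Ip : stL1 T (fun t x => p (rho t x)).
Proof. by case: hreg => _ _ []. Qed.

Let IH : stL1 T (fun t x => Hpot p rbar (rho t x)).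
Proof. by case: hreg => _ _ []. Qed.

Let IS i j : stL1 T (fun t x => rho t x * S (sympart (G t x)) i j).
Proof. by case: hreg => _ _ _ [_ H _] _; exact: H. Qed.

Let Idiss : stL1 T dissipation.
Proof. by case: hreg => _ _ _ []. Qed.

Let hlog0 : log_grad rho0 L0.
Proof. by case: hsol. Qed.

Let Irho0 : tL1 rho0.
Proof. by case: hlog0. Qed.

Let root01 : tL2 (fun x => Num.sqrt (rho0 x) * 1).
Proof.
case: hinit => _ _ _ [H _] _; rewrite (_ : (fun x => _ * 1) = (fun x => Num.sqrt (rho0 x)))//.
by apply/funext => x; rewrite mulr1.
Qed.

Let root0u i : tL2 (fun x => Num.sqrt (rho0 x) * u0 x 0 i).
Proof. by case: hinit => _ _ _ _ H; exact: H. Qed.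

Let root0L i : tL2 (fun x => Num.sqrt (rho0 x) * L0 x 0 i).
Proof. by case: hreg => [[H _]] _ _ _ _; exact: H. Qed.

Let tL1_root (w : X -> 'rV[R]_d) : (forall i, tL2 (fun x => Num.sqrt (rho0 x) * w x 0 i)) ->
  (forall i, tL1 (fun x => rho0 x * w x 0 i)) /\ tL1 (fun x => rho0 x * dotv (w x) (w x)).
Proof.
move=> rw; split=> [i|].
  have := tL1_weighted rho0_ge0 (rw i) root01.
  rewrite (_ : (fun x => _ * (_ * 1)) = (fun x => rho0 x * w x 0 i))//.
  by apply/funext => x; rewrite mulr1.
rewrite (_ : (fun x => _) = (fun x => \sum_i rho0 x * (w x 0 i * w x 0 i))).
  by apply: tL1_sum => i; exact: (tL1_weighted rho0_ge0 (rw i) (rw i)).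
by apply/funext => x; rewrite /dotv mulr_sumr.
Qed.

Let kinetic (w : R -> X -> 'rV[R]_d) t x := 2^-1 * dotv (w t x) (w t x).

Let smooth_kinetic w : smoothv w -> smooth (kinetic w).
Proof. by move=> sw; apply: smoothM; [exact: smooth_cst|exact: smooth_dotv]. Qed.

Let dh (s : R) : 0 < s -> is_derive s 1 h (derive1 p s / s).
Proof. exact: is_derive_Hpot'. Qed.

Let hr t x := h (r t x).
Let pr t x := p (r t x).

Let chr : jcontinuous hr.
Proof. exact: (comp_jcontinuous sr r0 dh). Qed.

Let dp (s : R) : 0 < s -> is_derive s 1 p (derive1 p s).
Proof. by move=> s0; apply: DeriveDef; [exact: pressure_derivable|rewrite derive1E]. Qed.

Let cpr : jcontinuous pr.
Proof. exact: (comp_jcontinuous sr r0 dp). Qed.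

Let cp' (s : R) : 0 < s -> {for s, continuous (derive1 p)}.
Proof. exact: pressure'_continuous. Qed.

Let cdpr : jcontinuous (dt pr).
Proof. exact: (comp_jcontinuous_dt sr r0 dp cp'). Qed.

Let ch'' (s : R) : 0 < s -> {for s, continuous (fun s => derive1 p s / s)}.
Proof. exact: Hpot''_continuous. Qed.

Let cdhr : jcontinuous (dt hr).
Proof. exact: (comp_jcontinuous_dt sr r0 dh ch''). Qed.

Let cghr : jcontinuousv (fun t => grad (hr t)).
Proof.
move=> j; rewrite (_ : (fun _ _ => _) = (fun t => pd j (hr t))).
  by move=> z; exact: (comp_jcontinuous_pd sr r0 dh ch'').
by apply/funext => t; apply/funext => x; rewrite mxE.
Qed.

(** The rate of change of the relative energy that the weak formulation gives. *)
Definition energy_rate s x :=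
  - dissipation s x - momentum_rate kappa S p rho u L G v s x
  + transport rho u (kinetic v) s x
  + kappa * transport rho u (fun t => divv (l t)) s x
  + kappa * transport rho u (kinetic l) s x
  - transport rho u hr s x + dt pr s x.

Let Imom : stL1 T (momentum_rate kappa S p rho u L G v).
Proof. exact: stL1_momentum_rate. Qed.

Let Itv : stL1 T (transport rho u (kinetic v)).
Proof. by apply: smooth_stL1_transport => //; exact: smooth_kinetic. Qed.

Let Itdl : stL1 T (transport rho u (fun t => divv (l t))).
Proof. by apply: smooth_stL1_transport => //; exact: smooth_divv. Qed.

Let Itl : stL1 T (transport rho u (kinetic l)).
Proof. by apply: smooth_stL1_transport => //; exact: smooth_kinetic. Qed.

Let Ith : stL1 T (transport rho u hr).
Proof. by apply: stL1D; [exact: stL1M|exact: (stL1_dotv Iu cghr)]. Qed.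

Let J1 := stL1B (stL1N Idiss) Imom.
Let J2 := stL1D J1 Itv.
Let J3 := stL1D J2 (stL1Z kappa Itdl).
Let J4 := stL1D J3 (stL1Z kappa Itl).
Let J5 := stL1B J4 Ith.

Lemma stL1_energy_rate : stL1 T energy_rate.
Proof. exact: (stL1D J5 (stL1_jcontinuous T cdpr)). Qed.

Let st_int_energy_rate t : t <= T -> st_int t energy_rate =
  - st_int t dissipation - st_int t (momentum_rate kappa S p rho u L G v)
  + st_int t (transport rho u (kinetic v))
  + kappa * st_int t (transport rho u (fun t => divv (l t)))
  + kappa * st_int t (transport rho u (kinetic l))
  - st_int t (transport rho u hr) + st_int t (dt pr).
Proof.
move=> tT; rewrite (st_intD tT J5 (stL1_jcontinuous T cdpr)) (st_intB tT J4 Ith).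
rewrite (st_intD tT J3 (stL1Z kappa Itl)) (st_intD tT J2 (stL1Z kappa Itdl)).
rewrite (st_intD tT J1 Itv) (st_intB tT (stL1N Idiss) Imom) (st_intN tT Idiss).
by rewrite (st_intZ _ tT Itl) (st_intZ _ tT Itdl).
Qed.

Let slice_continuous (f : R -> X -> R) t : jcontinuous f -> continuous (f t).
Proof. by move=> cf; exact: (@jcontinuous_slice _ _ f t cf). Qed.

Let log_grad_l (q : X -> R) (M : X -> 'rV[R]_d) t : log_grad q M ->
  tL1 (fun x => q x * dotv (M x) (l t x)) /\
  torus_int (fun x => q x * dotv (M x) (l t x)) = - torus_int (fun x => q x * divv (l t) x).
Proof.
move=> hM; have [||j|I1 _ E] := @log_grad_ibp _ _ q M (l t) hM.
- by move=> j x; exact: (smooth_differentiable t x (sl j)).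
- by move=> j; exact: (sl j).2.
- exact: (@slice_continuous (fun t => pd j (fun x => l t x 0 j)) t (smooth_continuous (smooth_pd j (sl j)))).
by split.
Qed.

Let rel_energyE (q : X -> R) (w M : X -> 'rV[R]_d) t : log_grad q M ->
  tL1 q -> tL1 (fun x => q x * dotv (w x) (w x)) -> tL1 (fun x => q x * dotv (M x) (M x)) ->
  (forall i, tL1 (fun x => q x * w x 0 i)) -> tL1 (fun x => Hpot p rbar (q x)) ->
  rel_energy kappa p rbar q w M (r t) (v t) =
  energy kappa p rbar q w M - torus_int (fun x => q x * dotv (w x) (v t x))
  + torus_int (fun x => q x * kinetic v t x) + kappa * torus_int (fun x => q x * divv (l t) x)
  + kappa * torus_int (fun x => q x * kinetic l t x)
  - torus_int (fun x => q x * hr t x) + torus_int (pr t).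
Proof.
move=> hM Iq Iww IMM Iw IHq; have [IMl EMl] := log_grad_l t hM.
rewrite (rel_energy_expand kappa hp rbar0 (r0 t) Iww IMM _ IMl) ?EMl ?mulrN ?opprK//.
- by apply: tL1_dotv => // i; exact: (@slice_continuous (fun t x => v t x 0 i) t (smooth_continuous (sv i))).
- by apply: tL1M => //; exact: (@slice_continuous (kinetic v) t (smooth_continuous (smooth_kinetic sv))).
- by apply: tL1M => //; exact: (@slice_continuous (kinetic l) t (smooth_continuous (smooth_kinetic sl))).
- by apply: tL1M => //; exact: (@slice_continuous hr t chr).
- by apply: tL1_continuous; exact: (@slice_continuous pr t cpr).
Qed.

Let rel_energy0 : rel_energy kappa p rbar rho0 u0 L0 (r 0) (v 0) =
  energy kappa p rbar rho0 u0 L0 - torus_int (fun x => rho0 x * dotv (u0 x) (v 0 x))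
  + torus_int (fun x => rho0 x * kinetic v 0 x) + kappa * torus_int (fun x => rho0 x * divv (l 0) x)
  + kappa * torus_int (fun x => rho0 x * kinetic l 0 x)
  - torus_int (fun x => rho0 x * hr 0 x) + torus_int (pr 0).
Proof.
have [Iw Iww] := tL1_root root0u; have [_ IMM] := tL1_root root0L.
by apply: rel_energyE => //; case: hreg => [[]].
Qed.

Let rel_energyt : {ae lambda, forall t, 0 <= t <= T ->
  rel_energy kappa p rbar (rho t) (u t) (L t) (r t) (v t) =
  energy kappa p rbar (rho t) (u t) (L t) - torus_int (fun x => rho t x * dotv (u t x) (v t x))
  + torus_int (fun x => rho t x * kinetic v t x) + kappa * torus_int (fun x => rho t x * divv (l t) x)
  + kappa * torus_int (fun x => rho t x * kinetic l t x)
  - torus_int (fun x => rho t x * hr t x) + torus_int (pr t)}.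
Proof.
have A1 : {ae lambda, forall t, 0 <= t <= T -> log_grad (rho t) (L t) /\ velocity_grad (rho t) (L t) (u t) (G t)}.
  by case: hsol.
have A2 := stL1_slice (stL1_dotv2 Iuu); have A3 := stL1_slice (stL1_dotv2 ILL).
have A4 := ae_forall_ord (fun i => stL1_slice (Iu i)).
have B1 := ae_imp2 (fun t a b => conj a b) A1 A2.
have B2 := ae_imp2 (fun t a b => conj a b) B1 A3.
have B3 := ae_imp2 (fun t a b => conj a b) B2 A4.
have B4 := ae_imp2 (fun t a b => conj a b) (stL1_slice IH) (stL1_slice Irho).
apply: ae_imp2 B3 B4 => t [[[a1 a2] a3] a4] [a5 a6] tT.
by apply: rel_energyE; [exact: (a1 tT).1|exact: a6|exact: a2|exact: a3|by move=> i; exact: a4|exact: a5].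
Qed.

(** The energy obeys its inequality, and each of the other terms of [rel_energyE]
  evolves by the equation tested with the corresponding function. *)
Lemma rel_energy_balance : {ae lambda, forall t, 0 <= t <= T ->
  rel_energy kappa p rbar (rho t) (u t) (L t) (r t) (v t)
  - rel_energy kappa p rbar rho0 u0 L0 (r 0) (v 0) <= st_int t energy_rate}.
Proof.
have hcont : weak_continuity T rho0 rho u by case: hsol => _ _ _ _ [].
have hmom : weak_momentum T kappa S p rho0 u0 rho u L G by case: hsol => _ _ _ _ [].
have cont phi (sphi : smooth phi) := smooth_continuity T0 Irho0 Irho Iu hcont sphi.
have C1 := momentum_identity T0 (tL1_root root0u).1 Iu IL Iuu ILL Ip IS hmom sv.
have C2 := cont _ (smooth_kinetic sv).
have C3 := cont _ (smooth_divv sl).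
have C4 := cont _ (smooth_kinetic sl).
have C5 := C1_continuity T0 rho0_ge0 rho_ge0 Irho0 Irho Iu hcont sr r0 dh ch''
  (Hpot''_lipschitz hp).
have B1 := ae_imp2 (fun t a b => conj a b) C1 C2.
have B2 := ae_imp2 (fun t a b => conj a b) B1 C3.
have B3 := ae_imp2 (fun t a b => conj a b) B2 C4.
have B4 := ae_imp2 (fun t a b => conj a b) B3 C5.
have B5 := ae_imp2 (fun t a b => conj a b) rel_energyt henergy.
apply: ae_imp2 B4 B5 => t [[[[e1 e2] e3] e4] e5] [e6 e7] tT.
have /andP[t0 tT'] := tT.
have e8 : torus_int (pr t) - torus_int (pr 0) = st_int t (dt pr).
  by apply: torus_int_FTC => // s x; exact: (comp_derivable_dt sr r0 dp).
have {}e1 := e1 tT; have {}e2 := e2 tT; have {}e3 := e3 tT; have {}e4 := e4 tT.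
have {}e5 := e5 tT; have {}e6 := e6 tT; have {}e7 := e7 tT.
have gen (RT R0 I E E0 D A A0 a B B0 b C C0 c K K0 k H H0 m P P0 q : R) :
    A = A0 + a -> B = B0 + b -> C = C0 + c -> K = K0 + k -> H = H0 + m -> P - P0 = q ->
    RT = E - A + B + kappa * C + kappa * K - H + P ->
    R0 = E0 - A0 + B0 + kappa * C0 + kappa * K0 - H0 + P0 ->
    I = - D - a + b + kappa * c + kappa * k - m + q -> E + D <= E0 -> RT - R0 <= I.
  move=> -> -> -> -> -> <- -> -> ->; rewrite -subr_ge0 => le; rewrite -subr_ge0.
  by apply: le_trans le _; rewrite le_eqVlt; apply/orP; left; apply/eqP; ring.
exact: (gen _ _ _ _ _ _ _ _ _ _ _ _ _ _ _ _ _ _ _ _ _ _ _ _ e1 e2 e3 e4 e5 e8 e6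
  rel_energy0 (st_int_energy_rate tT') e7).
Qed.

Let A t x := S (symgrad (v t) x).
Let U t x : 'rV[R]_d := u t x - v t x.
Let M t x : 'rV[R]_d := L t x - l t x.

Let cv := smoothv_jcontinuous sv.
Let cl := smoothv_jcontinuous sl.
Let IM := moment1B Irho IL cl.
Let IUM := moment2B Irho Iu IL IuL cv cl.
Let IUU := moment2B Irho Iu Iu Iuu cv cv.
Let IMM := moment2B Irho IL IL ILL cl cl.

Let cA i j : jcontinuous (fun t x => A t x i j).
Proof. exact: (stress_jcontinuous dS sv). Qed.

Let cD i j : jcontinuous (fun t x => gradv (v t) x i j).
Proof. exact: (smooth_continuous (smooth_gradv i j sv)). Qed.

Let dgradv t i j x : differentiable (fun y => gradv (v t) y i j) x.
Proof. exact: (smooth_differentiable t x (smooth_gradv i j sv)). Qed.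

Let dA t i j x : differentiable (fun y => A t y i j) x.
Proof. by apply: (stress_differentiable dS) => k m y; exact: dgradv. Qed.

Let IdA i j : stL1 T (fun t x => rho t x * pd j (fun y => A t y i j) x).
Proof. by case: hreg => _ _ _ _ H; have [] := H v sv i j. Qed.

Let IudA i j : stL1 T (fun t x => rho t x * u t x 0 i * pd j (fun y => A t y i j) x).
Proof. by case: hreg => _ _ _ _ H; have [] := H v sv i j. Qed.

(** The bracketed vectors of the remainder with the divisions by [r] carried out. *)
Let momentum_defect t x : 'rV[R]_d :=
  dtv v t x + v t x *m (gradv (v t) x)^T - (divm (A t) x + l t x *m (A t x)^T)
  + grad (hr t) x - kappa *: (grad (divv (l t)) x + l t x *m (gradv (l t) x)^T).

Let drift_defect t x : 'rV[R]_d :=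
  dtv l t x + v t x *m (gradv (l t) x)^T + (grad (divv (v t)) x + l t x *m gradv (v t) x).

Let momentum_bracket t x : 'rV[R]_d :=
  dtv v t x + advect (v t x) (v t) x
  - (r t x)^-1 *: divm (fun y => r t y *: S (symgrad (v t) y)) x
  + (r t x)^-1 *: grad (fun y => p (r t y)) x
  - (kappa * (r t x)^-1) *: divm (fun y => r t y *: hess (fun z => ln (r t z)) y) x.

Let drift_bracket t x : 'rV[R]_d :=
  dtv (fun s y => grad_ln (r s) y) t x + advect (v t x) (grad_ln (r t)) x
  + (r t x)^-1 *: divm (fun y => r t y *: (gradv (v t) y)^T) x.

Let momentum_bracketE t x : momentum_bracket t x = momentum_defect t x.
Proof.
have rn0 : r t x != 0 by rewrite gt_eqF.
rewrite /momentum_bracket -scalerA advectE (divm_weighted sr r0); last by move=> i j; exact: (diff_derivable (dA t i j x)).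
rewrite (divm_weighted sr r0); last first.
  by move=> i j; exact: (smooth_derivable_pd t x j (smooth_gradv i j sl)).
rewrite (grad_pressure sr r0 hp rbar0 t x) scalerA mulVf// scale1r.
by rewrite (divm_hess t x (smooth_ln r0 sr)).
Qed.

Let drift_bracketE t x : drift_bracket t x = drift_defect t x.
Proof.
rewrite /drift_bracket advectE (divm_weighted sr r0); last first.
  by move=> i j; exact: (smooth_derivable_pd t x j (smooth_gradv_tr i j sv)).
by rewrite divm_gradv_tr// trmxK.
Qed.

Let f1 s x := rho s x * ddot (tensor (U s x) (M s x)) (A s x).
Let f2 s x := rho s x * ddot (tensor (U s x) (U s x)) (gradv (v s) x).
Let f3 s x := rho s x * ddot (tensor (M s x) (M s x)) (gradv (v s) x).
Let f4 s x := rho s x * dotv (U s x) (momentum_bracket s x).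
Let f5 s x := rho s x * dotv (M s x) (drift_bracket s x).
Let f6 s x := (rho s x - r s x) *
  (dt hr s x + dotv (v s x) (grad (hr s) x) + derive1 p (r s x) * divv (v s) x).
Let f7 s x := (p (rho s x) - p (r s x) - derive1 p (r s x) * (rho s x - r s x)) * divv (v s) x.

Let I1 : stL1 T f1. Proof. exact: stL1_ddot. Qed.
Let I2 : stL1 T f2. Proof. exact: stL1_ddot. Qed.
Let I3 : stL1 T f3. Proof. exact: stL1_ddot. Qed.

Let cmulmx (a : R -> X -> 'rV[R]_d) (B : R -> X -> 'M[R]_d) : jcontinuousv a ->
  (forall i j, jcontinuous (fun t x => B t x i j)) -> jcontinuousv (fun t x => a t x *m B t x).
Proof.
move=> ca cB j.
rewrite (_ : (fun _ _ => _) = fun t x => \sum_k a t x 0 k * B t x k j).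
  by apply: jcontinuous_sum => k; apply: jcontinuousM; [exact: ca|exact: cB].
by apply/funext => t; apply/funext => x; rewrite mxE.
Qed.

Let IU := moment1B Irho Iu cv.

Let I4 : stL1 T f4.
Proof.
pose c t x : 'rV[R]_d := dtv v t x + v t x *m (gradv (v t) x)^T
  - kappa *: (grad (divv (l t)) x + l t x *m (gradv (l t) x)^T).
have sc : jcontinuousv c.
  have s1 := smoothvD (smoothv_dtv sv) (smoothv_advection sv sv).
  have s2 := smoothvD (smoothv_grad (smooth_divv sl)) (smoothv_advection sl sl).
  move=> i; rewrite (_ : (fun _ _ => _) = fun t x =>
    (dtv v t x + v t x *m (gradv (v t) x)^T) 0 i
    - kappa * (grad (divv (l t)) x + l t x *m (gradv (l t) x)^T) 0 i).
    apply: jcontinuousB; first exact: (smooth_continuous (s1 i)).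
    by apply: jcontinuousM; [exact: jcontinuous_cst|exact: (smooth_continuous (s2 i))].
  by apply/funext => t; apply/funext => x; rewrite /c !mxE.
have cAt i j : jcontinuous (fun t x => (A t x)^T i j).
  rewrite (_ : (fun _ _ => _) = fun t x => A t x j i); first exact: cA.
  by apply/funext => t; apply/funext => x; rewrite mxE.
have K1 := stL1_dotv IU sc; have K2 := stL1_dotv IU (cmulmx cl cAt); have K3 := stL1_dotv IU cghr.
have K4 i j := stL1B (IudA i j) (stL1M (IdA i j) (smooth_continuous (sv i))).
have K5 := stL1_sum (index_enum _) (fun i => stL1_sum (index_enum _) (fun j => K4 i j)).
apply: stL1_eq (stL1D (stL1B K1 (stL1D K5 K2)) K3) => t x _.
have E : \sum_i \sum_j (rho t x * u t x 0 i * pd j (fun y => A t y i j) x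
    - rho t x * pd j (fun y => A t y i j) x * v t x 0 i) = rho t x * dotv (U t x) (divm (A t) x).
  rewrite /dotv mulr_sumr; apply: eq_bigr => i _; rewrite !mxE !mulr_sumr.
  by apply: eq_bigr => j _; ring.
rewrite E /f4 momentum_bracketE /momentum_defect /c -/(U t x); move: (U t x) => w; rewrite !dotvE; ring.
Qed.

Let I5 : stL1 T f5.
Proof.
apply: stL1_eq (fun t x _ => congr1 (fun w => rho t x * dotv (M t x) w) (esym (drift_bracketE t x))) _.
apply: (stL1_dotv IM); apply: smoothv_jcontinuous.
have s1 := smoothvD (smoothv_dtv sl) (smoothv_advection sv sl).
have s2 := smoothv_mulmx sl (fun i j => smooth_gradv i j sv).
exact: (smoothvD s1 (smoothvD (smoothv_grad (smooth_divv sv)) s2)).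
Qed.

Let cdivv := smooth_continuous (smooth_divv sv).
Let cr := smooth_continuous sr.

Let cp'r : jcontinuous (fun t x => derive1 p (r t x)).
Proof. by apply: jcontinuous_comp => // t x; exact: cp'. Qed.

Let I6 : stL1 T f6.
Proof.
apply: stL1M; first exact: (stL1B Irho (stL1_jcontinuous T cr)).
apply: jcontinuousD; last exact: jcontinuousM.
apply: jcontinuousD => //; apply: jcontinuous_sum => i; apply: jcontinuousM; first exact: cv.
exact: cghr.
Qed.

Let I7 : stL1 T f7.
Proof.
apply: stL1M => //; apply: stL1B; first exact: (stL1B Ip (stL1_jcontinuous T cpr)).
by apply: stL1Ml => //; exact: (stL1B Irho (stL1_jcontinuous T cr)).
Qed.

Let K2 := stL1B I1 I2.
Let K3 := stL1B K2 (stL1Z kappa I3).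
Let K4 := stL1B K3 I4.
Let K5 := stL1B K4 (stL1Z kappa I5).
Let K6 := stL1B K5 I6.
Let K7 := stL1B K6 I7.

Let remainder s x := f1 s x - f2 s x - kappa * f3 s x - f4 s x - kappa * f5 s x - f6 s x - f7 s x.

Let st_int_remainder t : t <= T -> st_int t remainder =
  st_int t f1 - st_int t f2 - kappa * st_int t f3 - st_int t f4 - kappa * st_int t f5
  - st_int t f6 - st_int t f7.
Proof.
move=> tT; rewrite (st_intB tT K6 I7) (st_intB tT K5 I6) (st_intB tT K4 (stL1Z kappa I5)).
rewrite (st_intB tT K3 I4) (st_intB tT K2 (stL1Z kappa I3)) (st_intB tT I1 I2).
by rewrite (st_intZ _ tT I3) (st_intZ _ tT I5).
Qed.

Let monotone_part s x := rho s x *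
  ddot (S (sympart (G s x)) - A s x) (sympart (G s x) - sympart (gradv (v s) x)).

Let stress_part s x := rho s x * dotv (U s x) (divm (A s) x)
  + rho s x * ddot (G s x - gradv (v s) x) (A s x) + rho s x * dotv (U s x) (L s x *m (A s x)^T).

Let korteweg_part s x := rho s x * divv (capillary_field r v s) x + rho s x * dotv (L s x) (capillary_field r v s x).

Let pressure_part s x := r s x * dotv (v s x) (grad (hr s) x) + p (r s x) * divv (v s) x.

Let remainderE s x : remainder s x = energy_rate s x + monotone_part s x
  + (stress_part s x + kappa * korteweg_part s x + pressure_part s x).
Proof.
have sDl : sym_mx (gradv (l s) x) := gradv_grad_sym s x (smooth_ln r0 sr).
have sA : sym_mx (A s x) := symS (sym_sympart _).
have sG : sym_mx (S (sympart (G s x))) := symS (sym_sympart _).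
have E := @rate_identity R d kappa (rho s x) (r s x) (p (r s x)) (p (rho s x))
  (dt hr s x) (derive1 p (r s x)) (divv (v s) x) (dt (fun t => divv (l t)) s x)
  (u s x) (v s x) (L s x) (l s x) (dtv v s x) (dtv l s x) (grad (divv (v s)) x)
  (grad (divv (l s)) x) (laplv (v s) x) (grad (hr s) x) (divm (A s) x)
  (G s x) (gradv (v s) x) (gradv (l s) x) (A s x) (S (sympart (G s x))) sA sDl sG.
rewrite /korteweg_part (divv_capillary_field sr r0 sv).
rewrite /remainder /f4 /f5 momentum_bracketE drift_bracketE.
apply: (etrans E); congr (_ + _ + _).
rewrite /energy_rate /transport /momentum_rate /dissipation.
by rewrite !half_norm_dt// !half_norm_grad// (dt_pressure sr r0 hp rbar0).
Qed.

Let monotone_part_ge0 s x : 0 <= s <= T -> 0 <= monotone_part s x.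
Proof.
move=> sT; apply: mulr_ge0; first exact: rho_ge0.
by case: hS => _ _ _; apply; exact: sym_sympart.
Qed.

Let korteweg_part0 s : log_grad (rho s) (L s) ->
  tL1 (korteweg_part s) /\ torus_int (korteweg_part s) = 0.
Proof.
move=> hL; have sb := smoothv_capillary_field sr r0 sv.
have [||j|F1 F2 E] := @log_grad_ibp _ _ (rho s) (L s) (capillary_field r v s) hL.
- by move=> j x; exact: (smooth_differentiable s x (sb j)).
- by move=> j; exact: (sb j).2.
- exact: (@slice_continuous (fun t => pd j (fun x => capillary_field r v t x 0 j)) s
    (smooth_continuous (smooth_pd j (sb j)))).
by split; [exact: tL1D|rewrite torus_intD// E subrr].
Qed.

Let cdv t i j : continuous (pd j (fun y => v t y 0 i)).
Proof.
exact: (@slice_continuous (fun t => pd j (fun x => v t x 0 i)) t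
  (smooth_continuous (smooth_pd j (sv i)))).
Qed.

Let stress_part0 : {ae lambda, forall s, 0 <= s <= T ->
  [/\ log_grad (rho s) (L s), tL1 (stress_part s) & torus_int (stress_part s) = 0]}.
Proof.
have A1 : {ae lambda, forall t, 0 <= t <= T ->
    log_grad (rho t) (L t) /\ velocity_grad (rho t) (L t) (u t) (G t)} by case: hsol.
have A2 := ae_forall_ord (fun i => ae_forall_ord (fun j => stL1_slice (IdA i j))).
have A3 := ae_forall_ord (fun i => ae_forall_ord (fun j => stL1_slice (IudA i j))).
apply: ae_imp2 A1 (ae_imp2 (fun s a b => conj a b) A2 A3) => s a1 [a2 a3] sT.
have [b1 b2] := a1 sT.
have [] := @stress_null _ _ (rho s) (L s) (u s) (v s) (G s) (A s) b1 b2 (dA s) _ _ _ (fun i j => @cdv s i j)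
  (fun i j => a2 i j sT) (fun i j => a3 i j sT).
- by move=> i j; apply: tperiodic_stress => k; exact: (sv k).2.
- by move=> i x; exact: (smooth_differentiable s x (sv i)).
- by move=> i; exact: (sv i).2.
by split.
Qed.

Let torus_int_rate_le : {ae lambda, forall s, 0 <= s <= T ->
  torus_int (energy_rate s) <= torus_int (remainder s)}.
Proof.
have B := ae_imp2 (fun s a b => conj a b) (stL1_slice stL1_energy_rate) (stL1_slice K7).
apply: ae_imp2 stress_part0 B => s a [b1 b2] sT.
have [hL IS0 S0] := a sT; have [IK K0] := korteweg_part0 hL.
have [IPr Pr0] := pressure_flux sr r0 sv hp rbar0 s.
pose N x := stress_part s x + kappa * korteweg_part s x + pressure_part s x.
have IN : tL1 N by apply: tL1D => //; apply: tL1D => //; exact: tL1Z.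
have N0 : torus_int N = 0.
  have IZ := tL1Z kappa IK.
  by rewrite (torus_intD (tL1D IS0 IZ) IPr) (torus_intD IS0 IZ) (torus_intZ _ IK) S0 K0 Pr0 mulr0 !addr0.
have {}b1 := b1 sT; have {}b2 : tL1 (remainder s) := b2 sT.
rewrite -[leRHS]subr0 -N0 -(torus_intB b2 IN); apply: torus_int_le => //; first exact: tL1B.
move=> x; rewrite remainderE -/(N x) addrK lerDl; exact: monotone_part_ge0.
Qed.

(** The remainder exceeds [energy_rate] by a nonnegative term and by integrands whose
  integral over the torus is zero at almost every time. *)
Lemma rel_energy_inequality : {ae lambda, forall t, 0 <= t <= T ->
  rel_energy kappa p rbar (rho t) (u t) (L t) (r t) (v t)
  - rel_energy kappa p rbar rho0 u0 L0 (r 0) (v 0) <=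
  st_int t f1 - st_int t f2 - kappa * st_int t f3 - st_int t f4 - kappa * st_int t f5
  - st_int t f6 - st_int t f7}.
Proof.
apply: ae_imp rel_energy_balance => t H tT; have /andP[_ tT'] := tT.
apply: le_trans (H tT) _; rewrite -(st_int_remainder tT').
exact: (st_int_le tT' stL1_energy_rate K7 torus_int_rate_le).
Qed.

End RelativeEnergy.

Theorem proposition2p2 (R : realType) (d : nat) (hd : d = 2%N \/ d = 3%N)
  (kappa T : R) (hkappa : 0 < kappa) (hT : 0 < T)
  (S : 'M[R]_d -> 'M[R]_d) (hS : stress_law S)
  (p : R -> R) (hp : pressure_law p)
  (rbar : R) (hrbar : 0 < rbar)
  (rho0 : 'rV[R]_d -> R) (u0 L0 : 'rV[R]_d -> 'rV[R]_d)
  (h0 : initial_data rho0 u0)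
  (rho : R -> 'rV[R]_d -> R) (u L : R -> 'rV[R]_d -> 'rV[R]_d)
  (G : R -> 'rV[R]_d -> 'M[R]_d)
  (hsol : weak_solution T kappa S p rho0 u0 L0 rho u L G)
  (hreg : sufficiently_regular T S p rbar rho0 L0 rho u L G)
  (henergy : {ae (@lebesgue_measure R), forall t, 0 <= t <= T ->
     energy kappa p rbar (rho t) (u t) (L t)
     + st_int t (fun s x => rho s x *
         ddot (S (sympart (G s x))) (sympart (G s x)))
     <= energy kappa p rbar rho0 u0 L0}) :
  forall (r : R -> 'rV[R]_d -> R) (v : R -> 'rV[R]_d -> 'rV[R]_d),
  smooth r -> (forall t x, 0 < r t x) -> smoothv v ->
  {ae (@lebesgue_measure R), forall t, 0 <= t <= T ->
    rel_energy kappa p rbar (rho t) (u t) (L t) (r t) (v t)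
    - rel_energy kappa p rbar rho0 u0 L0 (r 0) (v 0)
    <=
    st_int t (fun s x => rho s x *
      ddot (tensor (u s x - v s x) (L s x - grad_ln (r s) x))
           (S (symgrad (v s) x)))
    - st_int t (fun s x => rho s x *
        ddot (tensor (u s x - v s x) (u s x - v s x)) (gradv (v s) x))
    - kappa * st_int t (fun s x => rho s x *
        ddot (tensor (L s x - grad_ln (r s) x) (L s x - grad_ln (r s) x))
             (gradv (v s) x))
    - st_int t (fun s x => rho s x *
        dotv (u s x - v s x)
          (dtv v s x + advect (v s x) (v s) x
           - (r s x)^-1 *: divm (fun y => r s y *: S (symgrad (v s) y)) x
           + (r s x)^-1 *: grad (fun y => p (r s y)) x
           - (kappa * (r s x)^-1) *:
               divm (fun y => r s y *: hess (fun z => ln (r s z)) y) x))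
    - kappa * st_int t (fun s x => rho s x *
        dotv (L s x - grad_ln (r s) x)
          (dtv (fun s' y => grad_ln (r s') y) s x
           + advect (v s x) (grad_ln (r s)) x
           + (r s x)^-1 *: divm (fun y => r s y *: (gradv (v s) y)^T) x))
    - st_int t (fun s x => (rho s x - r s x) *
        (dt (fun s' y => derive1 (Hpot p rbar) (r s' y)) s x
         + dotv (v s x) (grad (fun y => derive1 (Hpot p rbar) (r s y)) x)
         + derive1 p (r s x) * divv (v s) x))
    - st_int t (fun s x =>
        (p (rho s x) - p (r s x) - derive1 p (r s x) * (rho s x - r s x))
        * divv (v s) x)}.
Proof.
move=> r v sr r0 sv.
exact: (rel_energy_inequality hT hS hp hrbar h0 hsol hreg henergy sr r0 sv).
Qed.
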